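(* The cohomology $H^*(X_0;\mathbb{E}_0)$ can be computed from the complex $$0\to\bigoplus_{\sigma\in R_0}E^{\mathrm{Stab}_\Gamma(\sigma)}\to\bigoplus_{\sigma\in R_1}E^{\mathrm{Stab}_\Gamma(\sigma)}\to\cdots\to\bigoplus_{\sigma\in R_N}E^{\mathrm{Stab}_\Gamma(\sigma)}\to0,\qquad N=\dim D_0,$$ where the differential $d:\bigoplus_{\sigma\in R_{p-1}}E^{\mathrm{Stab}_\Gamma(\sigma)}\to\bigoplus_{\sigma\in R_p}E^{\mathrm{Stab}_\Gamma(\sigma)}$ is given by $$(dv)_\sigma=\sum_{\tau\text{ a }(p-1)\text{-cell in }\partial\sigma}\mathrm{sgn}_\sigma(\tau)\,\rho(\gamma_\tau)\,v_{[\tau]},$$ $v_{[\tau]}$ being the $[\tau]$-component of $v\in\bigoplus_{\sigma\in R_{p-1}}E^{\mathrm{Stab}_\Gamma(\sigma)}$.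
   Context: Let $D=G/K$ be a non-compact symmetric space, where $G$ is the group of real points of a semisimple linear algebraic group defined over $\mathbb{Q}$, and let $\Gamma$ be an arithmetic subgroup of $G(\mathbb{Q})$. Let $D_0\subset D$ be a spine, i.e. a $\Gamma$-equivariant deformation retract of $D$ of dimension equal to the virtual cohomological dimension of $\Gamma$, with a CW-structure such that the $\Gamma$-stabilizer of a cell fixes the cell pointwise. Put $X_0=\Gamma\backslash D_0$ with projection $\pi_0:D_0\to X_0$. Let $(E,\rho)$ be a $\Gamma$-module, $\rho:\Gamma\to\mathrm{GL}(E)$; for a subgroup $S\subseteq\Gamma$, $E^S$ denotes the $\rho(S)$-fixed elements. $\mathbb{E}_0$ is the sheaf on $X_0$ associated to the presheaf $U\mapsto\{f:\pi_0^{-1}(U)\to E: f\text{ locally constant},\ f(\gamma x)=\rho(\gamma)f(x)\ \forall\gamma\in\Gamma,\ x\in\pi_0^{-1}(U)\}$. For each $p$ fix a set $R_p$ of representatives of $\Gamma$-conjugacy classes of $p$-cells of $D_0$; $[\tau]$ denotes the representative of the class of a cell $\tau$. For each representative $[\tau]$ (a $p$-cell) fix a distinguished maximal flag of cells $F_{[\tau]}=\tau_0<\tau_1<\cdots<\tau_p$, with $\tau_i$ an $i$-cell and $\tau_p=[\tau]$. For each cell $\tau$ let $\gamma_\tau\in\Gamma$ be such that $\gamma_\tau\cdot F_{[\tau]}$ terminates in $\tau$ (it is well-defined up to $\mathrm{Stab}_\Gamma(\tau)$). For a $p$-cell $\sigma$ let $S_\sigma$ be the simplicial complex of the poset of cells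 contained in (the closure of) $\sigma$, ordered by containment: its vertices are these cells and its $k$-simplices are the flags $\sigma_0<\cdots<\sigma_k$, oriented by this order. Let $n_\sigma:\{p\text{-simplices of }S_\sigma\}\to\{\pm1\}$ be defined by $\partial S_\sigma=\sum_F n_\sigma(F)\,\partial F$ (sum over $p$-simplices $F$), i.e. by requiring that the boundary of the chain $\sum_F n_\sigma(F)F$ be supported on the subdivision of $\partial\sigma$, and normalized (multiplying by $-1$ if necessary) so that $n_\sigma(\gamma_\sigma F_{[\sigma]})=(-1)^p$. For a $(p-1)$-cell $\tau$ in $\partial\sigma$ set $\mathrm{sgn}_\sigma(\tau)=n_\sigma(\gamma_\tau F_{[\tau]}<\sigma)$, where $\gamma_\tau F_{[\tau]}<\sigma$ is the flag obtained by appending $\sigma$.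
   Formalization: The CW-structure on D_0 is assumed regular (closed cells are embedded balls), as S_σ and n_σ require; and the direct sums over R_p are read as products, which agree when R_p is finite (the claim fails for infinite R_p with direct sums). *)

(* Defs.v *)
From HB Require Import structures.
From mathcomp Require Import all_boot all_order all_algebra generic_quotient.
From mathcomp Require Import ring_quotient finmap.
From mathcomp Require Import all_classical all_reals topology.
From mathcomp Require Import complex.
From mathcomp Require mpoly.
From Stdlib Require Relation_Operators.

Set Implicit Arguments.
Unset Strict Implicit.
Unset Printing Implicit Defensive.

Import Order.TTheory GRing.Theory Num.Theory numFieldTopology.Exports.
Local Open Scope classical_set_scope.
Local Open Scope ring_scope.

Record submodule (k : nzRingType) (V : lmodType k) := Submodule {
  scarrier : set V;
  submodule0 : scarrier 0;
  submoduleP : forall (a : k) x y,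
    scarrier x -> scarrier y -> scarrier (a *: x + y) }.

Section submodule_theory.
Context {k : nzRingType} {V : lmodType k}.
Implicit Type S : submodule V.

Definition submod_pred S : {pred V} := fun x => `[< scarrier S x >].

Fact submod_pred_closed S : submod_closed (submod_pred S).
Proof.
split; first by apply/asboolP; exact: submodule0.
move=> a x y /asboolP Sx /asboolP Sy; apply/asboolP; exact: submoduleP.
Qed.

HB.instance Definition _ S :=
  GRing.isSubmodClosed.Build k V (submod_pred S) (submod_pred_closed S).

Definition submod_type S : Type := {x : V | x \in submod_pred S}.

HB.instance Definition _ S := SubChoice.on (submod_type S).
HB.instance Definition _ S := [SubChoice_isSubLmodule of submod_type S by <:].

Definition quot_module S : Type := Quotient.quot (submod_pred S).

HB.instance Definition _ S := GRing.Zmodule.on (quot_module S).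

Local Notation piQ S := (\pi_(Quotient.quot (submod_pred S)))%qT.

Fact quot_eq S (x y : V) : (x - y \in submod_pred S) = (piQ S x == piQ S y).
Proof. exact: Quotient.idealrBE. Qed.

Definition quot_scale S (a : k) (x : quot_module S) : quot_module S :=
  piQ S (a *: repr x).

Fact quot_scale_pi S a (x : V) : quot_scale a (piQ S x) = piQ S (a *: x).
Proof.
apply/eqP; rewrite -quot_eq -scalerBr rpredZ // quot_eq.
by apply/eqP; exact: reprK.
Qed.

Fact quot_scaleA S a b (x : quot_module S) :
  quot_scale a (quot_scale b x) = quot_scale (a * b) x.
Proof. by rewrite [quot_scale b x]/quot_scale quot_scale_pi scalerA. Qed.

Fact quot_scale1 S : left_id 1 (@quot_scale S).
Proof. by move=> x; rewrite /quot_scale scale1r; exact: reprK. Qed.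

Fact quot_piD S (x y : V) :
  piQ S (x + y) = (piQ S x : quot_module S) + piQ S y.
Proof. exact: Quotient.pi_add. Qed.

Fact quot_scaleDr S : right_distributive (@quot_scale S) +%R.
Proof.
move=> a x y; rewrite -[x]reprK -[y]reprK.
by rewrite -quot_piD !quot_scale_pi scalerDr quot_piD.
Qed.

Fact quot_scaleDl S (x : quot_module S) :
  {morph (@quot_scale S)^~ x : a b / a + b}.
Proof.
by move=> a b; rewrite -[x]reprK !quot_scale_pi scalerDl quot_piD.
Qed.

HB.instance Definition _ S := GRing.Zmodule_isLmodule.Build k (quot_module S)
  (@quot_scaleA S) (@quot_scale1 S) (@quot_scaleDr S) (@quot_scaleDl S).
End submodule_theory.

Definition isomorphic (k : nzRingType) (V W : lmodType k) : Prop :=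
  exists f : {linear V -> W}, bijective f.

(* The degree p cochains are the submodule ccar p of the ambient module
   cobj p; that the differentials respect these submodules and square to zero
   on them is the separate statement is_complex. *)
Record cochains (k : nzRingType) := Cochains {
  cobj : nat -> lmodType k;
  ccar : forall p, submodule (cobj p);
  cdiff : forall p, {linear cobj p -> cobj p.+1} }.

Definition is_complex (k : nzRingType) (C : cochains k) : Prop :=
  forall p x, scarrier (ccar C p) x ->
    scarrier (ccar C p.+1) (cdiff C p x) /\ cdiff C p.+1 (cdiff C p x) = 0.

Section cohomology.
Context {k : nzRingType} (C : cochains k).

Program Definition cocycles p : submodule (cobj C p) :=
  @Submodule k _ [set x | scarrier (ccar C p) x /\ cdiff C p x = 0] _ _.
Next Obligation. by move=> p; split; [exact: submodule0 | rewrite linear0]. Qed.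
Next Obligation.
move=> p a x y [Cx dx] [Cy dy]; split; first exact: submoduleP.
by rewrite linearP dx dy scaler0 addr0.
Qed.

Definition is_coboundary p : set (cobj C p) :=
  match p with
  | 0 => [set 0]
  | q.+1 => [set x | exists2 y, scarrier (ccar C q) y & x = cdiff C q y]
  end.

Program Definition coboundaries p : submodule (submod_type (cocycles p)) :=
  @Submodule k _ [set x | is_coboundary (val x)] _ _.
Next Obligation.
case=> [|p]/=; first by [].
by exists 0; [exact: submodule0 | rewrite linear0].
Qed.
Next Obligation.
case=> [|p] a x y /=; first by move=> -> ->; rewrite scaler0 addr0.
move=> [u Cu ->] [v Cv ->]; exists (a *: u + v); first exact: submoduleP.
by rewrite linearP.
Qed.

Definition cohomology p : lmodType k := quot_module (coboundaries p).

Definition acyclic_at p : Prop :=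
  forall x : cohomology p, x = 0.
End cohomology.

Record opens (X : topologicalType) := Opens {
  oset :> set X;
  opensP : open oset }.

Record sheaf (k : nzRingType) (X : topologicalType) := Sheaf {
  sec : opens X -> lmodType k;
  res : forall U V : opens X, V `<=` U -> {linear sec U -> sec V};
  res_id : forall (U : opens X) (h : U `<=` U) s, res h s = s;
  res_comp : forall (U V W : opens X) (hVU : V `<=` U) (hWV : W `<=` V)
    (hWU : W `<=` U) s, res hWV (res hVU s) = res hWU s;
  sheaf_sep : forall (U : opens X) (I : Type) (V : I -> opens X)
    (hV : forall i, V i `<=` U), U `<=` \bigcup_i V i ->
    forall s t, (forall i, res (hV i) s = res (hV i) t) -> s = t;
  sheaf_glue : forall (U : opens X) (I : Type) (V : I -> opens X)
    (hV : forall i, V i `<=` U), U `<=` \bigcup_i V i ->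
    forall s : forall i, sec (V i),
    (forall i j (W : opens X) (hi : W `<=` V i) (hj : W `<=` V j),
      res hi (s i) = res hj (s j)) ->
    exists t, forall i, res (hV i) t = s i }.

Arguments res {k X s U V} _ : rename.

Record sheaf_mor (k : nzRingType) (X : topologicalType) (A B : sheaf k X) :=
  SheafMor {
    smor :> forall U : opens X, {linear sec A U -> sec B U};
    smor_res : forall (U V : opens X) (h : V `<=` U) s,
      smor V (res h s) = res h (smor U s) }.

Section sheaf_cohomology.
Context {k : nzRingType} {X : topologicalType}.
Implicit Types A B I F : sheaf k X.

Definition sheaf_mono A B (f : sheaf_mor A B) : Prop :=
  forall U, injective (f U).

Definition sheaf_exact A B F (f : sheaf_mor A B) (g : sheaf_mor B F) : Prop :=
  (forall U s, g U (f U s) = 0) /\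
  (forall (U : opens X) s, g U s = 0 -> forall x, oset U x ->
    exists (V : opens X) (h : V `<=` U), oset V x /\ exists t, f V t = res h s).

Definition injective_sheaf I : Prop :=
  forall A B (i : sheaf_mor A B) (f : sheaf_mor A I), sheaf_mono i ->
    exists g : sheaf_mor B I, forall U s, g U (i U s) = f U s.

Record injective_resolution F := InjectiveResolution {
  ires : nat -> sheaf k X;
  iaug : sheaf_mor F (ires 0);
  idiff : forall p, sheaf_mor (ires p) (ires p.+1);
  ires_inj : forall p, injective_sheaf (ires p);
  iaug_mono : sheaf_mono iaug;
  iaug_exact : sheaf_exact iaug (idiff 0);
  idiff_exact : forall p, sheaf_exact (idiff p) (idiff p.+1) }.

Definition topens : opens X := Opens openT.

Definition full_submodule (V : lmodType k) : submodule V :=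
  @Submodule k V setT I (fun _ _ _ _ _ => I).

Definition global_sections F (J : injective_resolution F) : cochains k :=
  @Cochains k (fun p => sec (ires J p) topens)
    (fun p => full_submodule (sec (ires J p) topens))
    (fun p => idiff J p topens).

(* H^p(X; F), as the right derived functor of global sections, computed with
   the injective resolution J. *)
Definition sheaf_cohomology F (J : injective_resolution F) p : lmodType k :=
  cohomology (global_sections J) p.
End sheaf_cohomology.

Fact nbhs_set_typeP (T : topologicalType) (A : set T) (x : set_type A)
    (P : set (set_type A)) :
  nbhs x P <-> exists2 W, nbhs (val x) W & forall y, W (val y) -> P y.
Proof.
split=> [[_ [[W oW <-] /= Wx WP]]|[W]].
  by exists W; [exact: open_nbhs_nbhs | exact: WP].
rewrite nbhsE => -[W' [oW' W'x] W'W] WP.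
exists (set_val @^-1` W'); split=> //=; first by exists W'.
by move=> y /= /W'W /WP.
Qed.

Section kernel_relation.
Context {T : choiceType} {S : Type} (f : T -> S).

Definition ker_rel : rel T := fun x y => `[< f x = f y >].

Fact ker_rel_equiv : equiv_class_of ker_rel.
Proof.
split=> [x|x y|y x z]; rewrite /ker_rel; first exact/asboolP.
  by apply: asbool_equiv_eq; split.
by move=> /asboolP -> /asboolP ->; exact/asboolP.
Qed.

Canonical ker_rel_equiv_rel := EquivRelPack ker_rel_equiv.
Canonical ker_rel_encModRel := defaultEncModRel ker_rel.
End kernel_relation.

(* The quotient of T by the relation f x = f y, with the quotient topology. *)
Definition quot_space (T : topologicalType) (S : Type) (f : T -> S) : Type :=
  quotient_topology {eq_quot (ker_rel f)}%qT.

HB.instance Definition _ (T : topologicalType) (S : Type) (f : T -> S) :=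
  Quotient.on (quot_space f).
HB.instance Definition _ (T : topologicalType) (S : Type) (f : T -> S) :=
  Topological.on (quot_space f).

Definition quot_proj (T : topologicalType) (S : Type) (f : T -> S) (x : T) :
  quot_space f := (\pi_(quot_space f) x)%qT.

Fact quot_projP (T : topologicalType) (S : Type) (f : T -> S) (x y : T) :
  quot_proj f x = quot_proj f y <-> f x = f y.
Proof.
by split=> [/eqmodP/asboolP //|fxy]; apply/eqmodP/asboolP.
Qed.

Section orbit_space.
Context {D : topologicalType} {G : Type} (act : G -> D -> D) (Gam : set G).
Context (D0 : set D).

Definition orbit_step (x y : set_type D0) : Prop :=
  exists2 g, Gam g & val y = act g (val x).

(* Gam\D0 is the quotient by the equivalence relation generated by
   x ~ act g x; when D0 is stable under the group Gam, the class of x is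
   its orbit. *)
Definition orbit (x : set_type D0) : set (set_type D0) :=
  Relation_Operators.clos_refl_sym_trans _ orbit_step x.

Fact orbit_step_eq x y : orbit_step x y -> orbit x = orbit y.
Proof.
move=> xy; apply/seteqP; split=> z /=; apply: Relation_Operators.rst_trans.
  exact/Relation_Operators.rst_sym/Relation_Operators.rst_step.
exact: Relation_Operators.rst_step.
Qed.

Definition orbit_space : topologicalType := quot_space orbit.
Definition orbit_proj : set_type D0 -> orbit_space := quot_proj orbit.

Fact orbit_proj_step x y : orbit_step x y -> orbit_proj x = orbit_proj y.
Proof. by move=> xy; apply/quot_projP; exact: orbit_step_eq. Qed.

Context {k : nzRingType} {E : lmodType k} (rho : G -> {linear E -> E}).

Definition over (U : set orbit_space) : set (set_type D0) := orbit_proj @^-1` U.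

Program Definition eq_sections (U : set orbit_space) :
    submodule (set_type (over U) -> E) :=
  @Submodule k _ [set f : set_type (over U) -> E |
    (forall x, \forall y \near x, f y = f x) /\
    (forall g, Gam g -> forall x y : set_type (over U),
       val (val y) = act g (val (val x)) -> f y = rho g (f x))] _ _.
Next Obligation.
move=> U; split; first by move=> x; near=> y.
by move=> g _ x y _; rewrite linear0.
Unshelve. all: by end_near. Qed.
Next Obligation.
move=> U a f f' [f1 f2] [f'1 f'2]; split=> [x|g Gg x y exy].
  near=> y; rewrite /GRing.add/= /GRing.scale/=; congr (_ *: _ + _).
    by near: y; exact: f1.
  by near: y; exact: f'1.
rewrite /GRing.add/= /GRing.scale/= linearP.
by rewrite (f2 _ Gg _ _ exy) (f'2 _ Gg _ _ exy).
Unshelve. all: by end_near. Qed.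

Definition mk_over (U : set orbit_space) x (Ux : over U x) :
  set_type (over U) := SigSub (mem_set Ux).

Section restriction.
Context (U V : set orbit_space) (VU : V `<=` U).

Definition over_incl (x : set_type (over V)) : set_type (over U) :=
  @mk_over U (val x) (VU (set_valP x)).

Fact restr_subproof (f : submod_type (eq_sections U)) :
  (val f \o over_incl) \in submod_pred (eq_sections V).
Proof.
case: f => f /= /asboolP[f1 f2]; apply/asboolP; split=> [x|g Gg x y exy] /=.
  have /nbhs_set_typeP[W Wx Wf] := f1 (over_incl x).
  by apply/nbhs_set_typeP; exists W => // y Wy /=; exact: Wf.
exact: f2.
Qed.

Definition restr (f : submod_type (eq_sections U)) :
  submod_type (eq_sections V) := Sub (val f \o over_incl) (restr_subproof f).

Fact restr_is_linear : linear restr.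
Proof. by move=> a f g; apply: val_inj. Qed.

HB.instance Definition _ := GRing.isLinear.Build k _ _ _ restr restr_is_linear.
End restriction.

Fact over_eq (U : set orbit_space) (x y : set_type (over U)) :
  val x = val y -> x = y.
Proof. exact: val_inj. Qed.

Fact restr_id (U : opens orbit_space) (h : U `<=` U)
  (s : submod_type (eq_sections U)) : restr h s = s.
Proof.
apply: val_inj; apply/funext => x /=.
by congr (val s _); exact: over_eq.
Qed.

Fact restr_comp (U V W : opens orbit_space) (hVU : V `<=` U) (hWV : W `<=` V)
  (hWU : W `<=` U) (s : submod_type (eq_sections U)) :
  restr hWV (restr hVU s) = restr hWU s.
Proof.
apply: val_inj; apply/funext => x /=.
by congr (val s _); exact: over_eq.
Qed.

Fact restr_sep (U : opens orbit_space) (I : Type) (V : I -> opens orbit_space)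
    (hV : forall i, V i `<=` U) : U `<=` \bigcup_i V i ->
  forall s t : submod_type (eq_sections U),
    (forall i, restr (hV i) s = restr (hV i) t) -> s = t.
Proof.
move=> UV s t st; apply: val_inj; apply/funext => x.
have [i _ Vix] := UV _ (set_valP x).
have /= := congr1 val (st i).
move=> /(congr1 (fun f : set_type (over (V i)) -> E =>
  f (@mk_over (V i) (val x) Vix))) /=.
have -> // : over_incl (hV i) (@mk_over (V i) (val x) Vix) = x by exact: over_eq.
Qed.

Fact over_open (U : opens orbit_space) : open (over U).
Proof. exact: opensP U. Qed.

Fact restr_glue (U : opens orbit_space) (I : Type) (V : I -> opens orbit_space)
    (hV : forall i, V i `<=` U) : U `<=` \bigcup_i V i ->
  forall s : forall i, submod_type (eq_sections (V i)),
  (forall i j (W : opens orbit_space) (hi : W `<=` V i) (hj : W `<=` V j),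
    restr hi (s i) = restr hj (s j)) ->
  exists t, forall i, restr (hV i) t = s i.
Proof.
move=> UV s sij.
pose ix (x : set_type (over U)) := cid2 (UV _ (set_valP x)).
pose t (x : set_type (over U)) : E :=
  val (s (s2val (ix x))) (mk_over (s2valP' (ix x))).
have tE i (x : set_type (over U)) (Vx : over (V i) (val x)) :
  t x = val (s i) (mk_over Vx).
  rewrite /t; set j := s2val _; set Vjx := s2valP' _.
  have oW : open (V i `&` V j) by apply: openI; exact: opensP.
  pose W := Opens oW.
  have Wx : over W (val x) by split.
  have := congr1 val (sij i j W (@subIsetl _ _ _) (@subIsetr _ _ _)).
  move=> /(congr1 (fun f : set_type (over W) -> E => f (mk_over Wx))).
  move=> /= sE; apply: (etrans _ (etrans (esym sE) _)).
    by congr (val (s j) _); exact: over_eq.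
  by congr (val (s i) _); exact: over_eq.
have tP : t \in submod_pred (eq_sections U).
  apply/asboolP; split=> [x|g Gg x y exy].
    have [i _ Vix] := UV _ (set_valP x).
    have /asboolP[s1 _] := valP (s i).
    have /nbhs_set_typeP[W Wx Wf] := s1 (@mk_over (V i) (val x) Vix).
    apply/nbhs_set_typeP; exists (W `&` over (V i)).
      by apply: filterI => //; apply: open_nbhs_nbhs; split=> //; exact: over_open.
    move=> y [Wy Viy]; rewrite (tE i _ Viy) (tE i _ Vix).
    exact: Wf.
  have [i _ Vix] := UV _ (set_valP x).
  have Viy : over (V i) (val y).
    by rewrite /over /= -(@orbit_proj_step (val x)) //; exists g.
  have /asboolP[_ s2] := valP (s i).
  rewrite (tE i _ Viy) (tE i _ Vix).
  exact: s2.
exists (Sub t tP) => i; apply: val_inj; apply/funext => x.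
rewrite /= (tE i (over_incl (hV i) x) (set_valP x)).
by congr (val (s i) _); exact: over_eq.
Qed.

(* The presheaf of locally constant equivariant functions satisfies the sheaf
   axioms (restr_sep, restr_glue), so it is its own associated sheaf. *)
Definition equivariant_sheaf : sheaf k orbit_space :=
  @Sheaf k orbit_space (fun U => submod_type (eq_sections U))
    (fun U V h => restr h) restr_id restr_comp restr_sep restr_glue.
End orbit_space.

Section cw.
Context {R : realType} {D : topologicalType} {G : Type} (act : G -> D -> D).
Context (Gam : set G) (D0 : set D) (cells : nat -> set (set D)).
Implicit Types (s t : set D) (F : seq (set D)).

(* Points of D0 are only required to be fixed by the final map of the homotopy,
   so this covers strong deformation retracts as well. *)
Definition equivariant_deformation_retract : Prop :=
  exists H : R -> D -> D,
  [/\ {within `[0, 1]%classic `*` setT, continuous (fun z : R * D => H z.1 z.2)},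
      forall x, H 0 x = x,
      forall x, D0 (H 1 x),
      forall x, D0 x -> H 1 x = x &
      forall g u x, Gam g -> 0 <= u <= 1 -> H u (act g x) = act g (H u x)].

Definition closed_unit_ball p : set 'rV[R]_p := [set x | \sum_i x 0 i ^+ 2 <= 1].
Definition open_unit_ball p : set 'rV[R]_p := [set x | \sum_i x 0 i ^+ 2 < 1].

Definition bdry s : set D := closure s `\` s.

(* The cells are the open cells, cells p being the set of p-cells.  The
   structure is regular: characteristic maps are injective on closed balls and
   the boundary of a cell is a finite union of cells of smaller dimension. *)
Definition regular_cw_structure : Prop :=
  [/\ D0 = \bigcup_p \bigcup_(s in cells p) s,
      forall p q s t, cells p s -> cells q t -> s `&` t !=set0 ->
        p = q /\ s = t,
      forall p s, cells p s -> exists phi : 'rV[R]_p -> D,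
        [/\ {within @closed_unit_ball p, continuous phi},
            set_inj (@closed_unit_ball p) phi & phi @` @open_unit_ball p = s],
      forall p s, cells p s -> exists2 B : set (set D), finite_set B &
        (forall t, B t -> exists2 q, (q < p)%N & cells q t) /\
        bdry s = \bigcup_(t in B) t &
      forall A, A `<=` D0 ->
        (forall p s, cells p s -> closed (A `&` closure s)) ->
        exists2 C, closed C & A = C `&` D0].

Definition cw_dimension (N : nat) : Prop :=
  cells N !=set0 /\ forall p, (N < p)%N -> cells p = set0.

Definition translate (g : G) s : set D := act g @` s.

Definition cell_stabilizer s : set G := [set g | Gam g /\ translate g s = s].

Definition equivariant_cells : Prop :=
  (forall p s g, cells p s -> Gam g -> cells p (translate g s)) /\
  (forall p s g, cells p s -> cell_stabilizer s g ->
    forall x, s x -> act g x = x).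

Definition is_cell s : Prop := exists p, cells p s.

Definition cell_lt s t : Prop := s `<=` closure t /\ s <> t.

(* Flags s_0 < ... < s_m of cells. *)
Definition is_flag F : Prop :=
  (forall t, t \in F -> is_cell t) /\ sorted (fun s t => `[< cell_lt s t >]) F.

(* The m-simplices of the complex S_s. *)
Definition subdivision s (m : nat) : set (seq (set D)) :=
  [set F | [/\ size F = m.+1, is_flag F & forall t, t \in F -> t `<=` closure s]].

Definition omit (T : Type) (i : nat) (F : seq T) : seq T :=
  take i F ++ drop i.+1 F.

(* The coefficient of F' in the boundary of the oriented simplex F. *)
Definition face_sign F F' : int :=
  \sum_(i < size F) (omit i F == F')%:R * (-1) ^+ i.

Definition boundary_coef (c : seq (set D) -> int) s p F' : int :=
  \sum_(F <- fset_set (subdivision s p)) c F * face_sign F F'.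

(* rep s is the representative [s] in reps p of the class of the p-cell s. *)
Definition cell_representatives (reps : nat -> set (set D))
    (rep : set D -> set D) : Prop :=
  [/\ forall p, reps p `<=` cells p,
      forall p s, cells p s ->
        reps p (rep s) /\ exists2 g, Gam g & s = translate g (rep s) &
      forall p s t g, reps p s -> reps p t -> Gam g -> t = translate g s ->
        s = t].

Definition distinguished_flags (reps : nat -> set (set D))
    (flag : set D -> seq (set D)) : Prop :=
  forall p s, reps p s ->
    [/\ size (flag s) = p.+1, is_flag (flag s),
        forall i, (i <= p)%N -> cells i (nth set0 (flag s) i) &
        last set0 (flag s) = s].

Section signs.
Context (rep : set D -> set D) (flag : set D -> seq (set D)) (gam : set D -> G).

(* gam t . F_[t] *)
Definition transported_flag t : seq (set D) :=
  map (translate (gam t)) (flag (rep t)).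

Definition transporters : Prop :=
  forall t, is_cell t -> Gam (gam t) /\ last set0 (transported_flag t) = t.

(* n s is the function n_s on the top-dimensional simplices of S_s: the
   boundary of sum_F n_s(F) F has coefficient 0 at every simplex F' of S_s that
   does not lie in the subdivision of the boundary of s. *)
Definition flag_orientation (n : set D -> seq (set D) -> int) : Prop :=
  forall p s, cells p s ->
    [/\ forall F, subdivision s p F -> n s F = 1 \/ n s F = -1,
        forall F', size F' = p -> is_flag F' ->
          (forall t, t \in F' -> t `<=` closure s) ->
          ~ (forall t, t \in F' -> t `<=` bdry s) ->
          boundary_coef (n s) s p F' = 0 &
        n s (transported_flag s) = (-1) ^+ p].

Definition cell_sign (n : set D -> seq (set D) -> int) s t : int :=
  n s (rcons (transported_flag t) s).
End signs.

Section cellular_complex.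
Context {k : nzRingType} {E : lmodType k} (rho : G -> {linear E -> E}).
Context (reps : nat -> set (set D)) (rep : set D -> set D).
Context (flag : set D -> seq (set D)) (gam : set D -> G).
Context (n : set D -> seq (set D) -> int).

(* Families (v_s) indexed by s in reps p with v_s in E^Stab(s), extended by
   zero to all subsets of D.  This is the direct sum when reps p is finite,
   i.e. when Gam\D0 is compact; for infinite reps p it is the product, since
   finitely supported families would compute a different cohomology. *)
Program Definition cellular_cochains p : submodule (set D -> E) :=
  @Submodule k _ [set v : set D -> E |
    (forall s, ~ reps p s -> v s = 0) /\
    (forall s, reps p s -> forall g, cell_stabilizer s g ->
      rho g (v s) = v s)] _ _.
Next Obligation. by move=> p; split=> // s _ g _; rewrite linear0. Qed.
Next Obligation.
move=> p a v w [v0 vP] [w0 wP]; split=> s.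
  by move=> ns; rewrite /GRing.add/= /GRing.scale/= v0// w0// scaler0 addr0.
move=> rs g sg; rewrite /GRing.add/= /GRing.scale/= linearP.
by rewrite (vP s rs g sg) (wP s rs g sg).
Qed.

Definition facets p s : set (set D) :=
  [set t | cells p t /\ t `<=` bdry s].

Definition cellular_differential p (v : set D -> E) : set D -> E := fun s =>
  if `[< reps p.+1 s >] then
    \sum_(t <- fset_set (facets p s))
      rho (gam t) (v (rep t)) *~ cell_sign rep flag gam n s t
  else 0.

Fact cellular_differential_linear p : linear (cellular_differential p).
Proof.
move=> a v w; apply/funext => s.
rewrite /cellular_differential [RHS]/GRing.add/= [in RHS]/GRing.scale/=.
case: ifP => _; last by rewrite scaler0 addr0.
rewrite scaler_sumr -big_split/=; apply: eq_bigr => t _.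
have -> : (a *: v + w) (rep t) = a *: v (rep t) + w (rep t) by [].
by rewrite linearP mulrzDl scalerMzr.
Qed.

HB.instance Definition _ p := GRing.isLinear.Build k _ _ _
  (cellular_differential p) (cellular_differential_linear p).

Definition cellular_complex : cochains k :=
  @Cochains k (fun=> set D -> E) cellular_cochains cellular_differential.
End cellular_complex.
End cw.

Section matrix_groups.
Context {F : fieldType} {n : nat}.
Implicit Types H K : set 'M[F]_n.

Definition subgroup H : Prop :=
  [/\ forall g, H g -> g \in unitmx,
      H 1%:M,
      forall g h, H g -> H h -> H (g *m h) &
      forall g, H g -> H (invmx g)].

Definition generated (S : set 'M[F]_n) : set 'M[F]_n :=
  \bigcap_(H in [set H | subgroup H /\ S `<=` H]) H.

Definition derived_subgroup H : set 'M[F]_n :=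
  generated [set c | exists g h, [/\ H g, H h &
    c = g *m h *m invmx g *m invmx h]].

Definition solvable_group H : Prop :=
  exists m, iter m derived_subgroup H = [set 1%:M].

Definition normal_subgroup H K : Prop :=
  H `<=` K /\ forall g h, K g -> H h -> H (g *m h *m invmx g).

Definition finite_index H K : Prop :=
  H `<=` K /\ exists s : seq 'M[F]_n, forall g, K g ->
    exists2 h, h \in s & K h /\ H (invmx h *m g).

Definition commensurable H K : Prop :=
  finite_index (H `&` K) H /\ finite_index (H `&` K) K.

Definition torsion_free H : Prop :=
  forall g m, H g -> iter m.+1 (mulmx g) 1%:M = 1%:M -> g = 1%:M.

Definition mx_eval (q : mpoly.mpoly (n * n) F) (g : 'M[F]_n) : F :=
  mpoly.meval (fun i => mxvec g 0 i) q.

Definition zariski_closed H : Prop :=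
  exists Q : set (mpoly.mpoly (n * n) F),
    H = [set g | g \in unitmx /\ forall q, Q q -> mx_eval q g = 0].

Definition zariski_connected H : Prop :=
  forall A B, zariski_closed A -> zariski_closed B ->
    H `<=` A `|` B -> H `&` A `&` B = set0 -> H `<=` A \/ H `<=` B.

Definition representation (k : nzRingType) (E : lmodType k) H
    (rho : 'M[F]_n -> {linear E -> E}) : Prop :=
  (forall v, rho 1%:M v = v) /\
  (forall g h v, H g -> H h -> rho (g *m h) v = rho g (rho h v)).
End matrix_groups.

Section group_cohomology.
Context {F : fieldType} {n : nat} (H : set 'M[F]_n).
Context {M : lmodType int} (rho : 'M[F]_n -> {linear M -> M}).

Definition group_simplex p (s : seq 'M[F]_n) : Prop :=
  size s = p.+1 /\ forall g, g \in s -> H g.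

(* Homogeneous p-cochains: equivariant functions of p + 1 elements of H. *)
Program Definition group_cochains p : submodule (seq 'M[F]_n -> M) :=
  @Submodule int _ [set v : seq 'M[F]_n -> M |
    (forall s, ~ group_simplex p s -> v s = 0) /\
    (forall g s, H g -> group_simplex p s ->
      v (map (mulmx g) s) = rho g (v s))] _ _.
Next Obligation. by move=> p; split=> // g s _ _; rewrite linear0. Qed.
Next Obligation.
move=> p a v w [v0 vP] [w0 wP]; split=> [s ns|g s Hg hs].
  by rewrite /GRing.add/= /GRing.scale/= v0// w0// scaler0 addr0.
rewrite /GRing.add/= /GRing.scale/= linearP.
by rewrite (vP g s Hg hs) (wP g s Hg hs).
Qed.

Definition group_differential p (v : seq 'M[F]_n -> M) : seq 'M[F]_n -> M :=
  fun s => if `[< group_simplex p.+1 s >] then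
    \sum_(i < size s) (-1) ^+ i *: v (omit i s) else 0.

Fact group_differential_linear p : linear (group_differential p).
Proof.
move=> a v w; apply/funext => s.
rewrite /group_differential [RHS]/GRing.add/= [in RHS]/GRing.scale/=.
case: ifP => _; last by rewrite scaler0 addr0.
rewrite scaler_sumr -big_split/=; apply: eq_bigr => i _.
have -> : (a *: v + w) (omit i s) = a *: v (omit i s) + w (omit i s) by [].
by rewrite scalerDr !scalerA mulrC.
Qed.

HB.instance Definition _ p := GRing.isLinear.Build int _ _ _
  (group_differential p) (group_differential_linear p).

Definition group_complex : cochains int :=
  @Cochains int (fun=> seq 'M[F]_n -> M) group_cochains group_differential.
End group_cohomology.

(* Modules over the group H are abelian groups, i.e. Z-modules, with an
   action of H. *)
Definition cohomological_dimension (F : fieldType) (n : nat)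
    (H : set 'M[F]_n) (d : nat) : Prop :=
  (forall (M : lmodType int) (rho : 'M[F]_n -> {linear M -> M}),
     representation H rho ->
     forall p, (d < p)%N -> acyclic_at (group_complex H rho) p) /\
  (exists (M : lmodType int) (rho : 'M[F]_n -> {linear M -> M}),
     representation H rho /\ ~ acyclic_at (group_complex H rho) d).

Definition virtual_cohomological_dimension (F : fieldType) (n : nat)
    (H : set 'M[F]_n) (d : nat) : Prop :=
  exists H', [/\ subgroup H', finite_index H' H, torsion_free H' &
    cohomological_dimension H' d].

Section algebraic_groups.
Context {n : nat} (P : set (mpoly.mpoly (n * n) rat)).

(* The F-points of the subgroup of GL_n defined by the polynomials P. *)
Definition points (F : fieldType) : set 'M[F]_n :=
  [set g | g \in unitmx /\
    forall q, P q -> mx_eval (mpoly.map_mpoly ratr q) g = 0].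
Arguments points F : clear implicits.

(* P defines a group whose radical (over the algebraic closure C of R) is
   trivial. *)
Definition semisimple_algebraic_group (R : realType) : Prop :=
  let GC := points R[i] in
  subgroup GC /\
  forall H, subgroup H -> normal_subgroup H GC -> zariski_closed H ->
    zariski_connected H -> solvable_group H -> H = [set 1%:M].

Definition integral_points : set 'M[rat]_n :=
  [set g | points rat g /\
    forall i j, (g i j \is a Num.int) && (invmx g i j \is a Num.int)].

Definition arithmetic_subgroup (Gam : set 'M[rat]_n) : Prop :=
  [/\ subgroup Gam, Gam `<=` points rat & commensurable Gam integral_points].
End algebraic_groups.

Arguments points {n} P F.

Section symmetric_space.
Context {R : realType} {n : nat}.
Implicit Types (G K : set 'M[R]_n).

Definition maximal_compact_subgroup G K : Prop :=
  [/\ subgroup K, K `<=` G, compact K &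
    forall K', subgroup K' -> K' `<=` G -> compact K' -> K `<=` K' -> K' = K].

Definition left_coset G K (g : set_type G) : set 'M[R]_n :=
  [set val g *m h | h in K].

Definition symmetric_space G K : topologicalType := quot_space (left_coset (G := G) K).

Definition base_proj G K : set_type G -> symmetric_space G K :=
  quot_proj (left_coset K).

(* The action g . hK = (gh)K on G/K of a matrix g in G with rational
   entries (and a dummy value for g outside G). *)
Definition symmetric_space_act G K (g : 'M[rat]_n) (x : symmetric_space G K) :
  symmetric_space G K :=
  xget x [set y | exists h h' : set_type G,
    [/\ x = base_proj K h, val h' = map_mx ratr g *m val h &
        y = base_proj K h']].

Fact symmetric_space_actE G K (g : 'M[rat]_n) (h h' : set_type G) :
  val h' = map_mx ratr g *m val h ->
  symmetric_space_act g (base_proj K h) = base_proj K h'.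
Proof.
move=> hh'; rewrite /symmetric_space_act; case: xgetP => [y -> | /(_ (base_proj K h'))].
  move=> [u [v [uh vu ->]]]; apply/quot_projP.
  rewrite /left_coset vu hh'.
  have E (w : 'M[R]_n) : [set map_mx ratr g *m w *m c | c in K] =
      mulmx (map_mx ratr g) @` [set w *m c | c in K].
    rewrite image_comp; apply: eq_imagel => c _ /=; by rewrite mulmxA.
  by rewrite !E; congr (_ @` _); exact: (esym ((quot_projP _ _ _).1 uh)).
by case; exists h, h'.
Qed.
End symmetric_space.

(* Main.v *)
(* Cochains of degree n are functions of lists [x0; ..; xn] in which each point
   lies in an arbitrarily small neighbourhood of the preceding one, i.e. sections
   of the iterated Godement construction.  On closed cells they are acyclic, and
   on a boundary sphere they have cohomology in the top degree only (by bisection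
   of cubes and Mayer-Vietoris), so that filtering the equivariant cochains on D0
   by skeleta computes their cohomology by a complex of families (v_s) indexed
   by the cells up to Gamma, with differential given by incidence numbers.  With
   coefficients in Z/2 these numbers are all 1, and the same theory applied to
   flags shows that an orientation n_s is unique up to sign; hence the signs
   sgn_s(t) are incidence numbers.  Equivariant cochains resolve the sheaf E_0 on
   X_0, because Gamma is discrete in G and thus acts on D with local slices, and
   a double complex with contractible rows compares them with an injective
   resolution. *)
Require Import Defs.
From HB Require Import structures.
From mathcomp Require Import all_boot all_order all_algebra generic_quotient.
From mathcomp Require Import finmap.
From mathcomp Require Import all_classical all_reals topology normedtype realfun.
From mathcomp Require Import complex interval_inference zify ring lra.
From mathcomp Require mpoly.

Set Implicit Arguments.
Unset Strict Implicit.
Unset Printing Implicit Defensive.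

Import Order.TTheory GRing.Theory Num.Theory.
Import numFieldTopology.Exports numFieldNormedType.Exports.
Local Open Scope classical_set_scope.
Local Open Scope ring_scope.

(** The signs in the differential come from orientations of flags, not from degrees of maps. For the
    differential to square to zero, [n_s] on the flags through a facet [t] must agree with [n_t] up
    to sign, so orientations must be unique up to sign. This amounts to linking the maximal flags of
    a cell through faces of codimension one, which holds because closed cells are balls bounded by
    spheres and fails for general posets. Over Z/2 signs disappear, and the mere existence of
    orientations gives the relations needed to evaluate cocycles on cells; uniqueness follows, and
    evaluation with signs becomes possible. Cochains are functions of arbitrary lists, compared only
    on generic lists ([ev]). They need no continuity, may be defined by cases, and extend by zero
    from a closed set. The coefficients [E] are arbitrary, so averaging over stabilizers is
    excluded. Since a stabilizer fixes the closed cell pointwise, an equivariant cochain has values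
    in [E^Stab] there; primitives are found with these coefficients on representatives and carried
    around by [Gam]. *)

(* An isomorphism Z/B -> Z'/B' presented by a linear relation, which avoids
   choosing representatives. *)
Definition subquotient_iso (k : nzRingType) (V W : lmodType k)
    (Z B : V -> Prop) (Z' B' : W -> Prop) : Prop :=
  exists R : V -> W -> Prop,
  [/\ forall a x y x' y', R x y -> R x' y' -> R (a *: x + x') (a *: y + y'),
      forall x y, R x y -> Z x /\ Z' y,
      forall x, Z x -> exists y, R x y,
      forall y, Z' y -> exists x, R x y &
      forall x y, R x y -> (B x <-> B' y)].

Lemma subquotient_iso_sym (k : nzRingType) (V W : lmodType k)
    (Z B : V -> Prop) (Z' B' : W -> Prop) :
  subquotient_iso Z B Z' B' -> subquotient_iso Z' B' Z B.
Proof.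
move=> [R [lR RZ RV RW RB]]; exists (fun y x => R x y); split=> //.
- by move=> a x y x' y' ? ?; exact: lR.
- by move=> y x /RZ[].
- by move=> y x /RB[].
Qed.

Lemma subquotient_iso_trans (k : nzRingType) (V W U : lmodType k)
    (Z B : V -> Prop) (Z' B' : W -> Prop) (Z'' B'' : U -> Prop) :
  subquotient_iso Z B Z' B' -> subquotient_iso Z' B' Z'' B'' ->
  subquotient_iso Z B Z'' B''.
Proof.
move=> [R [lR RZ RV RW RB]] [S [lS SZ SV SW SB]].
exists (fun x z => exists2 y, R x y & S y z); split.
- move=> a x y x' y' [u xu uy] [u' xu' uy'].
  by exists (a *: u + u'); [exact: lR|exact: lS].
- by move=> x z [y /RZ[? _] /SZ[_ ?]].
- move=> x /RV[y xy]; have [_ /SV[z yz]] := RZ _ _ xy.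
  by exists z, y.
- move=> z /SW[y yz]; have [/RW[x xy] _] := SZ _ _ yz.
  by exists x, y.
- by move=> x z [y /RB xy /SB yz]; rewrite xy.
Qed.

Section cohomology_iso.
Context {k : nzRingType} (C C' : cochains k) (p : nat).

Let HC (C0 : cochains k) := cohomology C0 p.
Local Notation cl C0 x := ((\pi_(Quotient.quot (submod_pred (coboundaries C0 p)))%qT x) : HC C0).

Lemma cohomology_classE (C0 : cochains k) (x y : submod_type (cocycles C0 p)) :
  (cl C0 x = cl C0 y) <-> is_coboundary (val x - val y).
Proof.
split=> [/eqP|xy].
  by rewrite -quot_eq => /asboolP.
by apply/eqP; rewrite -quot_eq; apply/asboolP.
Qed.

(** Applied to differences of related pairs, the clause on [B] and [B'] gives well-definedness in
    one direction and injectivity in the other. *)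
Lemma isomorphic_cohomology :
  subquotient_iso (scarrier (cocycles C p)) (@is_coboundary _ C p)
    (scarrier (cocycles C' p)) (@is_coboundary _ C' p) ->
  isomorphic (cohomology C p) (cohomology C' p).
Proof.
move=> [R [lR RZ RV RW RB]].
have RN x y x' y' : R x y -> R x' y' -> R (x - x') (y - y').
  by move=> h h'; have := lR (-1) _ _ _ _ h' h; rewrite !scaleN1r ![- _ + _]addrC.
have ex (x : HC C) : exists y : submod_type (cocycles C' p),
    R (val (repr x)) (val y).
  have /asboolP/RV[y xy] := valP (repr x).
  have [_ /asboolP Zy] := RZ _ _ xy.
  by exists (Sub y Zy).
pose f (x : HC C) : HC C' := cl C' (projT1 (cid (ex x))).
have fE x y : R (val x) (val y) -> f (cl C x) = cl C' y.
  move=> xy; rewrite /f; case: cid => y' /= xy'.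
  apply/cohomology_classE; apply/(RB _ _ (RN _ _ _ _ xy' xy)).
  by apply/cohomology_classE; exact: reprK.
have Rex (x : submod_type (cocycles C p)) :
    exists y : submod_type (cocycles C' p), R (val x) (val y).
  have /asboolP/RV[y xy] := valP x.
  have [_ /asboolP Zy] := RZ _ _ xy.
  by exists (Sub y Zy).
have Rex' (y : submod_type (cocycles C' p)) :
    exists x : submod_type (cocycles C p), R (val x) (val y).
  have /asboolP/RW[x xy] := valP y.
  have [/asboolP Zx _] := RZ _ _ xy.
  by exists (Sub x Zx).
have lf : linear f.
  move=> a x y; rewrite -[x]reprK -[y]reprK.
  set u := repr x; set v := repr y.
  have [u' uu'] := Rex u; have [v' vv'] := Rex v.
  have -> : a *: (cl C u) + cl C v = cl C (a *: u + v).
    by rewrite quot_piD -quot_scale_pi.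
  rewrite (fE _ _ uu') (fE _ _ vv') (fE _ (a *: u' + v')); last exact: lR.
  by rewrite quot_piD -quot_scale_pi.
pose g : {linear HC C -> HC C'} := HB.pack f (GRing.isLinear.Build _ _ _ _ f lf).
have gfE x : g x = f x by [].
have ginj : injective g.
  move=> x x'; rewrite !gfE -[x]reprK -[x']reprK.
  have [y xy] := Rex (repr x); have [y' xy'] := Rex (repr x').
  rewrite (fE _ _ xy) (fE _ _ xy') => /cohomology_classE/(RB _ _ (RN _ _ _ _ xy xy')).
  by move/cohomology_classE.
have gex y : exists x, g x = y.
  by have [x xy] := Rex' (repr y); exists (cl C x); rewrite gfE (fE _ _ xy) reprK.
exists g, (fun y => projT1 (cid (gex y))) => [x|y].
  by apply: ginj; case: cid.
by case: cid.
Qed.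
End cohomology_iso.

(** * Generic cochains *)

Lemma near_near (T : topologicalType) (x : T) (P : T -> Prop) :
  (\forall y \near x, P y) -> \forall y \near x, \forall z \near y, P z.
Proof. by move=> /nbhs_interior. Qed.

Fixpoint lall (D : Type) (A : set D) (s : seq D) : Prop :=
  if s is x :: s' then A x /\ lall A s' else True.

Section generic_lists.
Context {D : topologicalType}.
Implicit Types (A B : set D) (P Q R : seq D -> Prop).

(** Here [x] is the point chosen last and not part of the list; it need not lie in [A]. The number
    [n] counts points, so a cochain of degree p is tested with [p.+1], and [n = 0] is the
    augmentation. *)
Fixpoint evx A n P x : Prop :=
  if n is m.+1 then \forall y \near x, A y -> evx A m (fun s => P (y :: s)) y
  else P [::].

(* "Generic" lists: each point is taken in a neighbourhood, depending on the
   preceding points, of the last of them. *)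
Definition ev A n P : Prop :=
  if n is m.+1 then forall x, A x -> evx A m (fun s => P (x :: s)) x else P [::].

Lemma evx_imp2 A n P Q R x :
  (forall s, size s = n -> lall A s -> P s -> Q s -> R s) ->
  evx A n P x -> evx A n Q x -> evx A n R x.
Proof.
elim: n P Q R x => [|n IH] P Q R x PQR /=; first by apply: PQR.
move=> Px Qx; near=> y => Ay.
apply: (IH (fun s => P (y :: s)) (fun s => Q (y :: s))).
- by move=> s ss As; apply: PQR; rewrite /= ?ss.
- by move: Ay; near: y.
- by move: Ay; near: y.
Unshelve. all: by end_near. Qed.

Lemma evx_all A n P x : (forall s, size s = n -> lall A s -> P s) -> evx A n P x.
Proof.
elim: n P x => [|n IH] P x Ps /=; first exact: Ps.
by apply: nearW => y Ay; apply: IH => s ss As; apply: Ps => //=; rewrite ss.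
Qed.

Lemma evx_imp A n P R x :
  (forall s, size s = n -> lall A s -> P s -> R s) -> evx A n P x -> evx A n R x.
Proof.
move=> PR Px; apply: (evx_imp2 _ Px Px) => s ss As Ps _; exact: PR.
Qed.

Lemma ev_imp2 A n P Q R :
  (forall s, size s = n -> lall A s -> P s -> Q s -> R s) ->
  ev A n P -> ev A n Q -> ev A n R.
Proof.
case: n => [|n] PQR /=; first by apply: PQR.
move=> AP AQ x Ax; apply: (evx_imp2 _ (AP x Ax) (AQ x Ax)) => s ss As.
by apply: PQR => //=; rewrite ss.
Qed.

Lemma ev_all A n P : (forall s, size s = n -> lall A s -> P s) -> ev A n P.
Proof.
case: n => [|n] Ps /=; first exact: Ps.
by move=> x Ax; apply: evx_all => s ss As; apply: Ps => //=; rewrite ss.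
Qed.

Lemma ev_imp A n P R :
  (forall s, size s = n -> lall A s -> P s -> R s) -> ev A n P -> ev A n R.
Proof.
by move=> PR Px; apply: (ev_imp2 _ Px Px) => s ss As Ps _; exact: PR.
Qed.

Lemma evx_near A n P x : evx A n P x -> \forall y \near x, evx A n P y.
Proof. by case: n => [|n] /= Px; [exact: nearW | exact: near_near]. Qed.

Lemma evx_sub A B n P x : B `<=` A -> evx A n P x -> evx B n P x.
Proof.
move=> BA; elim: n P x => [|n IH] P x //=.
by apply: filterS => y h /BA/h/IH.
Qed.

Lemma ev_sub A B n P : B `<=` A -> ev A n P -> ev B n P.
Proof.
move=> BA; case: n => [|n] //= AP x /BA/AP; exact: evx_sub.
Qed.

Lemma ev_evx A n P x : ev A n P -> evx A n P x.
Proof. by case: n => [|n] //= AP; apply: nearW => y; exact: AP. Qed.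

Fixpoint faces P s : Prop :=
  if s is x :: s' then P s' /\ faces (fun t => P (x :: t)) s' else True.

(** Generic lists stay generic when a point is omitted: what holds for all points near [x] holds
    near each of them ([evx_near]). Hence [cob] respects generic equality. *)
Lemma evx_faces A n P x : evx A n P x -> evx A n.+1 (faces P) x.
Proof.
elim: n P x => [|n IH] P x Px.
  by rewrite /=; apply: nearW.
change (\forall y \near x, A y -> evx A n.+1 (fun s => faces P (y :: s)) y).
near=> y => Ay.
have Py : evx A n (fun s => P (y :: s)) y by move: Ay; near: y.
have Pyy : evx A n.+1 P y by near: y; exact: evx_near Px.
by apply: (evx_imp2 _ Pyy (IH _ _ Py)).
Unshelve. all: by end_near. Qed.

Lemma faces_lall A P s : (forall t, size t = (size s).-1 -> lall A t -> P t) ->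
  lall A s -> faces P s.
Proof.
elim: s P => //= x s IH P AP [Ax As]; split; first exact: AP.
case: s IH AP As => // y s IH AP As.
by apply: IH => // t ts At; apply: AP => //=; rewrite ts.
Qed.

Lemma ev_faces A n P : ev A n P -> ev A n.+1 (faces P).
Proof.
move=> AP x Ax.
case: n AP => [|n] AP; first by split.
by apply: (evx_imp2 _ (ev_evx x AP) (evx_faces (AP x Ax))).
Qed.

(** Once a point leaves [A] the implication is vacuous, so [A] need not be open or closed in [B].
    Extension by zero rests on this. *)
Lemma evx_restr A B n P x : evx (A `&` B) n P x ->
  evx B n (fun s => lall A s -> P s) x.
Proof.
elim: n P x => [|n IH] P x //=.
apply: filterS => y h By; have [Ay|nAy] := pselect (A y).
  apply: (evx_imp _ (IH _ _ (h (conj Ay By)))) => s _ _ Ps [_]; exact: Ps.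
by apply: evx_all => s _ _ [].
Qed.

Lemma ev_restr A B n P : ev (A `&` B) n P ->
  ev B n (fun s => lall A s -> P s).
Proof.
case: n => [|n] //= AP x Bx; have [Ax|nAx] := pselect (A x).
  by apply: (evx_imp _ (evx_restr (AP x (conj Ax Bx)))) => s _ _ Ps [_]; exact: Ps.
by apply: evx_all => s _ _ [].
Qed.

Lemma evx_stay A (U : set D) n x :
  (forall y, A y -> U y -> \forall z \near y, A z -> U z) ->
  A x -> U x -> evx A n (lall U) x.
Proof.
move=> Uo; elim: n x => [|n IH] x Ax Ux //=.
apply: filterS (Uo x Ax Ux) => y h Ay; apply: evx_imp (IH y Ay (h Ay)) => s _ _ Us.
by split; first exact: h.
Qed.

Lemma last_lall (U : set D) x s : U x -> lall U s -> U (last x s).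
Proof. by elim: s x => //= y s IH x Ux [Uy Us]; exact: IH. Qed.

(** A generic list that enters a relatively open set never leaves it. *)
Lemma evx_last A (U : set D) n x :
  (forall y, A y -> U y -> \forall z \near y, A z -> U z) -> A x ->
  evx A n (fun s => ~ U (last x s) -> lall (A `\` U) (x :: s)) x.
Proof.
move=> Uo; elim: n x => [|n IH] x Ax; first by move=> /= nU.
have [Ux|nUx] := pselect (U x).
  apply: evx_imp (evx_stay n.+1 Uo Ax Ux) => s _ _ Us nU; exfalso.
  by apply: nU; exact: last_lall.
apply: nearW => y Ay; apply: evx_imp (IH y Ay) => s _ _ h /h /= [? ?].
by split.
Qed.

Lemma ev_last A (U : set D) n x0 :
  (forall y, A y -> U y -> \forall z \near y, A z -> U z) ->
  ev A n.+1 (fun s => ~ U (last x0 s) -> lall (A `\` U) s).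
Proof. by move=> Uo x Ax; exact: evx_last. Qed.

(** The members through the current point are finitely many and include those through the next one,
    so at each step a finite intersection of neighbourhoods suffices. The typical [F] is a locally
    finite closed cover. *)
Lemma ev_cover (F : set (set D)) A n P : (0 < n)%N ->
  (forall x, A x -> exists2 B, F B & B x) ->
  (forall x, A x -> exists L : seq (set D), (forall B, B \in L -> F B /\ B x) /\
     \forall y \near x, forall B, F B -> B y -> B \in L) ->
  (forall B, F B -> ev B n P) -> ev A n P.
Proof.
move=> n0 cov fin FP.
have key m Q x : A x -> (forall B, F B -> B x -> evx B m Q x) -> evx A m Q x.
  elim: m Q x => [|m IH] Q x Ax h.
    by have [B FB Bx] := cov x Ax; exact: (h B FB Bx).
  have [L [LF Lx]] := fin x Ax.
  have : \forall y \near x, forall B, B \in L -> B y -> evx B m (fun s => Q (y :: s)) y.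
    elim: L LF {Lx} => [|B L IHL] LF; first exact: nearW.
    have [FB Bx] := LF B (mem_head _ _).
    have {}IHL := IHL (fun B' h => LF B' (mem_behead (h : B' \in behead (B :: L)))).
    have {}h := h B FB Bx.
    near=> y => B'; rewrite inE => /orP[/eqP ->|]; first by near: y.
    by move: B'; near: y.
  rewrite /= => Ly; near=> y => Ay; apply: IH => // B FB By.
  have BL : B \in L by move: B FB By; near: y.
  by move: B FB By BL; near: y; apply: filterS Ly => y h' B FB By BL; exact: h'.
case: n n0 FP => // n _ FP x Ax; apply: key => // B FB; exact: FP.
Unshelve. all: by end_near. Qed.

Lemma ev_setU A B n P : closed A -> closed B ->
  ev A n P -> ev B n P -> ev (A `|` B) n P.
Proof.
case: n => // n cA cB AP BP.
apply: (@ev_cover [set A; B]) => //; last by move=> _ [->|->].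
  by move=> x [Ax|Bx]; [exists A => //; left|exists B => //; right].
move=> x _; exists ([seq C <- [:: A; B] | `[< C x >]]); split.
  move=> C; rewrite mem_filter !inE => /andP[/asboolP Cx /orP[]/eqP <-].
    by split=> //; left.
  by split=> //; right.
have H C : closed C -> \forall y \near x, C y -> C x.
  move=> cC; have [Cx|nCx] := pselect (C x); first exact: nearW.
  have : nbhs x (~` C) by apply: open_nbhs_nbhs; split=> //; exact: closed_openC.
  by apply: filterS => y nCy /nCy.
near=> y => C [->|->] Cy; rewrite mem_filter !inE eqxx ?orbT andbT; apply/asboolP.
  by move: Cy; near: y; exact: H.
by move: Cy; near: y; exact: H.
Unshelve. all: by end_near. Qed.

End generic_lists.

Definition contw (D D' : topologicalType) (B : set D) (phi : D -> D') :=
  forall x, B x -> forall U, nbhs (phi x) U -> \forall y \near x, B y -> U (phi y).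

Lemma evx_map (D D' : topologicalType) (A : set D') (B : set D) (phi : D -> D') n
    (P : seq D' -> Prop) x :
  (forall y, B y -> A (phi y)) -> contw B phi -> B x ->
  evx A n P (phi x) -> evx B n (fun s => P (map phi s)) x.
Proof.
move=> BA cphi; elim: n P x => [|n IH] P x Bx //= h.
apply: filterS (cphi x Bx _ h) => y h' By.
exact: (IH (fun s => P (phi y :: s))) (h' By (BA _ By)).
Qed.

Lemma ev_map (D D' : topologicalType) (A : set D') (B : set D) (phi : D -> D') n
    (P : seq D' -> Prop) :
  (forall y, B y -> A (phi y)) -> contw B phi ->
  ev A n P -> ev B n (fun s => P (map phi s)).
Proof.
case: n => // n BA cphi AP x Bx.
by apply: (evx_map (P := fun s => P (phi x :: s)) BA) => //; exact/AP/BA.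
Qed.

Lemma contw_sub (D D' : topologicalType) (A B : set D) (phi : D -> D') :
  B `<=` A -> contw A phi -> contw B phi.
Proof. by move=> BA h x /BA Ax U /(h x Ax); apply: filterS => y k /BA/k. Qed.

(** * Coboundaries, acyclicity and Mayer-Vietoris *)

Section cob.
Context {D : topologicalType} {M : zmodType}.
Implicit Types (A B : set D) (f g : seq D -> M) (s : seq D).

(** The alternating sum over omitted points, arranged so that one unfolding is the cone formula. On
    a one-point list the value is [f [::]], which makes the complex augmented. *)
Fixpoint cob f s : M :=
  if s is x :: s' then f s' - cob (fun t => f (x :: t)) s' else 0.

Lemma faces_cob f g s : faces (fun t => f t = g t) s -> cob f s = cob g s.
Proof. by elim: s f g => //= x s IH f g [-> /IH ->]. Qed.

Lemma ev_cob A n f g : ev A n (fun s => f s = g s) ->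
  ev A n.+1 (fun s => cob f s = cob g s).
Proof.
by move/ev_faces; apply: ev_imp => s _ _; exact: faces_cob.
Qed.

Lemma cob0 s : cob (fun=> 0) s = 0.
Proof. by elim: s => //= x s ->; rewrite subr0. Qed.

Lemma cobD f g s : cob (fun t => f t + g t) s = cob f s + cob g s.
Proof.
elim: s f g => [|x s IH] f g /=; first by rewrite addr0.
by rewrite IH opprD addrACA.
Qed.

Lemma cobN f s : cob (fun t => - f t) s = - cob f s.
Proof. by elim: s f => [|x s IH] f /=; rewrite ?oppr0// IH opprD. Qed.

Lemma cobB f g s : cob (fun t => f t - g t) s = cob f s - cob g s.
Proof. by rewrite cobD cobN. Qed.

Lemma ev_cob0 A n f : ev A n (fun s => f s = 0) -> ev A n.+1 (fun s => cob f s = 0).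
Proof. by move/ev_cob; apply: ev_imp => s _ _ ->; exact: cob0. Qed.

Lemma cob_cob f s : cob (cob f) s = 0.
Proof.
elim: s f => //= x s IH f.
have -> : cob (fun t => cob f (x :: t)) s = cob f s - cob (cob (fun u => f (x :: u))) s.
  exact: (cobB f (cob (fun u => f (x :: u))) s).
by rewrite IH subr0 subrr.
Qed.

Definition cocyc A n f := ev A n.+1 (fun s => cob f s = 0).

Definition cobd A n f :=
  if n is m.+1 then exists g, ev A n (fun s => f s = cob g s) else f [::] = 0.

(** Vanishing of reduced cohomology in degree n - 1; for [n = 0] and nonzero [M] it amounts to [A]
    being nonempty. *)
Definition acy A n := forall f, cocyc A n f -> cobd A n f.

Lemma cobd_sub A B n f : B `<=` A -> cobd A n f -> cobd B n f.
Proof. by case: n => // n BA [g h]; exists g; exact: ev_sub h. Qed.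

Lemma cocyc_sub A B n f : B `<=` A -> cocyc A n f -> cocyc B n f.
Proof. exact: ev_sub. Qed.

Lemma cobd_set0 n f : (0 < n)%N -> cobd set0 n f.
Proof. by case: n => // n _; exists (fun=> 0) => x []. Qed.

(* The cone with apex x is a primitive near x. *)
Lemma cone_cobd A n f x : A x -> cocyc A n f ->
  exists2 W, nbhs x W & cobd (A `&` W) n f.
Proof.
move=> Ax /(_ x Ax); case: n => [|n] /= h.
  by exists setT; [exact: filterT | move: h; rewrite subr0].
exists [set y | A y -> evx A n (fun s => cob f (x :: y :: s) = 0) y] => //.
exists (fun s => f (x :: s)) => y [Ay /(_ Ay) Wy].
apply: evx_sub (@subIsetl _ _ _) _; apply: evx_imp Wy => s _ _ /eqP.
by rewrite /= subr_eq0 => /eqP.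
Qed.

(** Mayer-Vietoris: on the intersection the two primitives differ by a cocycle, hence by a
    coboundary, which is absorbed into one of them. *)
Lemma cobd_setU A B n f : closed A -> closed B -> acy (A `&` B) n.-1 ->
  cobd A n f -> cobd B n f -> cobd (A `|` B) n f.
Proof.
case: n => // n cA cB AB [u fu] [v fv].
have : cocyc (A `&` B) n (fun s => u s - v s).
  apply: (ev_imp2 _ (ev_sub (@subIsetl _ A B) fu) (ev_sub (@subIsetr _ A B) fv)).
  by move=> s _ _; rewrite cobB => <- <-; rewrite subrr.
move/AB; case: n {AB} fu fv => [|n] fu fv.
  move=> /= /eqP; rewrite subr_eq0 => /eqP uv.
  by exists u => x [/fu //|/fv /= ->]; rewrite uv.
move=> [w uv].
(* Case distinction on the whole list; inside the intersection the correction by [cob w] makes both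
   cases agree generically. *)
pose g s := if `[< lall A s >] then u s - cob w s else v s.
exists g; apply: (@ev_setU _ A B n.+2 (fun s => f s = cob g s)) => //.
  apply: (ev_imp (n := n.+2) _ fu) => s _ As ->.
  rewrite -[LHS]subr0 -(cob_cob w s) -cobB; apply: faces_cob.
  by apply: faces_lall As => t _ At; rewrite /g asboolT.
have gv : ev B n.+1 (fun s => v s = g s).
  apply: ev_imp (ev_restr uv) => s _ _ h; rewrite /g.
  by case: asboolP => // /h <-; rewrite opprB addrC subrK.
by apply: (ev_imp2 _ fv (ev_cob gv)) => s _ _ -> ->.
Qed.

Lemma acy0 A x : A x -> acy A 0.
Proof. by move=> Ax f /(_ x Ax) /=; rewrite subr0. Qed.
End cob.

Lemma cob_map (D D' : topologicalType) (M : zmodType) (phi : D -> D') (f : seq D' -> M) s :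
  cob f (map phi s) = cob (fun t => f (map phi t)) s.
Proof. by elim: s f => //= x s IH f; rewrite IH. Qed.

Lemma cob_additive (D : topologicalType) (M M' : zmodType) (j : {additive M -> M'})
    (f : seq D -> M) s : j (cob f s) = cob (fun t => j (f t)) s.
Proof. by elim: s f => [|x s IH] f /=; rewrite ?raddf0// raddfB IH. Qed.

Lemma acy_retract (M : zmodType) (D D' : topologicalType) (A : set D) (B : set D')
    (phi : D -> D') (psi : D' -> D) n :
  (forall x, A x -> B (phi x)) -> (forall x, B x -> A (psi x)) ->
  contw A phi -> contw B psi -> (forall x, A x -> psi (phi x) = x) ->
  acy (M := M) B n -> acy (M := M) A n.
Proof.
move=> AB BA cphi cpsi K acyB f cf.
have /acyB : cocyc B n (fun s => f (map psi s)).
  by apply: ev_imp (ev_map BA cpsi cf) => s _ _; rewrite cob_map.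
case: n {acyB} cf => // n cf [g fg]; exists (fun s => g (map phi s)).
apply: ev_imp (ev_map AB cphi fg) => s _ As.
rewrite cob_map -map_comp => <-; congr f.
by elim: (s) As => //= x t IH [Ax /IH <-]; rewrite K.
Qed.

Lemma compact_inverse (D D' : topologicalType) (A : set D) (phi : D -> D') :
  hausdorff_space D' -> compact A -> contw A phi -> set_inj A phi ->
  A !=set0 ->
  exists psi : D' -> D, [/\ forall x, A x -> psi (phi x) = x,
    forall y, (phi @` A) y -> A (psi y) /\ phi (psi y) = y & contw (phi @` A) psi].
Proof.
move=> hD' cA cphi iphi [a0 Aa0].
pose psi y := xget a0 [set x | A x /\ phi x = y].
have psiP y : (phi @` A) y -> A (psi y) /\ phi (psi y) = y.
  move=> [x Ax xy]; rewrite /psi; case: xgetP => [z -> //|/(_ x)].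
  by case.
have psiK x : A x -> psi (phi x) = x.
  move=> Ax; have [|Az zx] := psiP (phi x); first by exists x.
  by apply: iphi; rewrite ?inE.
exists psi; split=> // y Ay U Uy.
pose C := A `\` U^°.
have cC : compact C.
  by apply: compact_closedI => //; apply: open_closedC; exact: open_interior.
have /compact_near_coveringP/near_covering_withinP cov := cC.
have [Apy ypy] := psiP y Ay.
(* By compactness of [C], points near [y] are not images of points outside the interior of [U]. *)
have : \forall y' \near y, C `<=` [set x | phi x <> y'].
  apply: (cov _ (nbhs y) (fun y' x => phi x <> y')) => x [Ax nUx].
  have xy : phi x != y.
    apply/eqP => xy; apply: nUx; suff -> : x = psi y by [].
    by apply: iphi; rewrite ?inE// ypy.
  have [[V V'] [/= Vx Vy] VV'] : exists2 V : set D' * set D',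
      nbhs (phi x) V.1 /\ nbhs y V.2 & V.1 `&` V.2 = set0.
    move: hD'; rewrite open_hausdorff => /(_ _ _ xy)[[V V'] /= [Vx Vy] [oV oV' /eqP VV']].
    exists (V, V') => //=; split; apply: open_nbhs_nbhs; split=> //.
    - exact: set_mem.
    - exact: set_mem.
  exists ([set x' | A x' -> V (phi x')], V') => /=.
    by split=> //; exact: cphi.
  move=> [x' y'] /= [Vx' Vy'] [Ax' _] xy'.
  suff : (V `&` V') y' by rewrite VV'.
  by split=> //; rewrite -xy'; exact: Vx'.
apply: filterS => y' /= hy' /psiP[Ap e].
apply: contrapT => nU; apply: (hy' (psi y')) => //; split=> // /interior_subset //.
Qed.

(** * Boxes, balls and spheres *)

Section boxes.
Context {R : realType} {m : nat}.
Implicit Types (a b x : 'rV[R]_m) (A : set 'rV[R]_m).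

Definition box a b : set 'rV[R]_m := [set x | forall i, a 0 i <= x 0 i <= b 0 i].

Definition upd a (i : 'I_m) (c : R) : 'rV[R]_m :=
  \row_j (if j == i then c else a 0 j).

Lemma box_compact a b : compact (box a b).
Proof.
have := @rV_compact R m (fun i => `[a 0 i, b 0 i]%classic) (fun i => @segment_compact _ _ _).
by congr compact; apply/seteqP; split=> x /= h i; have := h i; rewrite in_itv.
Qed.

Lemma box_closed a b : closed (box a b).
Proof. by apply: compact_closed; [exact: norm_hausdorff | exact: box_compact]. Qed.

Lemma bisect_step (Q : 'rV[R]_m -> 'rV[R]_m -> Prop) (v : R) : 0 <= v ->
  (forall a b i, let c := (a 0 i + b 0 i) / 2 in
     Q a (upd b i c) -> Q (upd a i c) b -> Q a b) ->
  (forall a b, (forall i, b 0 i - a 0 i <= v) -> Q a b) ->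
  forall a b, (forall i, b 0 i - a 0 i <= v *+ 2) -> Q a b.
Proof.
move=> v0 bis small a b ab.
(* [s] lists the coordinates whose side is still to be halved. *)
suff H (s : seq 'I_m) a' b' : (forall i, b' 0 i - a' 0 i <= v *+ 2) ->
    (forall i, i \notin s -> b' 0 i - a' 0 i <= v) -> Q a' b'.
  by apply: (H (enum 'I_m)) => // i; rewrite mem_enum.
elim: s a' b' => [|i s IH] a' b' h1 h2; first by apply: small => i; exact: h2.
apply: (bis _ _ i); apply: IH => j.
- have := h1 j; rewrite !mxE; case: eqP => // ->; lra.
- move=> js; rewrite !mxE; case: eqP => [->|/eqP ji].
    by have := h1 i; lra.
  by apply: h2; rewrite inE negb_or ji.
- have := h1 j; rewrite !mxE; case: eqP => // ->; lra.
- move=> js; rewrite !mxE; case: eqP => [->|/eqP ji].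
    by have := h1 i; lra.
  by apply: h2; rewrite inE negb_or ji.
Qed.

Lemma box_bisect (Q : 'rV[R]_m -> 'rV[R]_m -> Prop) a0 b0 :
  (forall a b i, let c := (a 0 i + b 0 i) / 2 in
     Q a (upd b i c) -> Q (upd a i c) b -> Q a b) ->
  (forall x, exists2 U, nbhs x U & forall a b, box a b `<=` U -> Q a b) ->
  Q a0 b0.
Proof.
move=> bis loc.
(* Only boxes inside the initial one matter, which keeps the limit argument in a compact set. *)
pose Q' a b := box a b `<=` box a0 b0 -> Q a b.
suff : Q' a0 b0 by apply.
pose w : R := \sum_i `|b0 0 i - a0 0 i|.
have w0 : 0 <= w by apply: sumr_ge0.
have bis' a b i : let c := (a 0 i + b 0 i) / 2 in
     Q' a (upd b i c) -> Q' (upd a i c) b -> Q' a b.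
  move=> c h1 h2 ab; apply: (bis _ _ i); [apply: h1|apply: h2] => x xab; apply: ab => j.
    have := xab j; have := xab i; rewrite !mxE eqxx; case: eqP => // ->.
    by rewrite /c; lra.
  have := xab j; have := xab i; rewrite !mxE eqxx; case: eqP => // ->.
  by rewrite /c; lra.
have good k : (forall a b, (forall i, b 0 i - a 0 i <= w / 2 ^+ k) -> Q' a b) ->
    forall a b, (forall i, b 0 i - a 0 i <= w) -> Q' a b.
  elim: k => [|k IH] h; first by move=> a b ab; apply: h => i; rewrite expr0 divr1.
  apply: IH => a b ab; apply: (@bisect_step Q' (w / 2 ^+ k.+1)) => //.
    by apply: divr_ge0 => //; exact: exprn_ge0.
  move=> i; apply: le_trans (ab i) _; rewrite le_eqVlt; apply/orP; left; apply/eqP.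
  by rewrite exprS invfM [2^-1 * _]mulrC mulrA -[RHS]mulr_natr mulfVK// pnatr_eq0.
have /compact_near_coveringP cov := @box_compact a0 b0.
have : \forall k \near \oo, box a0 b0 `<=` [set x | forall a b, box a b x ->
    (forall i, b 0 i - a 0 i <= w / 2 ^+ k) -> Q a b].
  apply: (cov _ _ (fun k x => forall a b, box a b x ->
    (forall i, b 0 i - a 0 i <= w / 2 ^+ k) -> Q a b)) => x _.
  have [U /nbhs_ballP[e /= e0 eU] UQ] := loc x.
  (* A box of sides below [e / 2] that meets the ball of radius [e / 2] lies in the ball of radius
     [e]; [w + 1] avoids division by zero. *)
  have e1 : 0 < e / 2 / (w + 1) by rewrite !divr_gt0// ltr_wpDl.
  exists (ball x (e / 2), [set k | 1 / 2 ^+ k < e / 2 / (w + 1)]) => /=.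
    split; first by apply: nbhsx_ballx; rewrite divr_gt0.
    exact: (near_infty_natSinv_expn_lt (PosNum e1)).
  move=> [x' k] /= [[_ xx'] ke] a b x'ab ab; apply: UQ => y yab; apply: eU.
  split=> // i j; rewrite (ord1 i) {i}; have := xx' 0 j; rewrite /ball/= => xx'j.
  have {}ke : w / 2 ^+ k < e / 2.
    move: ke; rewrite ltr_pdivlMr ?ltr_wpDl// => ke; apply: le_lt_trans ke.
    by rewrite mul1r mulrDr mulr1 [w * _]mulrC lerDl invr_ge0 exprn_ge0.
  have /andP[? ?] := x'ab j; have /andP[? ?] := yab j.
  have := le_lt_trans (ab j) ke.
  move: xx'j; rewrite !ltr_norml => /andP[? ?] ?; apply/andP; split.
    by lra.
  by lra.
move=> [k _ /(_ k (leqnn _)) hk]; apply: (good k) => [a b ab sub|i].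
  have [[x xab]|nab] := pselect (exists x, box a b x).
    exact: hk (sub _ xab) _ _ xab ab.
  (* An empty box lies in any neighbourhood, so the local hypothesis at an arbitrary point
     applies. *)
  have [U Ux UQ] := loc 0; apply: UQ => x xab; exfalso; apply: nab; by exists x.
rewrite /w (bigD1 i)//=; have := ler_norm (b0 0 i - a0 0 i).
have : 0 <= \sum_(i0 < m | i0 != i) `|b0 0 i0 - a0 0 i0| by apply: sumr_ge0.
by lra.
Qed.

Definition cvx A := forall x y t, A x -> A y -> 0 <= t <= 1 ->
  A ((1 - t) *: x + t *: y).

Lemma box_cvx a b : cvx (box a b).
Proof.
move=> x y t xab yab /andP[t0 t1] i; have := xab i; have := yab i; rewrite !mxE.
by move=> /andP[? ?] /andP[? ?]; apply/andP; split; nra.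
Qed.

Lemma cvxI A B : cvx A -> cvx B -> cvx (A `&` B).
Proof. by move=> cA cB x y t [? ?] [? ?] ?; split; [exact: cA|exact: cB]. Qed.

Lemma updE a i c j : upd a i c 0 j = if j == i then c else a 0 j.
Proof. by rewrite mxE. Qed.

Section box_acy.
Context {M : zmodType}.

(* Bisection reduces acyclicity of a box to that of its slices, together with
   the local statement [cone_cobd]. *)
Lemma box_acy (I : {set 'I_m}) A a b n : closed A ->
  (forall i, i \notin I -> a 0 i = b 0 i) ->
  (#|I| < n)%N \/ (cvx A /\ (0 < n)%N) ->
  acy (M := M) (A `&` box a b) n.
Proof.
elim: {I}_.+1 {-2}I (ltnSn #|I|) A a b n => // k IH I Ik A a b n cA abI hn f.
set A0 := A `&` box a b => cf.
have cA0 : closed A0 by apply: closedI => //; exact: box_closed.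
have n0 : (0 < n)%N by case: hn => [|[]//]; exact: leq_ltn_trans.
pose Q a' b' := (forall i, i \notin I -> a' 0 i = b' 0 i) -> cobd (A0 `&` box a' b') n f.
suff : Q a b by rewrite /Q /A0 -setIA setIid; apply.
apply: box_bisect => [a' b' i c h1 h2 a'b'|x]; last first.
  have [Ax|nAx] := pselect (A0 x).
    have [W Wx hW] := cone_cobd Ax cf; exists W => // a' b' sub _.
    by apply: cobd_sub hW => y [? /sub ?].
  exists (~` A0); first by apply: open_nbhs_nbhs; split=> //; exact: closed_openC.
  move=> a' b' sub _; apply: (cobd_sub (A := set0)); last exact: cobd_set0.
  by move=> y [A0y /sub].
have [iI|iI] := boolP (i \in I); last first.
  suff e : upd b' i c = b' by move: h1; rewrite e; apply.
  apply/rowP => j; rewrite updE; case: eqP => // ->.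
  by rewrite /c (a'b' i iI); field.
have {}h1 : cobd (A0 `&` box a' (upd b' i c)) n f.
  apply: h1 => j jI; rewrite updE; case: eqP => [ji|_]; last exact: a'b'.
  by move: jI; rewrite ji iI.
have {}h2 : cobd (A0 `&` box (upd a' i c) b') n f.
  apply: h2 => j jI; rewrite updE; case: eqP => [ji|_]; last exact: a'b'.
  by move: jI; rewrite ji iI.
have [ab|nab] := lerP (a' 0 i) (b' 0 i); last first.
  apply: (cobd_sub (A := set0)); last exact: cobd_set0.
  by move=> x [_ /(_ i)]; lra.
have ac : a' 0 i <= c <= b' 0 i by rewrite /c; lra.
have U : A0 `&` box a' b' `<=`
    (A0 `&` box a' (upd b' i c)) `|` (A0 `&` box (upd a' i c) b').
  move=> x [Ax xab]; have [xc|cx] := lerP (x 0 i) c; [left|right]; split=> // j.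
    by rewrite updE; case: eqP (xab j) => // ->; lra.
  by rewrite updE; case: eqP (xab j) => // ->; lra.
have Icap : (A0 `&` box a' (upd b' i c)) `&` (A0 `&` box (upd a' i c) b') =
    A0 `&` box (upd a' i c) (upd b' i c).
  apply/seteqP; split=> [x [[Ax h] [_ h']]|x [Ax h]].
    by split=> // j; have := h j; have := h' j; rewrite !updE; case: eqP => // ->; lra.
  by split; split=> // j; have := h j; rewrite !updE; case: eqP => // ->; lra.
have Ii : (#|I :\ i| < #|I|)%N by rewrite [X in (_ < X)%N](cardsD1 i) iI.
have offI j : j \notin I :\ i -> (upd a' i c) 0 j = (upd b' i c) 0 j.
  by rewrite !inE negb_and negbK !updE; case: eqP => //= _; exact: a'b'.
have cl a1 b1 : closed (A0 `&` box a1 b1) by apply: closedI => //; exact: box_closed.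
have glue : acy (M := M) (A0 `&` box (upd a' i c) (upd b' i c)) n.-1 ->
    cobd (A0 `&` box a' b') n f.
  move=> h; apply: cobd_sub U _; apply: cobd_setU => //.
  by rewrite Icap.
have Ik' : (#|I :\ i| < k)%N by exact: leq_trans Ii (Ik : (#|I| <= k)%N).
(* A slice has one free coordinate less, so the bound on [n] survives the drop of degree in
   Mayer-Vietoris. *)
case: hn => [In|[cvxA _]].
  apply: glue; apply: (IH (I :\ i)) => //; left.
  by rewrite -ltnS prednK//; exact: leq_ltn_trans Ii In.
have cvxA0 : cvx A0 by apply: cvxI => //; exact: box_cvx.
case: n n0 f cf {Q} h1 h2 glue => // -[|n] _ f cf h1 h2 glue; last first.
  by apply: glue; apply: (IH (I :\ i)) => //; right.
have [[z Az]|emp] := pselect ((A0 `&` box (upd a' i c) (upd b' i c)) !=set0).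
  by apply: glue; exact: acy0 Az.
have [[x [Ax hx]]|emp1] := pselect ((A0 `&` box a' (upd b' i c)) !=set0); last first.
  by apply: cobd_sub h2 => x /U[xL|//]; exfalso; apply: emp1; exists x.
have [[y [Ay hy]]|emp2] := pselect ((A0 `&` box (upd a' i c) b') !=set0); last first.
  by apply: cobd_sub h1 => y /U[//|yL]; exfalso; apply: emp2; exists y.
(* By convexity, the segment from [x] to [y] meets the slice between the two nonempty halves; [t] is
   the parameter of the crossing. *)
exfalso; apply: emp.
have xi := hx i; have yi := hy i; move: xi yi; rewrite !updE eqxx => xi yi.
have [xy|xy] := eqVneq (x 0 i) (y 0 i).
  exists x; split=> // j; have := hx j; rewrite !updE; case: eqP => // ->; lra.
pose t := (c - x 0 i) / (y 0 i - x 0 i).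
have yx : 0 < y 0 i - x 0 i by move: xy; rewrite neq_lt => /orP[]; lra.
have t01 : 0 <= t <= 1.
  by rewrite /t divr_ge0 ?ler_pdivrMr//; lra.
exists ((1 - t) *: x + t *: y); split; first exact: cvxA0.
have H : box a' b' ((1 - t) *: x + t *: y).
  apply: box_cvx => // j.
    by have := hx j; rewrite updE; case: eqP => // ->; lra.
  by have := hy j; rewrite updE; case: eqP => // ->; lra.
move=> j; have := H j; rewrite !updE; case: eqP => // -> _; rewrite !mxE.
suff -> : (1 - t) * x 0 i + t * y 0 i = c by lra.
by rewrite /t; field; rewrite gt_eqF.
Qed.
End box_acy.
End boxes.

Lemma contw_continuous_at (D D' : topologicalType) (B : set D) (phi : D -> D') :
  (forall x, B x -> {for x, continuous phi}) -> contw B phi.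
Proof.
move=> h x Bx U Ux; have /= := h x Bx U Ux; rewrite nbhs_simpl => xU.
by apply: (filterS (P := phi @^-1` U)) => // y ? _.
Qed.

Lemma contw_within (D D' : topologicalType) (B : set D) (phi : D -> D') :
  {within B, continuous phi} -> contw B phi.
Proof. by move=> /subspace_continuousP h x Bx U /(h x Bx). Qed.

Lemma contw_row (D : topologicalType) (R : realType) m (B : set D)
    (phi : D -> 'rV[R]_m) :
  (forall i, contw B (fun x => phi x 0 i)) -> contw B phi.
Proof.
move=> h x Bx U [P hP PU].
have : \forall y \near x, forall i, B y -> P 0 i (phi y 0 i).
  by apply: filter_forall => i; apply: (h i x Bx); exact: hP.
apply: filterS => y hy By; apply: PU => i j; rewrite (ord1 i); exact: hy.
Qed.

Lemma contw_image_compact (D D' : topologicalType) (A : set D) (phi : D -> D') :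
  compact A -> contw A phi -> compact (phi @` A).
Proof.
move=> cA cphi; apply: continuous_compact => //.
by apply/subspace_continuousP => x Ax U /(cphi x Ax).
Qed.

Lemma acy_compact_image (M : zmodType) (D D' : topologicalType) (A : set D)
    (phi : D -> D') n :
  hausdorff_space D' -> compact A -> contw A phi -> set_inj A phi ->
  (0 < n)%N \/ A !=set0 ->
  acy (M := M) A n <-> acy (M := M) (phi @` A) n.
Proof.
move=> hD' cA cphi iphi.
have [A0|nA0] := pselect (A !=set0) => hn; last first.
  have {hn}n0 : (0 < n)%N by case: hn.
  have e : A = set0 by apply/seteqP; split=> x // Ax; exfalso; apply: nA0; exists x.
  by rewrite e image_set0; split=> _ f _; exact: cobd_set0.
have [psi [K pK cpsi]] := compact_inverse hD' cA cphi iphi A0.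
split; apply: acy_retract.
- by move=> y Ay; exact: (pK y Ay).1.
- by move=> x Ax; exists x.
- exact: cpsi.
- exact: cphi.
- by move=> y Ay; exact: (pK y Ay).2.
- by move=> x Ax; exists x.
- by move=> y Ay; exact: (pK y Ay).1.
- exact: cphi.
- exact: cpsi.
- exact: K.
Qed.

Section pointwise_continuity.
Context {R : realType} {D : topologicalType}.
Implicit Types (f g : D -> R) (y : D).

Lemma continuous_mul f g y : {for y, continuous f} -> {for y, continuous g} ->
  {for y, continuous (fun z => f z * g z)}.
Proof. exact: (@continuousM R D f g y). Qed.

Lemma continuous_scal c g y : {for y, continuous g} ->
  {for y, continuous (fun z => c * g z)}.
Proof. by apply: (@continuous_mul (cst c) g y); exact: cst_continuous. Qed.

Lemma continuous_sub f g y : {for y, continuous f} -> {for y, continuous g} ->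
  {for y, continuous (fun z => f z - g z)}.
Proof. exact: (@continuousB R R^o D f g y). Qed.

Lemma continuous_csub c g y : {for y, continuous g} ->
  {for y, continuous (fun z => c - g z)}.
Proof. by apply: (@continuous_sub (cst c) g y); exact: cst_continuous. Qed.

Lemma continuous_sum (I : Type) (r : seq I) (f : I -> D -> R) y :
  (forall i, {for y, continuous (f i)}) ->
  {for y, continuous (fun z => \sum_(i <- r) f i z)}.
Proof.
move=> cf; elim: r => [|i r IH].
  have -> : (fun z => \sum_(i <- [::]) f i z) = cst 0 by apply/funext => z; rewrite big_nil.
  exact: cst_continuous.
have -> : (fun z => \sum_(j <- i :: r) f j z) = f i \+ (fun z => \sum_(j <- r) f j z).
  by apply/funext => z; rewrite big_cons.
exact: (@continuousD R R^o D (f i) _ y (cf i) IH).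
Qed.
End pointwise_continuity.

Section spheres.
Context {R : realType} {p : nat}.
Implicit Types x y : 'rV[R]_p.

Definition normsq x : R := \sum_i x 0 i ^+ 2.

Lemma continuous_dot (x : 'rV[R]_p) : continuous (fun y => \sum_i x 0 i * y 0 i).
Proof.
move=> y; apply: continuous_sum => i; apply: continuous_scal; exact: coord_continuous.
Qed.

Lemma continuous_normsq : continuous normsq.
Proof.
move=> y; apply: continuous_sum => i.
by apply: continuous_mul; exact: coord_continuous.
Qed.

Lemma normsq_ge0 x : 0 <= normsq x.
Proof. by apply: sumr_ge0 => i _; exact: sqr_ge0. Qed.

Lemma coord_le_normsq x i : x 0 i ^+ 2 <= normsq x.
Proof.
by rewrite /normsq (bigD1 i)//= lerDl; apply: sumr_ge0 => j _; exact: sqr_ge0.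
Qed.

Definition one_box : set 'rV[R]_p := box (\row__ (-1)) (\row__ 1).

Lemma one_boxP x : normsq x <= 1 -> one_box x.
Proof.
move=> x1 i; rewrite !mxE -ler_norml -[1]ger0_norm// -ler_sqr ?nnegrE//.
by rewrite normr1 real_normK ?num_real// expr1n; exact: le_trans (coord_le_normsq x i) x1.
Qed.

(** [ball_ j] is the unit disc of dimension j and [sphere_ j] the unit sphere of dimension j - 1,
    both in the span of the first j coordinates. *)
Definition ball_ j := [set x : 'rV[R]_p | normsq x <= 1 /\ forall i : 'I_p, (j <= i)%N -> x 0 i = 0].
Definition sphere_ j := [set x : 'rV[R]_p | normsq x = 1 /\ forall i : 'I_p, (j <= i)%N -> x 0 i = 0].

Lemma closed_level (f : 'rV[R]_p -> R) (C : set R) : continuous f -> closed C -> closed (f @^-1` C).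
Proof. by move=> cf cC; apply: preimage_closed => // x _; exact: cf. Qed.

Lemma closed_coord0 j : closed [set x : 'rV[R]_p | forall i : 'I_p, (j <= i)%N -> x 0 i = 0].
Proof.
rewrite (_ : [set _ | _] = \bigcap_(i in [set i : 'I_p | (j <= i)%N]) ((fun x => x 0 i) @^-1` [set 0])).
  apply: closed_bigI => i _; apply: closed_level; first by move=> x; exact: coord_continuous.
  exact: (accessible_closed_set1 (hausdorff_accessible (@norm_hausdorff R R^o))).
by apply/seteqP; split=> x h i; exact: h.
Qed.

Lemma closed_ball_ j : closed (ball_ j).
Proof.
rewrite (_ : ball_ j = normsq @^-1` [set t | t <= 1] `&`
  [set x : 'rV[R]_p | forall i : 'I_p, (j <= i)%N -> x 0 i = 0]) //.
apply: closedI; last exact: closed_coord0.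
by apply: closed_level; [exact: continuous_normsq | exact: closed_le].
Qed.

Lemma closed_sphere_ j : closed (sphere_ j).
Proof.
rewrite (_ : sphere_ j = normsq @^-1` [set 1] `&`
  [set x : 'rV[R]_p | forall i : 'I_p, (j <= i)%N -> x 0 i = 0]) //.
apply: closedI; last exact: closed_coord0.
apply: closed_level; first exact: continuous_normsq.
exact: (accessible_closed_set1 (hausdorff_accessible (@norm_hausdorff R R^o))).
Qed.

Lemma compact_ball_ j : compact (ball_ j).
Proof.
apply: subclosed_compact (@closed_ball_ j) (@box_compact _ _ (\row__ (-1)) (\row__ 1)) _.
by move=> x [/one_boxP].
Qed.

Lemma compact_sphere_ j : compact (sphere_ j).
Proof.
apply: subclosed_compact (@closed_sphere_ j) (@compact_ball_ j) _.
by move=> x [x1 h]; split=> //; rewrite x1.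
Qed.

Lemma cvx_ball_ j : cvx (ball_ j).
Proof.
move=> x y t [x1 hx] [y1 hy] /andP[t0 t1]; split=> [|i ji]; last first.
  by rewrite !mxE hx// hy// !mulr0 addr0.
apply: (@le_trans _ _ ((1 - t) * normsq x + t * normsq y)); last by nra.
rewrite /normsq !mulr_sumr -big_split/=; apply: ler_sum => i _; rewrite !mxE.
have := mulr_ge0 (mulr_ge0 t0 (_ : 0 <= 1 - t)) (sqr_ge0 (x 0 i - y 0 i)).
by rewrite subr_ge0 => /(_ t1); rewrite !expr2; nra.
Qed.

Lemma acy_ball_ (M : zmodType) j n : acy (M := M) (ball_ j) n.
Proof.
case: n => [|n].
  have : ball_ j 0; last exact: acy0.
  split=> [|i _]; rewrite ?mxE//.
  by rewrite /normsq big1// => i _; rewrite mxE expr0n.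
rewrite (_ : ball_ j = ball_ j `&` one_box); last first.
  by apply/seteqP; split=> x [] // x1 h; split; [by split|exact: one_boxP].
apply: (@box_acy R p M [set: 'I_p]%SET) => //; first exact: closed_ball_.
  by move=> i; rewrite inE.
by right; split=> //; exact: cvx_ball_.
Qed.

Lemma normsq_upd x j c : x 0 j = 0 -> normsq (upd x j c) = normsq x + c ^+ 2.
Proof.
move=> xj; rewrite /normsq (bigD1 j)//= [in RHS](bigD1 j)//= updE eqxx xj expr0n add0r addrC.
by congr (_ + _); apply: eq_bigr => i ij; rewrite updE (negPf ij).
Qed.

(** The hemisphere is the graph of plus or minus the square root of [1 - normsq] over the disc
    [ball_ j]. *)
Lemma acy_hemisphere (M : zmodType) (j : 'I_p) (s : bool) n :
  acy (M := M) [set x | sphere_ j.+1 x /\ 0 <= (-1) ^+ s * x 0 j] n.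
Proof.
pose up x := upd x j ((-1) ^+ s * Num.sqrt (1 - normsq x)).
have upE x : ball_ j x -> normsq (upd x j 0) = normsq x.
  by move=> [_ h]; rewrite normsq_upd ?h// expr0n addr0.
have downE x : normsq x = normsq (upd x j 0) + x 0 j ^+ 2.
  rewrite -(normsq_upd (x := upd x j 0) (j := j)) ?updE ?eqxx//; congr normsq.
  by apply/rowP => i; rewrite !updE; case: eqP => // ->.
apply: (acy_retract (B := ball_ j) (phi := fun x => upd x j 0) (psi := up)); last exact: acy_ball_.
- move=> x [[x1 hx] _]; split=> [|i ji].
    by rewrite -x1 (downE x) lerDl sqr_ge0.
  rewrite updE; case: eqP => // /eqP ij; apply: hx; rewrite ltn_neqAle ji andbT.
  by apply: contra ij => /eqP ?; apply/eqP/val_inj.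
- move=> x [x1 hx]; split; last first.
    by rewrite updE eqxx mulrA -expr2 sqrr_sign mul1r sqrtr_ge0.
  split=> [|i ji].
    rewrite normsq_upd ?hx// exprMn sqrr_sign mul1r sqr_sqrtr ?subr_ge0// addrC subrK//.
  rewrite updE; case: eqP => [ij|_]; first by move: ji; rewrite ij ltnn.
  by apply: hx; exact: ltnW.
- apply: contw_row => i; apply: contw_continuous_at => x _.
  rewrite (_ : (fun x => upd x j 0 0 i) = if i == j then cst 0 else fun x => x 0 i).
    by case: ifP => _; [exact: cst_continuous | exact: coord_continuous].
  by apply/funext => y; rewrite updE; case: ifP.
- apply: contw_row => i; apply: contw_continuous_at => x _.
  rewrite (_ : (fun x => up x 0 i) = if i == j then
      fun x => (-1) ^+ s * Num.sqrt (1 - normsq x) else fun x => x 0 i); last first.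
    by apply/funext => y; rewrite updE; case: ifP.
  case: ifP => _; last exact: coord_continuous.
  apply: continuous_scal.
  apply: (continuous_comp (f := fun x => 1 - normsq x)); last exact: sqrt_continuous.
  by apply: continuous_csub; exact: continuous_normsq.
- move=> x [[x1 hx] xj]; apply/rowP => i; rewrite /up !updE; case: eqP => // ->.
  have -> : 1 - normsq (upd x j 0) = ((-1) ^+ s * x 0 j) ^+ 2.
    by rewrite exprMn sqrr_sign mul1r -x1 (downE x) addrC addKr.
  by rewrite sqrtr_sqr ger0_norm// mulrA -expr2 sqrr_sign mul1r.
Qed.

(** Two hemispheres cover the sphere and meet in the equator [sphere_ j], so Mayer-Vietoris lowers
    dimension and degree together, down to the empty sphere [sphere_ 0]. *)
Lemma acy_sphere_ (M : zmodType) j n : (j <= p)%N -> n != j ->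
  acy (M := M) (sphere_ j) n.
Proof.
elim: j n => [|j IH] n jp nj f cf.
  rewrite (_ : sphere_ 0 = set0); first by apply: cobd_set0; rewrite lt0n.
  apply/seteqP; split=> x // [+ h].
  rewrite /normsq big1 => [/esym/eqP|i _]; first by rewrite oner_eq0.
  by rewrite h// expr0n.
case: n nj f cf => [|n] nj f cf.
  have [x Sx] : sphere_ j.+1 !=set0.
    exists (upd 0 (Ordinal jp) 1); split=> [|i ji].
      by rewrite normsq_upd ?mxE// expr1n /normsq big1 ?add0r// => i _; rewrite mxE expr0n.
    by rewrite updE mxE; case: eqP ji => // ->; rewrite /= ltnn.
  exact: (acy0 Sx).
pose J := Ordinal jp.
pose H (s : bool) := [set x | sphere_ j.+1 x /\ 0 <= (-1) ^+ s * x 0 J].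
have cH s : closed (H s).
  apply: closedI; first exact: closed_sphere_.
  apply: (closed_level (f := fun x => (-1) ^+ s * x 0 J) (C := [set t | 0 <= t])); last exact: closed_ge.
  by move=> x; apply: continuous_scal; exact: coord_continuous.
have U : sphere_ j.+1 `<=` H false `|` H true.
  move=> x Sx; case: (lerP 0 (x 0 J)) => xJ; [left|right]; split=> //.
    by rewrite expr0 mul1r.
  by rewrite expr1 mulN1r oppr_ge0 ltW.
have hH s : cobd (H s) n.+1 f.
  by apply: (@acy_hemisphere M J s); apply: cocyc_sub cf => x [].
apply: cobd_sub U _; apply: cobd_setU => //.
rewrite (_ : _ `&` _ = sphere_ j); first by apply: IH => //; exact: ltnW.
apply/seteqP; split=> x.
  move=> [[[x1 h] xJ] [_ xJ']]; split=> // i ji; have [iJ|iJ] := eqVneq i J.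
    by move: xJ xJ'; rewrite iJ expr0 expr1; lra.
  apply: h; rewrite ltn_neqAle ji andbT; apply: contra iJ => /eqP ?.
  by apply/eqP/val_inj.
move=> [x1 h]; have xJ : x 0 J = 0 by apply: h.
have h' : forall i : 'I_p, (j < i)%N -> x 0 i = 0 by move=> i ji; apply: h; exact: ltnW.
by split; split; rewrite // xJ mulr0.
Qed.

Lemma sphere_fullE x : sphere_ p x <-> normsq x = 1.
Proof. by split=> [[]//|x1]; split=> // i; rewrite leqNgt ltn_ord. Qed.

Lemma normsqB x y c : normsq (y - c *: x) =
  normsq y - 2 * c * (\sum_i x 0 i * y 0 i) + c ^+ 2 * normsq x.
Proof.
rewrite /normsq !mulr_sumr -sumrB -big_split/=; apply: eq_bigr => i _.
by rewrite !mxE; ring.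
Qed.

(* Stereographic projection from x0 followed by the projection of the
   hyperplane orthogonal to x0 onto a coordinate hyperplane. *)
Lemma acy_proper_sphere (M : zmodType) A x0 n : closed A -> A `<=` sphere_ p ->
  sphere_ p x0 -> ~ A x0 -> (p <= n)%N -> acy (M := M) A n.
Proof.
move=> cA AS Sx0 nAx0 pn.
have {Sx0}x01 : normsq x0 = 1 by apply/sphere_fullE.
have [i0 xi0] : exists i, x0 0 i != 0.
  apply: contrapT => h; suff : normsq x0 = 0 by rewrite x01 => /eqP; rewrite oner_eq0.
  rewrite /normsq big1// => i _; apply/eqP; rewrite expf_eq0/=.
  by apply: contrapT => /negP hi; apply: h; exists i.
have n0 : (0 < n)%N by exact: leq_trans (leq_ltn_trans (leq0n i0) (ltn_ord i0)) pn.
pose c y := \sum_i x0 0 i * y 0 i.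
have c1 y : A y -> 1 - c y != 0.
  move=> Ay; apply/eqP => cy; apply: nAx0; suff -> : x0 = y by [].
  have y1 : normsq y = 1 by apply/sphere_fullE; exact: AS.
  have : normsq (y - 1 *: x0) = 0.
    by rewrite normsqB y1 x01 -/(c y); move: cy; lra.
  move=> h; apply/rowP => i; have := coord_le_normsq (y - 1 *: x0) i.
  by rewrite h !mxE => h'; nra.
pose v y := (1 - c y)^-1 *: (y - c y *: x0).
pose st y := upd (v y) i0 0.
have vdot y : \sum_i x0 0 i * v y 0 i = 0.
  have -> : \sum_i x0 0 i * v y 0 i = (1 - c y)^-1 * (c y - c y * normsq x0).
    rewrite mulrBr /c /normsq !mulr_sumr -sumrB; apply: eq_bigr => i _.
    by rewrite !mxE -/(c y); ring.
  by rewrite x01 mulr1 subrr mulr0.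
have vinj y z : A y -> A z -> v y = v z -> y = z.
  move=> Ay Az vyz.
  (* The norm of [v u] determines the height [c u], from which [u] is recovered. *)
  have nv u : A u -> normsq (v u) * (1 - c u) = 1 + c u.
    move=> Au; have u1 : normsq u = 1 by apply/sphere_fullE; exact: AS.
    have -> : normsq (v u) = (1 - c u) ^- 2 * normsq (u - c u *: x0).
      by rewrite /normsq mulr_sumr; apply: eq_bigr => i _; rewrite mxE exprMn exprVn.
    rewrite normsqB u1 x01 -/(c u); field; exact: c1.
  have cyz : c y = c z.
    have := nv _ Ay; have := nv _ Az; rewrite vyz; have := c1 _ Ay; have := c1 _ Az.
    have := normsq_ge0 (v z); move: (normsq (v z)) (c y) (c z) => N a b N0 _ _ h1 h2.
    have : (N + 1) * (a - b) = 0 by nra.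
    by move=> /eqP; rewrite mulf_eq0 subr_eq0 => /orP[/eqP|/eqP//]; lra.
  apply/rowP => i; have /rowP/(_ i) := vyz; rewrite !mxE cyz.
  by move=> /(mulfI (_ : (1 - c z)^-1 != 0)); rewrite invr_eq0 c1// => /(_ isT); lra.
(* Orthogonality to [x0], with [x0 0 i0] nonzero, recovers the coordinate [i0] dropped by [st]. *)
have stinj : set_inj A st.
  move=> y z /set_mem Ay /set_mem Az yz; apply: vinj => //; apply/rowP => i.
  have e j : j != i0 -> v y 0 j = v z 0 j.
    by move=> ji; have /rowP/(_ j) := yz; rewrite !updE (negPf ji).
  have [->|/e//] := eqVneq i i0.
  apply: (mulfI xi0); have := vdot y; have := vdot z.
  rewrite (bigD1 i0)//= [in X in _ -> X](bigD1 i0)//= (eq_bigr (fun i => x0 0 i * v y 0 i)).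
    by move=> h1 h2; apply: (addIr (\sum_(i | i != i0) x0 0 i * v y 0 i)); rewrite h1 h2.
  by move=> j /e ->.
have cst : contw A st.
  apply: contw_row => i; apply: contw_continuous_at => y Ay.
  rewrite (_ : (fun x => st x 0 i) = if i == i0 then cst 0 else fun x => v x 0 i); last first.
    by apply/funext => z; rewrite updE; case: ifP.
  case: ifP => _; first exact: cst_continuous.
  have -> : (fun x => v x 0 i) = (fun x => (1 - c x)^-1 * (x 0 i - x0 0 i * c x)).
    by apply/funext => x; rewrite !mxE [c x * _]mulrC.
  have cc : {for y, continuous c} by exact: continuous_dot.
  apply: continuous_mul.
    by apply: continuousV; [exact: c1 | exact: continuous_csub].
  by apply: continuous_sub; [exact: coord_continuous | exact: continuous_scal].
have coA : compact A by apply: subclosed_compact cA (@compact_sphere_ p) AS.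
apply: (acy_compact_image M (norm_hausdorff (V := 'rV[R]_p)) coA cst stinj (or_introl n0)).2.
have cstA : compact (st @` A) by exact: contw_image_compact.
have [B [_ /(_ (B + 1))]] := compact_bounded cstA.
rewrite ltrDl ltr01 => /(_ isT) hB.
(* A degenerate box with p - 1 free coordinates, fewer than [n]; thus [box_acy] applies without
   convexity. *)
pose b : 'rV[R]_p := upd (\row__ (B + 1)) i0 0.
have -> : st @` A = st @` A `&` box (- b) b.
  apply/seteqP; split=> [w|w []//]; move=> Aw; split=> // i.
  rewrite mxE updE mxE; case: eqP => [->|_].
    by case: Aw => y _ <-; rewrite updE eqxx oppr0 lexx.
  rewrite -ler_norml; apply: le_trans (hB _ Aw).
  by rewrite /Num.norm/= mx_normrE; exact: (le_bigmax _ (fun ij => `|w ij.1 ij.2|) (0, i)).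
apply: (@box_acy R p M [set~ i0]); first exact: compact_closed.
  by move=> i; rewrite !inE negbK => /eqP ->; rewrite mxE updE eqxx oppr0.
by left; rewrite cardsC1 card_ord; apply: leq_trans pn; rewrite prednK//; exact: leq_ltn_trans (ltn_ord i0).
Qed.
End spheres.

(** * Closed cells and their boundary spheres *)

Section characteristic_map.
Context {R : realType} {D : topologicalType} (hD : hausdorff_space D).
Context {p : nat} {s : set D} {phi : 'rV[R]_p -> D}.
Hypothesis cphi : {within @closed_unit_ball R p, continuous phi}.
Hypothesis iphi : set_inj ((@closed_unit_ball R p)) phi.
Hypothesis phis : phi @` (@open_unit_ball R p) = s.

Let ballE : (@closed_unit_ball R p) = ball_ p.
Proof.
apply/seteqP; split=> x; last by case.
by move=> x1; split=> // i; rewrite leqNgt ltn_ord.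
Qed.

Let cw : contw ((@closed_unit_ball R p)) phi.
Proof. exact: contw_within. Qed.

Let cB : compact ((@closed_unit_ball R p)).
Proof. by rewrite ballE; exact: compact_ball_. Qed.

Lemma cell_closureE : closure s = phi @` (@closed_unit_ball R p).
Proof.
apply/seteqP; split=> y.
  have : closed (phi @` (@closed_unit_ball R p)).
    by apply: compact_closed => //; exact: contw_image_compact.
  move=> c /(closure_subset (B := phi @` (@closed_unit_ball R p))) h.
  rewrite closure_id in c; rewrite c; apply: h; rewrite -phis => _ [x x1 <-].
  by exists x => //; exact: ltW.
move=> [x x1 <-] U /(cw x1) xU.
have : \forall t \near (1 : R), closed_unit_ball (t *: x) -> U (phi (t *: x)).
  have ct : {for 1, continuous (fun t : R => t *: x)}.
    exact: scalel_continuous.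
  have := ct (fun y => closed_unit_ball y -> U (phi y)).
  by rewrite /= scale1r nbhs_simpl; apply.
move=> /nbhs_ballP[e /= e0 he].
(* A scaling factor within [e] of 1 moves [x] into the open ball; the maximum with 0 covers the case
   of large [e]. *)
pose t : R := Num.max 0 (1 - e / 2).
have t01 : 0 <= t < 1 by rewrite /t le_max lexx/= gt_max ltr01/= ltrBlDr ltrDl divr_gt0.
have tx : open_unit_ball (t *: x).
  rewrite /open_unit_ball /mkset; have -> : \sum_i (t *: x) 0 i ^+ 2 = t ^+ 2 * normsq x.
    by rewrite /normsq mulr_sumr; apply: eq_bigr => i _; rewrite mxE exprMn.
  have := normsq_ge0 x; have : normsq x <= 1 by []; nra.
exists (phi (t *: x)); split; first by rewrite -phis; exists (t *: x).
apply: he; last exact: ltW.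
rewrite /ball/= ltr_norml; apply/andP; split; first by have := t01; lra.
have : 1 - e / 2 <= t by rewrite /t le_max lexx orbT.
lra.
Qed.

Let sphere_sub : sphere_ p `<=` (@closed_unit_ball R p).
Proof. by move=> x [x1 _]; rewrite /closed_unit_ball/= -/(normsq x) x1. Qed.

Lemma cell_bdryE : bdry s = phi @` sphere_ p.
Proof.
rewrite /bdry cell_closureE; apply/seteqP; split=> y.
  move=> [[x x1 <-] nx]; exists x => //; apply/sphere_fullE.
  apply/eqP; rewrite eq_le; apply/andP; split=> //.
  by rewrite leNgt; apply/negP => x1'; apply: nx; rewrite -phis; exists x.
move=> [x Sx <-]; split; first by exists x => //; exact: sphere_sub.
rewrite -phis => -[z z1 zx].
have zx' : z = x.
  by apply: iphi => //; apply/mem_set; [exact: ltW | exact: sphere_sub].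
by move: z1; rewrite /open_unit_ball/= zx' -/(normsq x) (sphere_fullE x).1// ltxx.
Qed.

Let sphere_contw : contw (sphere_ p) phi.
Proof. exact: contw_sub cw. Qed.

Let sphere_inj : set_inj (sphere_ p) phi.
Proof. by move=> x y /set_mem/sphere_sub/mem_set ? /set_mem/sphere_sub/mem_set ?; exact: iphi. Qed.

Lemma cell_nonempty : s !=set0.
Proof.
rewrite -phis; exists (phi 0), 0 => //; rewrite /open_unit_ball/=.
by rewrite big1 ?ltr01// => i _; rewrite mxE expr0n.
Qed.

Lemma cell_bdry_closed : closed (bdry s).
Proof.
rewrite cell_bdryE; apply: compact_closed => //; apply: contw_image_compact => //.
exact: compact_sphere_.
Qed.

Lemma cell_acy (M : zmodType) n : acy (M := M) (closure s) n.
Proof.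
rewrite cell_closureE; apply: (acy_compact_image M hD cB cw iphi _).1; last by rewrite ballE; exact: acy_ball_.
right; exists 0; rewrite /closed_unit_ball/= big1 ?ler01// => i _.
by rewrite mxE expr0n.
Qed.

Lemma cell_bdry_acy (M : zmodType) n : n != p -> acy (M := M) (bdry s) n.
Proof.
move=> np; have cS := @compact_sphere_ R p p.
rewrite cell_bdryE; apply: (acy_compact_image M hD cS sphere_contw sphere_inj _).1; last by apply: acy_sphere_.
- case: n np => [|n] np; last by left.
  right; have p0 : (0 < p)%N by rewrite lt0n eq_sym.
  exists (upd 0 (Ordinal p0) 1); apply/sphere_fullE.
  by rewrite normsq_upd ?mxE// expr1n /normsq big1 ?add0r// => i _; rewrite mxE expr0n.
Qed.

Lemma cell_bdry_proper_acy (M : zmodType) A n : closed A -> A `<=` bdry s ->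
  A <> bdry s -> (p <= n)%N -> acy (M := M) A n.
Proof.
move=> cA As nA pn; pose A' := sphere_ p `&` phi @^-1` A.
have AE : A = phi @` A'.
  apply/seteqP; split=> y; last by move=> [x [_ Ax] <-].
  move=> Ay; have := As _ Ay; rewrite cell_bdryE => -[x Sx xy].
  by exists x => //; split=> //=; rewrite xy.
have A'S : A' `<=` sphere_ p by move=> x [].
have cA' : closed A'.
  move=> x clx; have Sx : sphere_ p x.
    have := @closed_sphere_ R p p; apply; exact: closure_subset clx.
  split=> //=; apply: cA => U /(sphere_contw Sx) xU.
  by have [z [[Sz Az] Uz]] := clx _ xU; exists (phi z); split=> //; exact: Uz.
have [x0 Sx0 nx0] : exists2 x0, sphere_ p x0 & ~ A' x0.
  apply: contrapT => h; apply: nA; apply/seteqP; split=> // y.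
  rewrite cell_bdryE => -[x Sx <-]; apply: contrapT => nAx; apply: h.
  by exists x => // -[].
have n0 : (0 < n)%N.
  apply: leq_trans pn; rewrite lt0n; apply/negP => /eqP p0.
  have [+ _] := Sx0; rewrite /normsq big1 => [/esym/eqP|i _]; first by rewrite oner_eq0.
  by have := leq_ltn_trans (leq0n i) (ltn_ord i); rewrite [X in (_ < X)%N]p0.
have coA' := subclosed_compact cA' (@compact_sphere_ R p p) A'S.
have iA' : set_inj A' phi.
  by move=> x y /set_mem/A'S/mem_set ? /set_mem/A'S/mem_set ?; exact: sphere_inj.
rewrite AE; apply: (acy_compact_image M hD coA' (contw_sub A'S sphere_contw) iA' (or_introl n0)).1.
exact: acy_proper_sphere Sx0 nx0 pn.
Qed.
End characteristic_map.

(** * Cell complexes *)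

(** The interface between the topology of cells and the combinatorics. By [cell_proper_acyclic],
    proper closed subsets of a boundary sphere have no reduced cohomology in the dimension of the
    sphere or above; this is what lets a class be concentrated on a single facet. *)
Record cell_complex (D : topologicalType) (cells : nat -> set (set D)) : Prop := {
  cell_disj : forall p q s t, cells p s -> cells q t -> s `&` t !=set0 -> p = q /\ s = t;
  cell_ne : forall p s, cells p s -> s !=set0;
  cell_pt : forall s, cells 0 s -> exists x, s = [set x];
  cell_faces : forall p s, cells p s -> exists B : seq (set D),
    (forall t, t \in B -> exists2 q, (q < p)%N & cells q t) /\
    (forall x, bdry s x <-> exists2 t, t \in B & t x);
  cell_bdryC : forall p s, cells p s -> closed (bdry s);
  cell_acyclic : forall (M : zmodType) p s n, cells p s -> acy (M := M) (closure s) n;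
  cell_bdry_acyclic : forall (M : zmodType) p s n, cells p s -> n != p ->
    acy (M := M) (bdry s) n;
  cell_proper_acyclic : forall (M : zmodType) p s A n, cells p s -> closed A ->
    A `<=` bdry s -> A <> bdry s -> (p <= n)%N -> acy (M := M) A n;
  cell_lf : forall p s x, cells p s -> s x -> exists L : seq (set D),
    \forall y \near x, forall q t, cells q t -> t y -> t \in L }.

Section cell_complex_theory.
Context {D : topologicalType} {cells : nat -> set (set D)}.
Hypothesis cc : cell_complex cells.
Implicit Types (s t : set D) (Y : set D).

Lemma sub_closure_cell s : s `<=` closure s. Proof. exact: subset_closure. Qed.

Lemma bdry_sub s : bdry s `<=` closure s. Proof. by move=> x []. Qed.

Lemma closure_cellP s x : closure s x <-> s x \/ bdry s x.
Proof.
split=> [sx|[/sub_closure_cell//|/bdry_sub//]].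
by have [?|?] := pselect (s x); [left|right].
Qed.

Lemma cell_dim p q s : cells p s -> cells q s -> p = q.
Proof.
move=> ps qs; have [x sx] := cell_ne cc ps.
by have [] := cell_disj cc ps qs _; first by exists x.
Qed.

Lemma cell_meet_bdry p q s t x : cells p s -> cells q t -> t x -> bdry s x ->
  (q < p)%N /\ t `<=` bdry s.
Proof.
move=> ps qt tx sx; have [B [Bc Bs]] := cell_faces cc ps.
have [t' Bt' t'x] := (Bs x).1 sx; have [q' q'p q't'] := Bc _ Bt'.
have [->  ->] : q = q' /\ t = t' by apply: (cell_disj cc qt q't'); exists x.
by split=> // y t'y; apply/Bs; exists t'.
Qed.

Lemma cell_meet_closure p q s t x : cells p s -> cells q t -> t x -> closure s x ->
  (p = q /\ s = t) \/ ((q < p)%N /\ t `<=` bdry s).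
Proof.
move=> ps qt tx /closure_cellP[sx|sx]; last by right; exact: cell_meet_bdry sx.
by left; apply: (cell_disj cc ps qt); exists x.
Qed.

Lemma cell_sub_closure p q s t : cells p s -> cells q t -> t `<=` closure s ->
  (p = q /\ s = t) \/ ((q < p)%N /\ t `<=` bdry s).
Proof.
move=> ps qt ts; have [x tx] := cell_ne cc qt.
exact: (cell_meet_closure ps qt tx (ts _ tx)).
Qed.

Lemma closure_cell_sub s t : t `<=` closure s -> closure t `<=` closure s.
Proof.
move=> /closure_subset; have /closure_id <- // := @closed_closure _ s.
Qed.

Lemma closure_sub_bdry p s t : cells p s -> t `<=` bdry s -> closure t `<=` bdry s.
Proof.
by move=> ps /closure_subset; have /closure_id <- := cell_bdryC cc ps.
Qed.

Lemma cell_bdry_lt p q s t : cells p s -> cells q t -> t `<=` bdry s -> (q < p)%N.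
Proof.
move=> ps qt ts; have [x tx] := cell_ne cc qt.
by have [] := cell_meet_bdry ps qt tx (ts _ tx).
Qed.

Lemma bdry_cell p s x : cells p s -> bdry s x ->
  exists q t, [/\ (q < p)%N, cells q t, t x & t `<=` bdry s].
Proof.
move=> ps sx; have [B [Bc Bs]] := cell_faces cc ps.
have [t Bt tx] := (Bs x).1 sx; have [q qp qt] := Bc _ Bt.
by exists q, t; split=> // y ty; apply/Bs; exists t.
Qed.

Lemma cell_relopen p s y : cells p s -> s y ->
  \forall z \near y, closure s z -> s z.
Proof.
move=> ps sy; have : nbhs y (~` bdry s).
  apply: open_nbhs_nbhs; split; last by case.
  by apply: closed_openC; exact: cell_bdryC ps.
by apply: filterS => z nz cz; apply: contrapT => nsz; exact: nz.
Qed.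

Lemma finite_faces p q s : cells p s -> finite_set (facets cells q s).
Proof.
move=> ps; have [B [Bc Bs]] := cell_faces cc ps.
apply: (@sub_finite_set _ _ [set` B]); last exact: finite_seq.
move=> t [qt ts] /=; have [x tx] := cell_ne cc qt.
have [t' Bt' t'x] := (Bs x).1 (ts _ tx); have [q' _ q't'] := Bc _ Bt'.
by have [_ ->] : q = q' /\ t = t' by apply: (cell_disj cc qt q't'); exists x.
Qed.

Lemma mem_faces p q s t : cells p s ->
  (t \in fset_set (facets cells q s)) = `[< cells q t /\ t `<=` bdry s >].
Proof.
move=> ps; rewrite in_fset_set; last exact: finite_faces ps.
by apply/idP/asboolP => [/set_mem//|h]; apply/mem_set.
Qed.

Lemma cell_lf_closure p s x : cells p s -> s x -> exists L : seq (set D),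
  (forall t, t \in L -> closure t x) /\
  \forall y \near x, forall q t, cells q t -> closure t y -> t \in L.
Proof.
move=> ps sx; have [L Lx] := cell_lf cc ps sx.
have : \forall y \near x, forall q t, cells q t -> closure t y -> t \in L.
  move: Lx => /near_near; apply: filterS => y Ly q t qt ty.
  by have [z [tz h]] := ty _ Ly; exact: h qt tz.
move=> {}Lx; exists [seq t <- L | `[< closure t x >]]; split.
  by move=> t; rewrite mem_filter => /andP[/asboolP].
have H : \forall y \near x, forall t, t \in L -> closure t y -> closure t x.
  elim: L {Lx} => [|t L IH]; first by apply: nearW.
  have tx : \forall y \near x, closure t y -> closure t x.
    have [?|ntx] := pselect (closure t x); first exact: nearW.
    have : nbhs x (~` closure t).
      by apply: open_nbhs_nbhs; split=> //; apply: closed_openC; exact: closed_closure.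
    by apply: filterS => y nty /nty.
  near=> y => t'; rewrite inE => /orP[/eqP ->|t'L]; first by near: y.
  by move: t' t'L; near: y.
near=> y => q t qt ty; rewrite mem_filter; apply/andP; split.
  apply/asboolP; have tL : t \in L by move: q t qt ty; near: y.
  by move: (t) tL ty; near: y.
by move: q t qt ty; near: y.
Unshelve. all: by end_near. Qed.

Definition subcomplex Y :=
  (forall q t x, cells q t -> t x -> Y x -> closure t `<=` Y) /\
  (forall x, Y x -> exists q t, cells q t /\ t x).

Lemma subcomplex_bdry p s : cells p s -> subcomplex (bdry s).
Proof.
move=> ps; split=> [q t x qt tx sx|x sx].
  have [_ ts] := cell_meet_bdry ps qt tx sx; exact: closure_sub_bdry ps _.
by have [q [t [_ ? ? _]]] := bdry_cell ps sx; exists q, t.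
Qed.

(** Strict inequality: [skel Y j] is the (j - 1)-skeleton, where the boundaries of j-cells lie. *)
Definition skel Y j : set D := [set x | Y x /\ exists q t, [/\ (q < j)%N, cells q t & t x]].

Lemma skel_sub Y j : skel Y j `<=` Y. Proof. by move=> x []. Qed.

Lemma skelS Y Y' j j' : Y `<=` Y' -> (j <= j')%N -> skel Y j `<=` skel Y' j'.
Proof.
move=> YY jj x [/YY Yx [q [t [qj qt tx]]]]; split=> //; exists q, t; split=> //.
exact: leq_trans jj.
Qed.

Lemma closure_sub_skel Y q j t : subcomplex Y -> cells q t -> (q < j)%N -> t `<=` Y ->
  closure t `<=` skel Y j.
Proof.
move=> [Y1 Y2] qt qj tY x tx; have [z tz] := cell_ne cc qt; split.
  exact: Y1 qt tz (tY _ tz) _ tx.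
move/closure_cellP : tx => [tx|/(bdry_cell qt)[q' [t' [q'q q't' t'x _]]]].
  by exists q, t.
by exists q', t'; split=> //; exact: ltn_trans qj.
Qed.

Lemma ev_skel Y j n P : subcomplex Y ->
  (forall q t, cells q t -> (q < j)%N -> t `<=` Y -> ev (closure t) n.+1 P) ->
  ev (skel Y j) n.+1 P.
Proof.
move=> sY h; have [Y1 Y2] := sY.
apply: (@ev_cover _ [set C | exists q t, [/\ cells q t, (q < j)%N, t `<=` Y & C = closure t]]) => //.
- move=> x [Yx [q [t [qj qt tx]]]]; exists (closure t); last exact: subset_closure.
  exists q, t; split=> //; apply: subset_trans (Y1 _ _ _ qt tx Yx).
  exact: subset_closure.
- move=> x [Yx [q0 [t0 [q0j q0t0 t0x]]]]; have [L [L1 L2]] := cell_lf_closure q0t0 t0x.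
  exists ([seq closure t | t <- L & `[< exists q, [/\ cells q t, (q < j)%N & t `<=` Y] >]]).
  split=> [C /mapP[t]|].
    rewrite mem_filter => /andP[/asboolP[q [? ? ?]] tL] ->; split; last exact: L1.
    by exists q, t.
  apply: filterS L2 => y L2 C [q [t [qt qj tY ->]]] ty; apply/map_f.
  by rewrite mem_filter (L2 _ _ qt ty) andbT; apply/asboolP; exists q.
- by move=> C [q [t [qt qj tY ->]]]; exact: h qt qj tY.
Qed.

Lemma bdry_skel p s : cells p s -> bdry s = skel (bdry s) p.
Proof.
move=> ps; apply/seteqP; split=> [x sx|]; last exact: skel_sub.
by split=> //; have [q [t [? ? ? _]]] := bdry_cell ps sx; exists q, t.
Qed.

Section gluing.
Context {M : zmodType}.
Implicit Types (f g F : seq D -> M).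

Definition cell_at j x := xget set0 [set s | cells j s /\ s x].

Lemma cell_atE j s x : cells j s -> s x -> cell_at j x = s.
Proof.
move=> js sx; rewrite /cell_at; case: xgetP => [t _ [jt tx]|/(_ s)]; last by case.
by have [_ ->] : j = j /\ t = s by apply: (cell_disj cc jt js); exists x.
Qed.

(* A generic list in the j-skeleton that meets a j-cell ends in it, so the cell
   can be read off from the last point. *)
Definition glue_cells j (g : set D -> seq D -> M) (l : seq D) : M :=
  if l is x :: l' then
    if `[< exists s, cells j s /\ s (last x l') >] then g (cell_at j (last x l')) l else 0
  else 0.

Lemma glue_skel Y j n (g : set D -> seq D -> M) : ev (skel Y j) n (fun l => glue_cells j g l = 0).
Proof.
case: n => // n; apply: ev_all => -[//|x l] _ /= [xY lY].
have [_ [q [t [qj qt tx]]]] := last_lall xY lY.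
case: asboolP => // -[s [js sx]].
have [qE _] : q = j /\ t = s by apply: (cell_disj cc qt js); exists (last x l).
by move: qj; rewrite qE ltnn.
Qed.

(** By [ev_last], a generic list either ends in the open cell or stays in the boundary; there [g s]
    vanishes and no j-cell is met. *)
Lemma glue_cell j n s (g : set D -> seq D -> M) : cells j s -> ev (bdry s) n (fun l => g s l = 0) ->
  ev (closure s) n (fun l => glue_cells j g l = g s l).
Proof.
move=> js; case: n => [|n] gs; first by rewrite /= gs.
have [x0 _] := cell_ne cc js.
have gs' : ev (closure s) n.+1 (fun l => lall (bdry s) l -> g s l = 0).
  by apply: ev_restr; apply: ev_sub gs; exact: subIsetl.
have lst := @ev_last _ (closure s) s n x0 (fun y _ => cell_relopen js).
apply: (ev_imp2 _ lst gs') => -[//|x l] _ As; rewrite [last x0 _]/= => h1 h2.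
have [sl|nsl] := pselect (s (last x l)).
  rewrite /= asboolT; last by exists s.
  by rewrite (cell_atE js sl).
have {}h1 := h1 nsl; rewrite (h2 h1) /=; case: asboolP => // -[s' [js' s'x]].
have : bdry s (last x l) by case: h1 => bx bl; exact: last_lall bx bl.
by move=> /(cell_meet_bdry js js' s'x)[]; rewrite ltnn.
Qed.

Definition ext0 (C : set D) (f : seq D -> M) (l : seq D) : M :=
  if `[< lall C l >] then f l else 0.

Lemma ext0E C f n : ev C n (fun l => ext0 C f l = f l).
Proof. by apply: ev_all => l _ Cl; rewrite /ext0 asboolT. Qed.

Lemma ext0_eq0 C A f n : ev (C `&` A) n (fun l => f l = 0) ->
  ev A n (fun l => ext0 C f l = 0).
Proof.
move/ev_restr; apply: ev_imp => l _ _ h; rewrite /ext0; case: asboolP => // /h.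
Qed.

Lemma ev_trans A n f g h : ev A n (fun l => f l = g l) -> ev A n (fun l => g l = h l) ->
  ev A n (fun l => f l = h l).
Proof. by apply: ev_imp2 => l _ _ -> ->. Qed.

Lemma ev_esym A n f g : ev A n (fun l => f l = g l) -> ev A n (fun l => g l = f l).
Proof. by apply: ev_imp => l _ _ ->. Qed.

(** The exact sequence of a closed cell and its boundary sphere: a primitive on the cell restricts
    to a cocycle of the sphere, which bounds since [n != p], and the primitive is corrected
    accordingly. *)
Lemma rel_acyclic p s n f : cells p s -> n != p ->
  ev (bdry s) n.+1 (fun l => f l = 0) -> ev (closure s) n.+2 (fun l => cob f l = 0) ->
  exists g, ev (bdry s) n (fun l => g l = 0) /\
            ev (closure s) n.+1 (fun l => f l = cob g l).
Proof.
move=> ps np f0 df0; have [g fg] := @cell_acyclic _ _ cc M p s n.+1 ps f df0.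
have gc : cocyc (bdry s) n g.
  by apply: (ev_imp2 _ f0 (ev_sub (@bdry_sub s) fg)) => l _ _ -> <-.
case: n np f0 df0 fg gc => [|n] np f0 df0 fg gc.
  by exists g; split=> //; exact: (cell_bdry_acyclic cc (M := M) ps np gc).
have [w gw] := cell_bdry_acyclic cc (M := M) ps np gc.
exists (fun l => g l - cob w l); split.
  by apply: ev_imp gw => l _ _ ->; rewrite subrr.
by apply: ev_imp fg => l _ _ ->; rewrite cobB cob_cob subr0.
Qed.

(** No cohomology above the dimension: a cell of dimension below n has no relative cohomology in
    degree n, so the primitive extends over one dimension of cells at a time. *)
Lemma skel_cobd Y j n f : subcomplex Y -> (j <= n)%N ->
  ev (skel Y j) n.+2 (fun l => cob f l = 0) ->
  exists g, ev (skel Y j) n.+1 (fun l => f l = cob g l).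
Proof.
move=> sY; elim: j f => [|j IH] f jn df.
  by exists (fun=> 0) => x [_ [q [t []]]].
have [g fg] : exists g, ev (skel Y j) n.+1 (fun l => f l = cob g l).
  by apply: IH; [exact: ltnW | apply: ev_sub df; exact: skelS].
pose f' l := f l - cob g l.
have f'0 : ev (skel Y j) n.+1 (fun l => f' l = 0).
  by apply: ev_imp fg => l _ _; rewrite /f' => ->; rewrite subrr.
have df' : ev (skel Y j.+1) n.+2 (fun l => cob f' l = 0).
  by apply: ev_imp df => l _ _; rewrite cobB cob_cob subr0.
have ex t : exists h, cells j t -> t `<=` Y -> ev (bdry t) n (fun l => h l = 0) /\
    ev (closure t) n.+1 (fun l => f' l = cob h l).
  have [[jt tY]|nt] := pselect (cells j t /\ t `<=` Y); last first.
    by exists (fun=> 0) => ? ?; exfalso; exact: nt.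
  have ct := closure_sub_skel sY jt (ltnSn j) tY.
  have bt : bdry t `<=` skel Y j.
    rewrite (bdry_skel jt); apply: skelS => // x /bdry_sub/ct; exact: skel_sub.
  have nj : n != j by rewrite gtn_eqF.
  have [h hP] := rel_acyclic jt nj (ev_sub bt f'0) (ev_sub ct df').
  by exists h.
pose h t := projT1 (cid (ex t)).
have hP t : cells j t -> t `<=` Y -> ev (bdry t) n (fun l => h t l = 0) /\
    ev (closure t) n.+1 (fun l => f' l = cob (h t) l).
  by rewrite /h; case: cid.
exists (fun l => g l + glue_cells j h l); apply: ev_skel => // q t qt.
rewrite ltnS leq_eqVlt => /orP[/eqP qj|qj] tY.
  rewrite qj in qt; have [h1 h2] := hP t qt tY.
  apply: (ev_imp2 _ h2 (ev_cob (glue_cell qt h1))) => l _ _; rewrite cobD => e1 ->.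
  by rewrite -e1 /f' addrC subrK.
have ct := closure_sub_skel sY qt qj tY.
apply: (ev_imp2 _ (ev_sub ct fg) (ev_sub ct (ev_cob0 (glue_skel Y j n h)))) => l _ _ -> e.
by rewrite cobD e addr0.
Qed.
End gluing.
End cell_complex_theory.

(** * Evaluation of relative cocycles on cells *)

Section evaluation.
Context {D : topologicalType} {cells : nat -> set (set D)}.
Hypothesis cc : cell_complex cells.
Implicit Types (s t : set D) (Y : set D).

Local Notation skel := (skel (cells := cells)).
Local Notation cfaces q s := (fset_set (facets cells q s)).

Section def.
Context {M : zmodType} (inc : set D -> set D -> int).
Implicit Types (f g F G : seq D -> M).

Definition primitive q s F f : Prop :=
  ev (skel (bdry s) q) q.+1 (fun l => f l = 0) /\
  ev (closure s) q.+2 (fun l => F l = cob f l).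

(* The value of a relative p-cocycle F of (closure s, bdry s): a primitive f of F
   vanishing below the facets restricts to a relative cocycle of each facet. *)
Fixpoint cell_eval p s F : M :=
  if p is q.+1 then
    let f := xget (fun=> 0) [set f | primitive q s F f] in
    \sum_(t <- cfaces q s) cell_eval q t f *~ inc s t
  else F (xget [::] [set l | exists2 x, s x & l = [:: x]]).

Definition rel_cocycle p s F : Prop :=
  ev (bdry s) p.+1 (fun l => F l = 0) /\
  ev (closure s) p.+2 (fun l => cob F l = 0).

(** [c] is a reduced cycle on the facets of [s]; for [c = inc s] this is the relation that the
    boundary of a boundary is zero. Testing on all [m : M] asks for it only as far as [M] can see,
    for instance modulo 2. *)
Definition balanced q s (c : set D -> int) : Prop :=
  match q with
  | 0 => forall m : M, \sum_(t <- cfaces 0 s) m *~ c t = 0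
  | q'.+1 => forall u, cells q' u -> u `<=` bdry s -> forall m : M,
      \sum_(t <- cfaces q s | `[< u `<=` bdry t >]) m *~ inc t u *~ c t = 0
  end.

Lemma cell_eval_ext p s F G : cells p s ->
  ev (closure s) p.+1 (fun l => F l = G l) -> cell_eval p s F = cell_eval p s G.
Proof.
case: p => [|p] ps FG.
  have [x sx] := cell_pt cc ps.
  rewrite /=; case: xgetP => [_ _ [y sy ->]|/(_ [:: x])[]].
    by apply: FG; exact: sub_closure_cell.
  by exists x; rewrite ?sx.
(* The choice made in [cell_eval] depends only on the set of primitives. *)
rewrite /=; suff -> : [set f | primitive p s F f] = [set f | primitive p s G f] by [].
apply/seteqP; split=> f [f0 Ff]; split=> //.
  by apply: (ev_imp2 _ Ff FG) => l _ _ <- <-.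
by apply: (ev_imp2 _ Ff FG) => l _ _ <- <-.
Qed.

Lemma rel_cocycle_ext p s F G : ev (closure s) p.+1 (fun l => F l = G l) ->
  rel_cocycle p s F -> rel_cocycle p s G.
Proof.
move=> FG [F0 dF]; split.
  by apply: (ev_imp2 _ F0 (ev_sub (@bdry_sub _ s) FG)) => l _ _ -> <-.
by apply: (ev_imp2 _ dF (ev_cob FG)) => l _ _ -> <-.
Qed.

Lemma rel_cocycleD p s F G : rel_cocycle p s F -> rel_cocycle p s G ->
  rel_cocycle p s (fun l => F l + G l).
Proof.
move=> [F0 dF] [G0 dG]; split.
  by apply: (ev_imp2 _ F0 G0) => l _ _ -> ->; rewrite addr0.
by apply: (ev_imp2 _ dF dG) => l _ _; rewrite cobD => -> ->; rewrite addr0.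
Qed.

Lemma rel_cocycleN p s F : rel_cocycle p s F -> rel_cocycle p s (fun l => - F l).
Proof.
move=> [F0 dF]; split; first by apply: ev_imp F0 => l _ _ ->; rewrite oppr0.
by apply: ev_imp dF => l _ _; rewrite cobN => ->; rewrite oppr0.
Qed.

Lemma rel_cocycle0 p s : rel_cocycle p s (fun=> 0).
Proof. by split; apply: ev_all => l _ _ //; rewrite cob0. Qed.

Lemma primitive_ex q s F : cells q.+1 s -> rel_cocycle q.+1 s F ->
  exists f, primitive q s F f.
Proof.
move=> ps [F0 dF].
have [g Fg] := cell_acyclic cc (M := M) ps dF.
have dg : ev (skel (bdry s) q) q.+2 (fun l => cob g l = 0).
  apply: (ev_sub (@skel_sub _ _ _ _)).
  by apply: (ev_imp2 _ F0 (ev_sub (@bdry_sub _ s) Fg)) => l _ _ -> <-.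
have [w gw] := skel_cobd cc (subcomplex_bdry cc ps) (leqnn q) dg.
exists (fun l => g l - cob w l); split.
  by apply: ev_imp gw => l _ _ ->; rewrite subrr.
by apply: ev_imp Fg => l _ _ ->; rewrite cobB cob_cob subr0.
Qed.

Lemma bdry_facet_skel q s t : cells q.+1 s -> cells q t -> t `<=` bdry s ->
  bdry t `<=` skel (bdry s) q.
Proof.
move=> ps qt ts; rewrite (bdry_skel cc qt); apply: skelS => //.
by apply: subset_trans (closure_sub_bdry cc ps ts); exact: bdry_sub.
Qed.

Lemma primitive_facet q s t F f : cells q.+1 s -> cells q t -> t `<=` bdry s ->
  ev (bdry s) q.+2 (fun l => F l = 0) -> primitive q s F f -> rel_cocycle q t f.
Proof.
move=> ps qt ts F0 [f0 Ff]; split.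
  by apply: ev_sub f0; exact: bdry_facet_skel.
apply: (ev_sub (closure_sub_bdry cc ps ts)).
by apply: (ev_imp2 _ F0 (ev_sub (@bdry_sub _ s) Ff)) => l _ _ -> <-.
Qed.

Definition additive_at q := forall t F G, cells q t -> rel_cocycle q t F ->
  rel_cocycle q t G -> cell_eval q t (fun l => F l + G l) = cell_eval q t F + cell_eval q t G.

Definition stokes_at q := forall s F f, cells q.+1 s -> rel_cocycle q.+1 s F ->
  primitive q s F f -> cell_eval q.+1 s F = \sum_(t <- cfaces q s) cell_eval q t f *~ inc s t.

Lemma cell_eval_null0 q t : additive_at q -> cells q t -> cell_eval q t (fun=> 0) = 0.
Proof.
move=> add qt; have := add t _ _ qt (@rel_cocycle0 q t) (@rel_cocycle0 q t).
have -> : (fun _ : seq D => 0 + 0 : M) = (fun=> 0) by apply/funext => l; rewrite addr0.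
by move/eqP; rewrite -subr_eq0 opprD addrA subrr sub0r oppr_eq0 => /eqP.
Qed.

Lemma cell_evalN q t F : additive_at q -> cells q t -> rel_cocycle q t F ->
  cell_eval q t (fun l => - F l) = - cell_eval q t F.
Proof.
move=> add qt rF; apply/eqP; rewrite -addr_eq0 -add//; last exact: rel_cocycleN.
rewrite (_ : (fun l => _) = (fun=> 0)); first by rewrite cell_eval_null0.
by apply/funext => l; rewrite addNr.
Qed.

Lemma sum_facets_facet q s t (Q : set D -> M) : cells q.+2 s -> cells q.+1 t ->
  t `<=` bdry s ->
  \sum_(u <- cfaces q t) Q u = \sum_(u <- cfaces q s | `[< u `<=` bdry t >]) Q u.
Proof.
move=> ps qt ts; rewrite -[RHS]big_filter; apply: perm_big; apply: uniq_perm.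
- exact: fset_uniq.
- by apply: filter_uniq; exact: fset_uniq.
move=> u; rewrite mem_filter (mem_faces cc _ _ qt) (mem_faces cc _ _ ps).
apply/asboolP/andP => [[qu ut]|[/asboolP ut /asboolP[qu _]]]; last by split.
split; apply/asboolP => //; split=> //.
apply: subset_trans ut _; apply: subset_trans (closure_sub_bdry cc ps ts).
exact: bdry_sub.
Qed.

(* A cocycle vanishing below the facets is a coboundary; its values on the facets
   cancel against every balanced family of coefficients. *)
Lemma balanced_sum q s c f : additive_at q ->
  (if q is q'.+1 then stokes_at q' else True) -> cells q.+1 s -> balanced q s c ->
  ev (skel (bdry s) q) q.+1 (fun l => f l = 0) ->
  ev (closure s) q.+2 (fun l => cob f l = 0) ->
  \sum_(t <- cfaces q s) cell_eval q t f *~ c t = 0.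
Proof.
move=> add stk ps bal f0 df.
have [w fw] := cell_acyclic cc (M := M) ps df.
have tfaces t : t \in cfaces q s -> cells q t /\ t `<=` bdry s.
  by rewrite (mem_faces cc _ _ ps) => /asboolP.
have clt t : t \in cfaces q s -> closure t `<=` closure s.
  move=> /tfaces[qt ts]; apply: subset_trans (closure_sub_bdry cc ps ts) _.
  exact: bdry_sub.
case: q add stk ps bal f0 df fw tfaces clt => [|q] add stk ps bal f0 df fw tfaces clt.
  rewrite -[RHS](bal (w [::])); apply: eq_big_seq => t ts; congr (_ *~ _).
  have [qt _] := tfaces _ ts.
  rewrite (@cell_eval_ext 0 t f (cob w)) //; last by apply: ev_sub fw; exact: clt.
  have [x tx] := cell_pt cc qt.
  rewrite /=; case: xgetP => [_ _ [y sy ->]|/(_ [:: x])[]].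
    by rewrite /= subr0.
  by exists x; rewrite ?tx.
have sb := subcomplex_bdry cc ps.
have dw : ev (skel (bdry s) q) q.+2 (fun l => cob w l = 0).
  have h1 := ev_sub (skelS (Y := bdry s) (fun x h => h) (leqnSn q)) f0.
  have h2 : skel (bdry s) q `<=` closure s.
    by apply: subset_trans (@bdry_sub _ s); exact: skel_sub.
  by apply: (ev_imp2 _ h1 (ev_sub h2 fw)) => l _ _ -> <-.
(* Corrected by [cob v], the primitive vanishes below the facets of the facets, as Stokes
   requires. *)
have [v wv] := skel_cobd cc sb (leqnn q) dw.
pose w' l := w l - cob v l.
have w'0 : ev (skel (bdry s) q) q.+1 (fun l => w' l = 0).
  by apply: ev_imp wv => l _ _; rewrite /w' => ->; rewrite subrr.
have fw' : ev (closure s) q.+2 (fun l => f l = cob w' l).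
  by apply: ev_imp fw => l _ _ ->; rewrite /w' cobB cob_cob subr0.
(* Stokes on every facet; exchanging the sums leaves, for each [u], the sum that balance makes
   zero. *)
have -> : \sum_(t <- cfaces q.+1 s) cell_eval q.+1 t f *~ c t =
   \sum_(t <- cfaces q.+1 s) \sum_(u <- cfaces q s)
     (if `[< u `<=` bdry t >] then cell_eval q u w' *~ inc t u *~ c t else 0).
  apply: eq_big_seq => t ts; have [qt tb] := tfaces _ ts.
  have rf : rel_cocycle q.+1 t f.
    split; first by apply: ev_sub f0; exact: bdry_facet_skel.
    by apply: ev_sub df; exact: clt.
  have ft : ev (closure t) q.+2 (fun l => f l = cob w' l) by apply: ev_sub fw'; exact: clt.
  rewrite (cell_eval_ext qt ft) (@stk t (cob w') w') //; last 2 first.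
  - exact: rel_cocycle_ext ft rf.
  - split; last exact: ev_all.
    apply: ev_sub w'0; apply: skelS => //.
    apply: subset_trans (closure_sub_bdry cc ps tb); exact: bdry_sub.
  by rewrite (sum_facets_facet _ ps qt tb) mulrz_suml big_mkcond.
rewrite exchange_big/= big_seq; apply: big1 => u.
rewrite (mem_faces cc _ _ ps) => /asboolP[qu us].
by rewrite -big_mkcond/=; exact: bal.
Qed.

Hypothesis inc_bal : forall q s, cells q.+1 s -> balanced q s (inc s).

(** One induction for two facts: independence of the primitive ([stokes_at]) uses additivity one
    dimension lower, and additivity uses independence in the same dimension. *)
Lemma cell_eval_theory q : additive_at q /\
  (if q is q'.+1 then stokes_at q' else True).
Proof.
elim: q => [|q [add stk]]; first by [].
have stk' : stokes_at q.
  move=> s F f ps [F0 dF] pf; rewrite /=; set f0 := xget _ _.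
  have pf0 : primitive q s F f0.
    by rewrite /f0; case: xgetP => // h; exfalso; exact: h pf.
  case: (pf) (pf0) => [p1 p2] [p3 p4].
  have d1 : ev (skel (bdry s) q) q.+1 (fun l => f l - f0 l = 0).
    by apply: (ev_imp2 _ p1 p3) => l _ _ -> ->; rewrite subrr.
  have d2 : ev (closure s) q.+2 (fun l => cob (fun l => f l - f0 l) l = 0).
    by apply: (ev_imp2 _ p2 p4) => l _ _; rewrite cobB => <- <-; rewrite subrr.
  have h := balanced_sum add stk ps (inc_bal ps) d1 d2.
 apply/eqP; rewrite -subr_eq0 -sumrB -oppr_eq0 -sumrN -[X in _ == X]h.
  apply/eqP; apply: eq_big_seq => t; rewrite (mem_faces cc _ _ ps) => /asboolP[qt ts].
  have rf := primitive_facet ps qt ts F0 pf; have rf0 := primitive_facet ps qt ts F0 pf0.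
  by rewrite add// ?cell_evalN ?mulrzBl ?opprB//; exact: rel_cocycleN.
split=> // s F G ps rF rG.
have [f pf] := primitive_ex ps rF; have [g pg] := primitive_ex ps rG.
have pfg : primitive q s (fun l => F l + G l) (fun l => f l + g l).
  case: pf pg => [f0 Ff] [g0 Gg]; split.
    by apply: (ev_imp2 _ f0 g0) => l _ _ -> ->; rewrite addr0.
  by apply: (ev_imp2 _ Ff Gg) => l _ _ -> ->; rewrite cobD.
rewrite (stk' _ _ _ ps (rel_cocycleD rF rG) pfg) (stk' _ _ _ ps rF pf) (stk' _ _ _ ps rG pg).
rewrite -big_split/=; apply: eq_big_seq => t; rewrite (mem_faces cc _ _ ps) => /asboolP[qt ts].
rewrite add ?mulrzDl//.
  exact: primitive_facet ps qt ts rF.1 pf.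
exact: primitive_facet ps qt ts rG.1 pg.
Qed.

Lemma cell_evalD q : additive_at q.
Proof. by case: (cell_eval_theory q). Qed.

Lemma cell_eval_stokes q : stokes_at q.
Proof. by case: (cell_eval_theory q.+1). Qed.

Lemma cell_eval0 q t F : cells q t -> ev (closure t) q.+1 (fun l => F l = 0) ->
  cell_eval q t F = 0.
Proof.
move=> qt F0; rewrite (@cell_eval_ext _ _ F (fun=> 0))//.
by apply: cell_eval_null0 => //; exact: cell_evalD.
Qed.

Lemma balanced_facets_sum q s c f : cells q.+1 s -> balanced q s c ->
  ev (skel (bdry s) q) q.+1 (fun l => f l = 0) ->
  ev (closure s) q.+2 (fun l => cob f l = 0) ->
  \sum_(t <- cfaces q s) cell_eval q t f *~ c t = 0.
Proof. by have [? ?] := cell_eval_theory q; exact: balanced_sum. Qed.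

Hypothesis inc_unit : forall q s t, cells q.+1 s -> cells q t -> t `<=` bdry s ->
  inc s t = 1 \/ inc s t = -1.

Hypothesis facet_ex : forall q s, cells q.+1 s -> facets cells q s !=set0.

(** Facets are maximal among the cells of the boundary, so an open facet is relatively open
    there. *)
Lemma horn_closed q s t : cells q.+1 s -> cells q t -> t `<=` bdry s ->
  closed (bdry s `\` t).
Proof.
move=> ps qt ts x clx.
have bx : bdry s x.
  have /closure_id -> := cell_bdryC cc ps; apply: closure_subset clx; exact: subDsetl.
split=> // tx; have [L Lx] := cell_lf cc qt tx.
have : \forall y \near x, bdry s y -> t y.
  have tn := cell_relopen cc qt tx.
  have [L' [L'1 L'2]] := cell_lf_closure cc qt tx.
  apply: filterS2 L'2 tn => y L'y ty by_.
  have [q' [t' [q'q q't' t'y t's]]] := bdry_cell cc ps by_.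
  have : closure t' x by apply/L'1/(L'y _ _ q't')/sub_closure_cell.
  move=> /(cell_meet_closure cc q't' qt tx)[[_ <-]//|[]].
  by rewrite ltnNge -ltnS q'q.
by move=> /clx[y [[by_ nty] /(_ by_)]].
Qed.

Lemma horn_proper s t : t !=set0 -> t `<=` bdry s -> bdry s `\` t <> bdry s.
Proof. by move=> [x tx] ts e; have := ts _ tx; rewrite -e => -[]. Qed.

Lemma skel_horn q s t : cells q t -> skel (bdry s) q `<=` bdry s `\` t.
Proof.
move=> qt x [bx [q' [t' [q'q q't' t'x]]]]; split=> // tx.
have [e _] : q' = q /\ t' = t by apply: (cell_disj cc q't' qt); exists x.
by move: q'q; rewrite e ltnn.
Qed.

Lemma facet_horn q s t u : cells q.+1 s -> cells q t -> cells q u -> u <> t ->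
  u `<=` bdry s -> closure u `<=` bdry s `\` t.
Proof.
move=> ps qt qu ut us x ux; split; first exact: (closure_sub_bdry cc ps us ux).
move=> tx; have [[_ ?]|[]] := cell_meet_closure cc qu qt tx ux; first by exfalso; exact: ut.
by rewrite ltnn.
Qed.

Lemma closure_horn q s t : cells q t -> closure t `&` (bdry s `\` t) `<=` bdry t.
Proof. by move=> qt x [/closure_cellP[] // tx [_]]. Qed.

(* Modifying the primitive by a coboundary, it can be concentrated on one facet:
   the complement of a facet in the boundary sphere is a proper closed subset. *)
Lemma primitive_on_facet q s t F : cells q.+1 s -> cells q t -> t `<=` bdry s ->
  rel_cocycle q.+1 s F -> exists f, primitive q s F f /\
    ev (bdry s `\` t) q.+1 (fun l => f l = 0).
Proof.
move=> ps qt ts rF; have [f [f0 Ff]] := primitive_ex ps rF.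
have [|w fw] := cell_proper_acyclic cc (M := M) (n := q.+1) ps (horn_closed ps qt ts)
    (@subDsetl _ _ _) (horn_proper (cell_ne cc qt) ts) (leqnn _) (f := f).
  apply: (ev_sub (B := bdry s `\` t) (@subDsetl _ (bdry s) t)).
  by apply: (ev_imp2 _ rF.1 (ev_sub (@bdry_sub _ s) Ff)) => l _ _ -> <-.
have z : ev (bdry s `\` t) q.+1 (fun l => f l - cob w l = 0).
  by apply: ev_imp fw => l _ _ ->; rewrite subrr.
exists (fun l => f l - cob w l); split=> //; split.
  by apply: ev_sub z; exact: skel_horn.
by apply: ev_imp Ff => l _ _ ->; rewrite cobB cob_cob subr0.
Qed.

Lemma sum_one_facet q s t f : cells q.+1 s -> cells q t -> t `<=` bdry s ->
  ev (bdry s `\` t) q.+1 (fun l => f l = 0) -> forall c : set D -> int,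
  \sum_(u <- cfaces q s) cell_eval q u f *~ c u = cell_eval q t f *~ c t.
Proof.
move=> ps qt ts f0 c; rewrite (big_rem t)/=; last first.
  by rewrite (mem_faces cc _ _ ps); apply/asboolP.
rewrite big_seq big1 ?addr0// => u; rewrite (mem_rem_uniqF, mem_rem_uniq) ?fset_uniq//.
rewrite inE/= (mem_faces cc _ _ ps) => /andP[/eqP ut /asboolP[qu us]].
rewrite cell_eval0 ?mul0rz//; apply: ev_sub f0; exact: facet_horn ps qt qu ut us.
Qed.

Lemma extend_facet q s t f : cells q.+1 s -> cells q t -> t `<=` bdry s ->
  ev (bdry t) q.+1 (fun l => f l = 0) -> ev (bdry s `\` t) q.+1 (fun l => ext0 (closure t) f l = 0).
Proof.
move=> ps qt ts f0; apply: ext0_eq0; apply: ev_sub f0; exact: closure_horn qt.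
Qed.

Lemma ev_bdry_facet q s t n P : cells q.+1 s -> cells q t -> t `<=` bdry s ->
  ev (bdry s `\` t) n.+1 P -> ev (closure t) n.+1 P -> ev (bdry s) n.+1 P.
Proof.
move=> ps qt ts h1 h2.
have e : bdry s `<=` (bdry s `\` t) `|` closure t.
  move=> x bx; have [tx|ntx] := pselect (t x); [right|by left].
  exact: sub_closure_cell.
apply: (ev_sub e); apply: ev_setU => //; first exact: horn_closed ps qt ts.
exact: closed_closure.
Qed.

(** Extending by zero from a facet and applying [cob] realizes the connecting map; it multiplies the
    value by an incidence number. *)
Lemma facet_relcoc q s t f : cells q.+1 s -> cells q t -> t `<=` bdry s ->
  rel_cocycle q t f -> let f' := ext0 (closure t) f in
  [/\ rel_cocycle q.+1 s (cob f'), primitive q s (cob f') f',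
      ev (bdry s `\` t) q.+1 (fun l => f' l = 0) &
      cell_eval q.+1 s (cob f') = cell_eval q t f *~ inc s t].
Proof.
move=> ps qt ts [f0 df] f'.
have z := extend_facet ps qt ts f0; rewrite -/f' in z.
have rF : rel_cocycle q.+1 s (cob f').
  split; last by apply: ev_all => l _ _; rewrite cob_cob.
  apply: (ev_bdry_facet ps qt ts); first exact: ev_cob0.
  by apply: (ev_imp2 _ df (ev_cob (ext0E (closure t) f q.+1))) => l _ _ <- <-.
have pf' : primitive q s (cob f') f'.
  by split; [apply: ev_sub z; exact: skel_horn | exact: ev_all].
split=> //; rewrite (cell_eval_stokes ps rF pf') (sum_one_facet ps qt ts z).
by congr (_ *~ _); apply: cell_eval_ext => //; exact: ext0E.
Qed.

Lemma inc_sq q s t : cells q.+1 s -> cells q t -> t `<=` bdry s ->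
  inc s t * inc s t = 1.
Proof.
by move=> ps qt ts; have [->|->] := inc_unit ps qt ts; rewrite ?mulrNN mulr1.
Qed.

Lemma cell_eval_surj p s m : cells p s ->
  exists2 F, rel_cocycle p s F & cell_eval p s F = m.
Proof.
elim: p s m => [|q IH] s m ps.
  have [x sx] := cell_pt cc ps; exists (fun=> m) => //; split.
    by move=> y /(bdry_cell cc ps)[q [t []]].
  by apply: ev_all => -[//|y [|z [|]]]//= _ _; rewrite subr0 subrr.
have [t [qt ts]] := facet_ex ps.
have [f rf fm] := IH t (m *~ inc s t) qt.
have [rF _ _ e] := facet_relcoc ps qt ts rf.
exists (cob (ext0 (closure t) f)) => //.
by rewrite e fm -mulrzA (inc_sq ps qt ts) mulr1z.
Qed.

(** A primitive concentrated on one facet has there, up to sign, the value of [F]; if that is zero,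
    the induction hypothesis lets the primitive be removed from the boundary. With [cell_eval_surj]
    this identifies the relative cohomology in degree p with [M]. *)
Lemma cell_eval_ker p s F : cells p s -> rel_cocycle p s F -> cell_eval p s F = 0 ->
  exists g, ev (bdry s) p (fun l => g l = 0) /\
            ev (closure s) p.+1 (fun l => F l = cob g l).
Proof.
elim: p s F => [|q IH] s F ps rF F0.
  exists (fun=> 0); split=> // y sy; have [x sx] := cell_pt cc ps.
  move: F0; rewrite /= subr0; case: xgetP => [_ _ [z sz ->]|/(_ [:: x])[]].
    have -> // : z = y; have [//|/(bdry_cell cc ps)[? [? []]]//] := (closure_cellP s y).1 sy.
    by move: sz; rewrite sx => -> ->.
  by exists x; rewrite ?sx.
have [t [qt ts]] := facet_ex ps.
have [f [pf z]] := primitive_on_facet ps qt ts rF.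
move: F0; rewrite (cell_eval_stokes ps rF pf) (sum_one_facet ps qt ts z) => ft0.
have rf := primitive_facet ps qt ts rF.1 pf.
have [g [g0 fg]] : exists g, ev (bdry t) q (fun l => g l = 0) /\
    ev (closure t) q.+1 (fun l => f l = cob g l).
  apply: IH => //; rewrite -[LHS]mulr1z -(inc_sq ps qt ts) mulrzA ft0 mul0rz //.
pose g' := ext0 (closure t) g.
have g'0 : ev (bdry s `\` t) q (fun l => g' l = 0).
  by apply: ext0_eq0; apply: ev_sub g0; exact: closure_horn qt.
have fg' : ev (bdry s) q.+1 (fun l => f l = cob g' l).
  apply: (ev_bdry_facet ps qt ts); first by apply: (ev_imp2 _ z (ev_cob0 g'0)) => l _ _ -> ->.
  by apply: (ev_imp2 _ fg (ev_cob (ext0E (closure t) g q))) => l _ _ -> <-.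
exists (fun l => f l - cob g' l); split.
  by apply: ev_imp fg' => l _ _ ->; rewrite subrr.
by apply: ev_imp pf.2 => l _ _ ->; rewrite cobB cob_cob subr0.
Qed.

(* Two facets carry cohomologous classes, so a balanced family is determined up
   to sign by one coefficient. *)
Lemma balanced_vanish q s t u c (m : M) : cells q.+1 s -> cells q t -> t `<=` bdry s ->
  cells q u -> u `<=` bdry s -> balanced q s c -> c t = 0 -> m *~ c u = 0.
Proof.
move=> ps qt ts qu us bal ct.
have [f rf fm] := cell_eval_surj m qu.
have [rF [p1 p2] z e] := facet_relcoc ps qu us rf; set f' := ext0 _ _ in rF p1 p2 z e.
have [h [[h1 h2] hz]] := primitive_on_facet ps qt ts rF.
have d1 : ev (skel (bdry s) q) q.+1 (fun l => f' l - h l = 0).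
  by apply: (ev_imp2 _ p1 h1) => l _ _ -> ->; rewrite subrr.
have d2 : ev (closure s) q.+2 (fun l => cob (fun l => f' l - h l) l = 0).
  by apply: ev_imp h2 => l _ _; rewrite cobB => <-; rewrite subrr.
have := balanced_facets_sum ps bal d1 d2.
rewrite (eq_big_seq (fun t => cell_eval q t f' *~ c t - cell_eval q t h *~ c t)); last first.
  move=> v; rewrite (mem_faces cc _ _ ps) => /asboolP[qv vs].
  have r1 := primitive_facet ps qv vs rF.1 (conj p1 p2).
  have r2 := primitive_facet ps qv vs rF.1 (conj h1 h2).
  rewrite cell_evalD// ?cell_evalN ?mulrzBl//; first exact: cell_evalD.
  exact: rel_cocycleN.
rewrite sumrB (sum_one_facet ps qu us z) (sum_one_facet ps qt ts hz) ct mulr0z subr0 => <-.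
by rewrite -fm; congr (_ *~ _); apply: esym; apply: cell_eval_ext => //; exact: ext0E.
Qed.
End def.
End evaluation.

(** * Naturality and transport of the evaluation *)

Section naturality.
Context {D : topologicalType} {cells : nat -> set (set D)}.
Hypothesis cc : cell_complex cells.
Context {M M' : zmodType} (inc : set D -> set D -> int) (j : {additive M -> M'}).
Hypothesis balM : forall q s, cells q.+1 s -> balanced (cells := cells) (M := M) inc q s (inc s).
Hypothesis balM' : forall q s, cells q.+1 s -> balanced (cells := cells) (M := M') inc q s (inc s).

(** Serves for [rho g], for scalars and for the inclusion of the fixed elements. *)
Lemma cell_eval_nat p s (F : seq D -> M) : cells p s -> rel_cocycle p s F ->
  cell_eval (cells := cells) inc p s (fun l => j (F l)) = j (cell_eval (cells := cells) inc p s F).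
Proof.
elim: p s F => [|q IH] s F ps rF //.
have [f pf] := primitive_ex cc ps rF.
have ev_j A n (g : seq D -> M) : ev A n (fun l => g l = 0) -> ev A n (fun l => j (g l) = 0).
  by apply: ev_imp => l _ _ ->; rewrite raddf0.
have rjF : rel_cocycle q.+1 s (fun l => j (F l)).
  case: rF => F0 dF; split; first exact: ev_j.
  by apply: ev_imp dF => l _ _ h; rewrite -cob_additive h raddf0.
have pjf : primitive (cells := cells) q s (fun l => j (F l)) (fun l => j (f l)).
  case: pf => f0 Ff; split; first exact: ev_j.
  by apply: ev_imp Ff => l _ _ ->; rewrite cob_additive.
rewrite (cell_eval_stokes cc balM ps rF pf) (cell_eval_stokes cc balM' ps rjF pjf) raddf_sum.
apply: eq_big_seq => t; rewrite (mem_faces cc _ _ ps) => /asboolP[qt ts].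
by rewrite IH ?raddfMz//; exact: primitive_facet ps qt ts rF.1 pf.
Qed.
End naturality.

Section transport.
Context {D : topologicalType} {cells : nat -> set (set D)}.
Hypothesis cc : cell_complex cells.
Context {M : zmodType} (inc : set D -> set D -> int).
Hypothesis balM : forall q s, cells q.+1 s -> balanced (cells := cells) (M := M) inc q s (inc s).

Record cell_auto (th th' : D -> D) : Prop := {
  auto_cont : continuous th;
  auto_cont' : continuous th';
  autoK : cancel th th';
  autoK' : cancel th' th;
  auto_cells : forall q t, cells q t -> cells q (th @` t);
  auto_cells' : forall q t, cells q t -> cells q (th' @` t) }.

Lemma cell_auto_sym th th' : cell_auto th th' -> cell_auto th' th.
Proof. by case=> *; split. Qed.

Section one.
Context {th th' : D -> D} (ca : cell_auto th th').

Lemma auto_image (A : set D) x : (th @` A) x <-> A (th' x).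
Proof.
split=> [[y Ay <-]|Ax]; first by rewrite (autoK ca).
by exists (th' x); rewrite ?(autoK' ca).
Qed.

Lemma auto_imageK (A : set D) : th' @` (th @` A) = A.
Proof.
apply/seteqP; split=> x; first by move=> [_ [y Ay <-] <-]; rewrite (autoK ca).
by move=> Ax; exists (th x); rewrite ?(autoK ca)//; exists x.
Qed.

Lemma auto_closure (A : set D) : closure (th @` A) = th @` closure A.
Proof.
apply/seteqP; split=> x.
  move=> clx; apply/auto_image => U /(auto_cont' ca); rewrite nbhs_simpl => /clx[y [Ay Uy]].
  by exists (th' y); split=> //; apply/auto_image.
move=> [y cly <-] U /(auto_cont ca); rewrite nbhs_simpl => /cly[z [Az Uz]].
by exists (th z); split=> //; exists z.
Qed.

Lemma auto_bdry (A : set D) : bdry (th @` A) = th @` bdry A.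
Proof.
rewrite /bdry auto_closure; apply/seteqP; split=> x.
  move=> [/auto_image cx nx]; apply/auto_image; split=> // Ax; apply: nx; exact/auto_image.
by move=> /auto_image[cx nx]; split; [exact/auto_image | move=> /auto_image].
Qed.

Lemma auto_sub (A B : set D) : A `<=` B -> th @` A `<=` th @` B.
Proof. by move=> AB _ [x Ax <-]; exists x => //; exact: AB. Qed.

Lemma auto_subE (A B : set D) : th @` A `<=` th @` B -> A `<=` B.
Proof.
move=> AB x Ax; have : (th @` B) (th x) by apply: AB; exists x.
by move/auto_image; rewrite (autoK ca).
Qed.

Lemma ev_auto A n (P : seq D -> Prop) : ev (th @` A) n P -> ev A n (fun l => P (map th l)).
Proof.
apply: ev_map => [y Ay|]; first by exists y.
move=> x _ U /(auto_cont ca); rewrite nbhs_simpl => xU.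
by apply: (filterS (P := th @^-1` U)).
Qed.

Lemma perm_faces p q s : cells p s ->
  perm_eq (fset_set (facets cells q (th @` s))) [seq th @` t | t <- fset_set (facets cells q s)].
Proof.
move=> ps; have ps' := auto_cells ca ps; apply: uniq_perm.
- exact: fset_uniq.
- rewrite map_inj_in_uniq; first exact: fset_uniq.
  by move=> t t' _ _ /(congr1 (fun A => th' @` A)); rewrite !auto_imageK.
move=> t; rewrite (mem_faces cc _ _ ps'); apply/asboolP/mapP => [[qt ts]|[u]].
  have e : t = th @` (th' @` t).
    apply/seteqP; split=> x; first by move=> tx; apply/auto_image; exists x.
    by move=> /auto_image[y ty /(can_inj (autoK' ca)) <-].
  exists (th' @` t); last exact: e.
  rewrite (mem_faces cc _ _ ps); apply/asboolP; split; first exact: (auto_cells' ca qt).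
  by apply: auto_subE; rewrite -auto_bdry -e.
rewrite (mem_faces cc _ _ ps) => /asboolP[qu us] ->; split; first exact: auto_cells ca _ _ qu.
by rewrite auto_bdry; exact: auto_sub.
Qed.

Lemma rel_cocycle_auto p s (F : seq D -> M) : rel_cocycle p (th @` s) F ->
  rel_cocycle p s (fun l => F (map th l)).
Proof.
move=> [F0 dF]; rewrite auto_bdry in F0; rewrite auto_closure in dF.
split; first exact: (ev_auto F0).
by apply: ev_imp (ev_auto dF) => l _ _; rewrite cob_map.
Qed.

Lemma auto_skel Y j : skel (cells := cells) (th @` Y) j = th @` skel (cells := cells) Y j.
Proof.
apply/seteqP; split=> x.
  move=> [/auto_image Yx [q [t [qj qt tx]]]]; apply/auto_image; split=> //.
  exists q, (th' @` t); split=> //; exact: (auto_cells' ca qt).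
move=> [y [Yy [q [t [qj qt ty]]]] <-]; split; first by exists y.
by exists q, (th @` t); split=> //; exact: (auto_cells ca qt).
Qed.

Hypothesis inc_auto : forall q s t, cells q.+1 s -> cells q t -> t `<=` bdry s ->
  inc (th @` s) (th @` t) = inc s t.

Lemma cell_eval_auto p s (F : seq D -> M) : cells p s -> rel_cocycle p (th @` s) F ->
  cell_eval (cells := cells) inc p (th @` s) F =
  cell_eval (cells := cells) inc p s (fun l => F (map th l)).
Proof.
elim: p s F => [|q IH] s F ps rF.
  have [x sx] := cell_pt cc ps.
  have H u y (G : seq D -> M) : u = [set y] -> cell_eval (cells := cells) inc 0 u G = G [:: y].
    move=> uy /=; case: xgetP => [_ _ [z + ->]|/(_ [:: y])[]]; first by rewrite uy => ->.
    by exists y; rewrite ?uy.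
  by rewrite (H _ (th x)) ?(H _ x)// sx image_set1.
have ps' := auto_cells ca ps.
have [f pf] := primitive_ex cc ps' rF.
have rF' := rel_cocycle_auto rF.
have pf' : primitive (cells := cells) q s (fun l => F (map th l)) (fun l => f (map th l)).
  case: pf => f0 Ff; rewrite auto_bdry auto_skel in f0; rewrite auto_closure in Ff.
  split; first exact: (ev_auto f0).
  by apply: ev_imp (ev_auto Ff) => l _ _; rewrite -cob_map.
rewrite (cell_eval_stokes cc balM ps' rF pf) (cell_eval_stokes cc balM ps rF' pf').
rewrite (perm_big _ (perm_faces q ps))/= big_map.
apply: eq_big_seq => t; rewrite (mem_faces cc _ _ ps) => /asboolP[qt ts].
rewrite IH ?(inc_auto ps qt ts)//.
apply: (primitive_facet cc ps' _ _ rF.1 pf); first exact: (auto_cells ca qt).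
by rewrite auto_bdry; exact: auto_sub.
Qed.
End one.
End transport.

(** * Orientations and incidence numbers *)

Section flags.
Context {D : topologicalType} {cells : nat -> set (set D)}.
Hypothesis cc : cell_complex cells.
Implicit Types (s t u : set D) (F G : seq (set D)).

Local Notation cfaces q s := (fset_set (facets cells q s)).
Local Notation isf := (is_flag cells).

Definition dimc s : nat := xget 0%N [set p | cells p s].

Lemma dimcE p s : cells p s -> dimc s = p.
Proof.
by move=> ps; rewrite /dimc; case: xgetP => [q _ /= qs|/(_ p)//]; exact: (cell_dim cc qs ps).
Qed.

Lemma is_cell_dimc s : is_cell cells s -> cells (dimc s) s.
Proof. by move=> [p ps]; rewrite (dimcE ps). Qed.

Lemma cell_lt_dim p q s t : cells p s -> cells q t -> cell_lt s t ->
  (p < q)%N /\ s `<=` bdry t.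
Proof.
move=> ps qt [st ne]; have [[_ ts]|//] := cell_sub_closure cc qt ps st.
by exfalso; apply: ne.
Qed.

Lemma facet_lt p s t : cells p s -> is_cell cells t -> t `<=` bdry s -> cell_lt t s.
Proof.
move=> ps [q qt] ts; split; first by apply: subset_trans ts _; exact: bdry_sub.
by move=> e; have := cell_bdry_lt cc ps qt ts; rewrite (cell_dim cc qt (q := p)) ?e// ltnn.
Qed.

Lemma flag_sorted F : isf F -> sorted ltn (map dimc F).
Proof.
move=> [Fc sF]; rewrite sorted_map; apply: sub_in_sorted sF; last exact: allss.
move=> s t /Fc/is_cell_dimc sc /Fc/is_cell_dimc tc /asboolP st.
by have [] := cell_lt_dim sc tc st.
Qed.

Lemma sorted_ltn_iota l p : sorted ltn l -> size l = p.+1 ->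
  (forall i, i \in l -> (i <= p)%N) -> l = iota 0 p.+1.
Proof.
move=> sl szl lp; apply: (irr_sorted_eq ltn_trans ltnn) => //; first exact: iota_ltn_sorted.
have ul : uniq l by apply: sorted_uniq sl; [exact: ltn_trans | exact: ltnn].
have [] := @uniq_min_size _ l (iota 0 p.+1) ul; last by move=> _ e.
  by move=> i /lp; rewrite mem_iota.
by rewrite size_iota szl.
Qed.

Lemma flag_iota F p : isf F -> size F = p.+1 -> (forall t, t \in F -> (dimc t <= p)%N) ->
  map dimc F = iota 0 p.+1.
Proof.
move=> fF sF Fp; apply: sorted_ltn_iota; rewrite ?size_map//; first exact: flag_sorted.
by move=> i /mapP[t /Fp tp ->].
Qed.

Definition top p s F : Prop := [/\ size F = p.+1, isf F & last set0 F = s].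

Lemma top_iota p s F : cells p s -> top p s F -> map dimc F = iota 0 p.+1.
Proof.
move=> ps [sF fF lF]; apply: flag_iota => // t tF.
have sl := flag_sorted fF; rewrite -(dimcE ps) -lF -nth_last sF/=.
rewrite -[in X in (X <= _)%N](nth_index set0 tF) -!(nth_map set0 0%N) ?sF ?index_mem//; last by rewrite -sF index_mem.
apply: (sorted_leq_nth leq_trans leqnn) => //.
- by apply: sub_sorted sl => i j; exact: ltnW.
- by rewrite inE size_map sF -sF index_mem.
- by rewrite inE size_map sF.
- by rewrite -ltnS -sF index_mem.
Qed.

Lemma flag_rcons2 F s : isf (rcons F s) -> isf F /\
  (F <> [::] -> cell_lt (last set0 F) s).
Proof.
move=> [Fc sF]; split.
  split; first by move=> t tF; apply: Fc; rewrite mem_rcons inE tF orbT.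
  by move: sF; rewrite -cats1 => /cat_sorted2[].
case: F sF {Fc} => // x F; rewrite /= rcons_path => /andP[_ /asboolP] h _; exact: h.
Qed.

Lemma flag_rcons F s : isf F -> is_cell cells s -> (F <> [::] -> cell_lt (last set0 F) s) ->
  isf (rcons F s).
Proof.
move=> [Fc sF] sc lt; split.
  by move=> t; rewrite mem_rcons inE => /orP[/eqP ->//|/Fc].
case: F Fc sF lt => // x F Fc sF lt; rewrite /= rcons_path; apply/andP; split=> //.
by apply/asboolP; exact: lt.
Qed.

Lemma flag_sub_last F t : isf F -> t \in F -> t `<=` closure (last set0 F).
Proof.
case/lastP: F => // l s [_ fl]; rewrite last_rcons mem_rcons inE => /orP[/eqP ->|tl].
  exact: subset_closure.
have : sorted (fun s t => `[< s `<=` closure t >]) (rcons l s).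
  by apply: sub_sorted fl => x y /asboolP[? _]; exact/asboolP.
have tr : transitive (fun s t : set D => `[< s `<=` closure t >]).
  move=> y x z /asboolP xy /asboolP yz; apply/asboolP; apply: subset_trans xy _.
  exact: closure_cell_sub.
rewrite (sorted_pairwise tr) pairwise_rcons => /andP[/allP/(_ _ tl)/asboolP + _].
exact.
Qed.

Lemma top_rcons_inv q s F : cells q.+1 s -> top q.+1 s F ->
  exists F' t, [/\ F = rcons F' s, cells q t, t `<=` bdry s & top q t F'].
Proof.
move=> ps tF; have io := top_iota ps tF; case: tF => sF fF lF.
case/lastP: F sF fF lF io => // F s'; rewrite size_rcons last_rcons => -[sF] fF e; rewrite {s'}e in fF *.
rewrite map_rcons -addn1 iotaD -cats1 => /eqP; rewrite eqseq_cat ?size_iota ?size_map//.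
move=> /andP[/eqP io _]; have [f1 f2] := flag_rcons2 fF.
have F0 : F <> [::] by move=> F0; move: sF; rewrite F0.
have lF : cells q (last set0 F).
  have lF : last set0 F \in F by case: (F) F0 => // x F1 _; rewrite /= mem_last.
  have := is_cell_dimc (f1.1 _ lF); suff -> : dimc (last set0 F) = q by [].
  by rewrite -(nth_last set0 F) sF/= -(nth_map _ 0%N) ?sF// io nth_iota.
exists F, (last set0 F); split=> //.
by have [_] := cell_lt_dim lF ps (f2 F0).
Qed.

Lemma top_rcons q s t F : cells q.+1 s -> cells q t -> t `<=` bdry s -> top q t F ->
  top q.+1 s (rcons F s).
Proof.
move=> ps qt ts [sF fF lF]; split; rewrite ?size_rcons ?sF ?last_rcons//.
apply: flag_rcons => //; first by exists q.+1.
by move=> _; rewrite lF; apply: facet_lt ps _ ts; exists q.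
Qed.

Lemma top_sub p s F : top p s F -> forall t, t \in F -> t `<=` closure s.
Proof. by move=> [_ fF <-] t; exact: flag_sub_last. Qed.

Lemma subdivisionE p s F : cells p s -> subdivision cells s p F <-> top p s F.
Proof.
move=> ps; split=> [[sF fF Fs]|tF]; last first.
  by case: (tF) => sF fF _; split=> //; exact: top_sub tF.
split=> //; have io : map dimc F = iota 0 p.+1.
  apply: flag_iota => // t tF; have tc := is_cell_dimc (fF.1 _ tF).
  by have [[-> _]|[/ltnW]] := cell_sub_closure cc ps tc (Fs _ tF).
have lF : last set0 F \in F by case: (F) sF => // x F' _; rewrite /= mem_last.
have tc := is_cell_dimc (fF.1 _ lF).
have [[_ ->]//|[]] := cell_sub_closure cc ps tc (Fs _ lF).
have -> : dimc (last set0 F) = p; last by rewrite ltnn.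
by rewrite -(nth_last set0 F) sF/= -(nth_map _ 0%N) ?sF// io nth_iota.
Qed.

Fixpoint words (T : eqType) (L : seq T) m : seq (seq T) :=
  if m is m'.+1 then [seq x :: w | x <- L, w <- words L m'] else [:: [::]].

Lemma mem_words (T : eqType) (L : seq T) w : {subset w <= L} -> w \in words L (size w).
Proof.
elim: w => //= x w IH wL; apply/allpairsP; exists (x, w); split=> //=.
  by apply: wL; rewrite mem_head.
by apply: IH => y yw; apply: wL; rewrite inE yw orbT.
Qed.

Lemma finite_subdivision p s : cells p s -> finite_set (subdivision cells s p).
Proof.
move=> ps; have [B [Bc Bs]] := cell_faces cc ps.
apply: (@sub_finite_set _ _ [set` words (s :: B) p.+1]); last exact: finite_seq.
move=> F [sF fF Fs]; change (F \in words (s :: B) p.+1); rewrite -sF; apply: mem_words => t tF.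
have tc := is_cell_dimc (fF.1 _ tF).
have [[_ ->]|[_ ts]] := cell_sub_closure cc ps tc (Fs _ tF); first exact: mem_head.
have [x tx] := cell_ne cc tc; have [t' Bt' t'x] := (Bs x).1 (ts _ tx).
have [q' _ q't'] := Bc _ Bt'.
by have [_ ->] : dimc t = q' /\ t = t'
  by [apply: (cell_disj cc tc q't'); exists x]; rewrite inE Bt' orbT.
Qed.

Section flag_balance.
Context {M : zmodType}.
Implicit Types a : seq (set D) -> M.

(* a has zero boundary in the interior of the flag complex of the p-cell s,
   organized by the largest cell of the flags at which two flags differ. *)
Fixpoint flag_balanced p s a : Prop :=
  if p is q.+1 then
    (forall t, cells q t -> t `<=` bdry s -> flag_balanced q t (fun F => a (rcons F s))) /\
    match q with
    | 0 => \sum_(t <- cfaces 0 s) a [:: t; s] = 0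
    | q'.+1 => forall u G, cells q' u -> u `<=` bdry s -> top q' u G ->
        \sum_(t <- cfaces q s | `[< u `<=` bdry t >]) a (G ++ [:: t; s]) = 0
    end
  else True.
End flag_balance.

Section boundary.
Context {P : nat} {sg : set D} (Psg : cells P sg).
Context (n : seq (set D) -> int).
Hypothesis nbd : forall F', size F' = P -> isf F' ->
  (forall t, t \in F' -> t `<=` closure sg) ->
  ~ (forall t, t \in F' -> t `<=` bdry sg) -> boundary_coef cells n sg P F' = 0.

(** In a full flag the cell at place [i] has dimension [i], so a face without dimension [q] can
    arise only by omitting place [q]. *)
Lemma face_signE F F' q : top P sg F -> (q <= P)%N -> q \notin map dimc F' ->
  face_sign F F' = (omit q F == F')%:R * (-1) ^+ q.
Proof.
move=> tF qP nq; have io := top_iota Psg tF; case: tF => sF _ _.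
have qF : (q < size F)%N by rewrite sF.
rewrite /face_sign (bigD1 (Ordinal qF))//= big1 ?addr0// => -[i iF] /=.
rewrite -val_eqE/= => iq; case: eqP => [e|]; last by rewrite mul0r.
exfalso; move/negP: nq; apply; rewrite -e /omit map_cat map_take map_drop io.
rewrite mem_cat take_iota drop_iota !mem_iota/=; rewrite sF in iF.
by move: iq iF qP; rewrite /minn; case: ifP; lia.
Qed.

Lemma omit_cat (T : Type) (G : seq T) x l : omit (size G) (G ++ x :: l) = G ++ l.
Proof. by rewrite /omit take_size_cat// -cat_rcons drop_size_cat// size_rcons. Qed.

(** The full flags having a given face without dimension [q] arise by inserting a q-cell and share
    the sign [(-1) ^+ q]. The face ends in [sg] itself, so it does not lie in the boundary and its
    coefficient is zero. *)
Lemma interior_sum q s suf G : cells q.+1 s -> last set0 (s :: suf) = sg ->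
  (q.+1 + size suf)%N = P -> size G = q -> isf (G ++ s :: suf) ->
  (forall t, t \in G -> (dimc t < q)%N) ->
  \sum_(t <- cfaces q s | `[< isf (G ++ [:: t, s & suf]) >]) n (G ++ [:: t, s & suf]) = 0.
Proof.
move=> qs lst szP sG fF' Gq.
set F' := G ++ s :: suf.
have szF' : size F' = P by rewrite size_cat sG/= -szP addSnnS.
have lF' : last set0 F' = sg by rewrite last_cat -lst.
have sgF' : sg \in F' by rewrite mem_cat -lst [last _ _]/= mem_last orbT.
have F'sub t : t \in F' -> t `<=` closure sg.
  by rewrite -lF'; exact: flag_sub_last.
have nin : ~ (forall t, t \in F' -> t `<=` bdry sg).
  by move=> h; have [x sx] := cell_ne cc Psg; have := h _ sgF' _ sx; case.
have := nbd szF' fF' F'sub nin.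
have nq : q \notin map dimc F'.
  rewrite map_cat mem_cat negb_or; apply/andP; split.
    by apply/negP => /mapP[t /Gq + e]; rewrite -e ltnn.
  have : sorted ltn (map dimc (s :: suf)).
    by have := flag_sorted fF'; rewrite map_cat => /cat_sorted2[].
  rewrite /= (dimcE qs) path_sortedE; last exact: ltn_trans.
  move=> /andP[/allP al _]; rewrite inE negb_or neq_ltn ltnSn/=.
  by apply/negP => /al /=; rewrite ltnNge leqnSn.
have qP : (q <= P)%N by rewrite -szP; lia.
have FS := finite_subdivision Psg.
rewrite /boundary_coef (eq_big_seq (fun F => (if omit q F == F' then n F else 0) * (-1) ^+ q)).
  rewrite -mulr_suml => /eqP; rewrite mulf_eq0 signr_eq0 orbF -big_mkcond/= => /eqP h.
  rewrite -[RHS]h -[LHS]big_filter -[RHS]big_filter -(big_map (fun t => G ++ [:: t, s & suf]) xpredT n).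
  apply: perm_big; apply: uniq_perm.
  - rewrite map_inj_uniq; first by apply: filter_uniq; exact: fset_uniq.
    by move=> t t' /eqP; rewrite eqseq_cat// eqxx/= => /eqP[].
  - by apply: filter_uniq; exact: fset_uniq.
  move=> F; rewrite mem_filter in_fset_set//; apply/mapP/andP.
    move=> [t]; rewrite mem_filter => /andP[/asboolP fF tq] ->; split.
      by rewrite -{1}sG omit_cat.
    apply/mem_set/(subdivisionE _ Psg); split=> //.
      by rewrite size_cat sG/= -szP !addnS !addSn.
    by rewrite last_cat.
  move=> [/eqP oF /set_mem/(subdivisionE _ Psg) tF].
  have io := top_iota Psg tF; case: tF => sF fF _.
  have qF : (q < size F)%N by rewrite sF.
  have FE : F = take q F ++ nth set0 F q :: drop q.+1 F.
    by rewrite -drop_nth// cat_take_drop.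
  have sT : size (take q F) = size G by rewrite size_take qF.
  move: oF; rewrite /omit => /eqP; rewrite eqseq_cat// => /andP[/eqP GE /eqP sE].
  rewrite GE sE in FE; set t := nth set0 F q in FE.
  exists t => //; rewrite mem_filter -FE; apply/andP; split; first exact/asboolP.
  have tF : t \in F by exact: mem_nth.
  have tq : cells q t.
    have e : nth 0%N (iota 0 P.+1) q = q by rewrite nth_iota ?ltnS.
    have := is_cell_dimc (fF.1 _ tF); suff -> : dimc t = q by [].
    by rewrite /t -(nth_map set0 0%N)// io.
  rewrite (mem_faces cc _ _ qs); apply/asboolP; split=> //.
  have : sorted (fun s t => `[< cell_lt s t >]) [:: t, s & suf].
    by have := fF.2; rewrite FE => /cat_sorted2[].
  by move=> /= /andP[/asboolP /(cell_lt_dim tq qs)[]].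
move=> F; rewrite in_fset_set// => /set_mem/(subdivisionE _ Psg) tF.
by rewrite (face_signE tF qP nq); case: eqP; rewrite ?mul1r// !mul0r mulr0.
Qed.
End boundary.
End flags.

Lemma F2_cases (x : 'F_2) : x = 0 \/ x = 1.
Proof. by case: x => -[|[|//]] h; [left|right]; apply: val_inj. Qed.

Lemma F2_sign (x : int) : x = 1 \/ x = -1 -> x%:~R = 1 :> 'F_2.
Proof. by case=> ->; apply: val_inj. Qed.

Lemma F2_natint (x : 'F_2) : ((x : nat) : int)%:~R = x.
Proof. by have [->|->] := F2_cases x; apply: val_inj. Qed.

(** * Uniqueness of orientations and its consequences for incidence numbers *)

Section orientations.
Context {D : topologicalType} {cells : nat -> set (set D)}.
Hypothesis cc : cell_complex cells.
Implicit Types (s t u : set D) (F G : seq (set D)).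

Local Notation cfaces q s := (fset_set (facets cells q s)).
Local Notation isf := (is_flag cells).
Local Notation top := (top (cells := cells)).
Local Notation flag_balanced := (flag_balanced (cells := cells)).

Lemma orientation_balanced P sg (n : seq (set D) -> int) : cells P sg ->
  (forall F', size F' = P -> isf F' ->
    (forall t, t \in F' -> t `<=` closure sg) ->
    ~ (forall t, t \in F' -> t `<=` bdry sg) -> boundary_coef cells n sg P F' = 0) ->
  flag_balanced P sg n.
Proof.
move=> Psg nbd.
(* [flag_balanced] strips cells from the end of flags; the stripped cells are collected in [suf]. *)
suff H q s suf : cells q s -> isf (s :: suf) -> last set0 (s :: suf) = sg ->
    (q + size suf)%N = P -> flag_balanced q s (fun F => n (F ++ suf)).
  have := H P sg [::] Psg; rewrite /= addn0.
  have -> : (fun F => n (F ++ [::])) = n by apply/funext => F; rewrite cats0.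
  apply=> //; split=> // t; rewrite inE => /eqP ->; by exists P.
elim: q s suf => //= q IH s suf qs fs lst szP.
have consf t : cells q t -> t `<=` bdry s -> isf [:: t, s & suf].
  move=> qt ts; case: fs => f1 f2; split.
    by move=> x; rewrite inE => /orP[/eqP ->|/f1//]; exists q.
  apply/andP; split=> //; apply/asboolP; apply: (facet_lt cc qs) => //; by exists q.
split=> [t qt ts|].
  have := IH t (s :: suf) qt (consf t qt ts) lst.
  rewrite addnS => /(_ szP); congr flag_balanced.
  by apply/funext => F; rewrite cat_rcons.
have sumE G : size G = q -> isf (G ++ s :: suf) ->
    (forall t, t \in G -> (dimc (cells := cells) t < q)%N) ->
    \sum_(t <- cfaces q s | `[< isf (G ++ [:: t, s & suf]) >]) n (G ++ [:: t, s & suf]) = 0.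
  by apply: (interior_sum cc Psg nbd qs).
case: q qs {IH} szP consf sumE => [|q] qs szP consf sumE.
  rewrite -[RHS](sumE [::])//= big_seq_cond [RHS]big_seq_cond; apply: eq_bigl => t.
  rewrite andbT (mem_faces cc _ _ qs); case: asboolP => // -[qt ts].
  by rewrite asboolT//; exact: consf.
move=> u G qu us tG; have io := top_iota cc qu tG; case: tG => sG fG lG.
have G0 : G <> [::] by move=> e; move: sG; rewrite e.
have join l : isf l -> (head set0 l = s \/ cells q.+1 (head set0 l)) -> l <> [::] -> cell_lt u (head set0 l) -> isf (G ++ l).
  move=> [l1 l2] _ l0 ul; split.
    by move=> x; rewrite mem_cat => /orP[/(fG.1)|/l1].
  case: l l1 l2 l0 ul => // y l l1 l2 _ /= ul.
  case: (G) G0 fG lG => // z G' _ [_ sG'] lG'; rewrite /= cat_path/=.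
  by apply/andP; split=> //; apply/andP; split=> //; apply/asboolP; move: lG' => /= ->.
rewrite -[RHS](sumE G)//.
- rewrite big_seq_cond [RHS]big_seq_cond; apply: eq_big => [t|t _]; last first.
    by rewrite -catA.
  rewrite (mem_faces cc _ _ qs); case: (asboolP (_ /\ _)) => //= -[qt ts].
  apply/asboolP/asboolP => [ut|[f1 f2]].
    apply: join => //; [exact: consf|by right|].
    by apply: (facet_lt cc qt) => //; exists q.
  have := f2; case: (G) G0 lG => // z G' _ /= lG'; rewrite cat_path lG' => /and3P[_ /asboolP lt _].
  by have [] := cell_lt_dim cc qu qt lt.
- by apply: join => //; [by left | apply: (facet_lt cc qs) => //; exists q].
- move=> t tG; have : dimc (cells := cells) t \in map (dimc (cells := cells)) G by exact: map_f.
  by rewrite io mem_iota.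
Qed.

Section uniqueness.
Context (n : set D -> seq (set D) -> int) (tf : set D -> seq (set D)).
Hypothesis tfP : forall p s, cells p s -> top p s (tf s).
Hypothesis nP : forall p s, cells p s ->
  [/\ forall F, top p s F -> n s F = 1 \/ n s F = -1, flag_balanced p s (n s) &
      n s (tf s) = (-1) ^+ p].

Lemma facet_exists q s : cells q.+1 s -> facets cells q s !=set0.
Proof. by move=> qs; have [F' [t [_ ? ? _]]] := top_rcons_inv cc qs (tfP qs); exists t. Qed.

Lemma tf0 s : cells 0 s -> tf s = [:: s].
Proof. by move=> /tfP[]; case: (tf s) => [//|x [|//]] _ _ /= ->. Qed.

(** A vanishing sum of signs has an even number of terms. Thus the existence of orientations alone
    makes evaluation over Z/2 available, with all incidence numbers equal to 1. *)
Lemma F2_one q s : cells q.+1 s -> balanced (cells := cells) (M := 'F_2) (fun _ _ => 1) q s (fun=> 1).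
Proof.
move=> qs; have [nu [_ nb] _] := nP qs; case: q qs nu nb => [|q] qs nu nb.
  move=> m; transitivity (m * \sum_(t <- cfaces 0 s) 1).
    by rewrite mulr_sumr; apply: eq_bigr => t _; rewrite mulr1.
  suff -> : \sum_(t <- cfaces 0 s) 1 = 0 :> 'F_2 by rewrite mulr0.
  have := congr1 (fun x : int => x%:~R : 'F_2) nb; rewrite rmorph_sum/= => h.
  rewrite -[RHS]h; apply: eq_big_seq => t; rewrite (mem_faces cc _ _ qs) => /asboolP[qt ts].
  rewrite F2_sign//; apply: nu; have := top_rcons cc qs qt ts (tfP qt).
  by rewrite (tf0 qt).
move=> u qu us m.
transitivity (m * \sum_(t <- cfaces q.+1 s | `[< u `<=` bdry t >]) 1).
  by rewrite mulr_sumr; apply: eq_bigr => t _; rewrite mulr1.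
suff -> : \sum_(t <- cfaces q.+1 s | `[< u `<=` bdry t >]) 1 = 0 :> 'F_2 by rewrite mulr0.
have := congr1 (fun x : int => x%:~R : 'F_2) (nb u _ qu us (tfP qu)); rewrite rmorph_sum/= => h.
rewrite -[RHS]h big_seq_cond [RHS]big_seq_cond; apply: eq_bigr => t.
rewrite (mem_faces cc _ _ qs) => /andP[/asboolP[qt ts] /asboolP ut].
rewrite F2_sign//; apply: nu; rewrite -cat_rcons cats1.
by apply: (top_rcons cc qs qt ts); exact: (top_rcons cc qt qu ut (tfP qu)).
Qed.

(** By induction [a] is constant on the flags through each facet [t], with value [c t]. The
    codimension-one relation makes [c] balanced, and by [balanced_vanish] it is zero at all facets
    or at none; over Z/2 it is then constant. *)
Lemma flag_balanced_const p s (a : seq (set D) -> 'F_2) : cells p s ->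
  flag_balanced p s a -> forall F G, top p s F -> top p s G -> a F = a G.
Proof.
elim: p s a => [|q IH] s a qs ba F G tF tG.
  have t0 F0 : top 0 s F0 -> F0 = [:: s].
    by case; case: F0 => [//|x [|//]] _ _ /= ->.
  by rewrite (t0 F)// (t0 G).
have [b1 b2] := ba.
pose c t : int := (a (rcons (tf t) s) : nat).
have cE t F0 : cells q t -> t `<=` bdry s -> top q t F0 -> a (rcons F0 s) = (c t)%:~R.
  move=> qt ts tF0; rewrite /c F2_natint.
  exact: (IH t (fun F => a (rcons F s)) qt (b1 t qt ts) F0 (tf t) tF0 (tfP qt)).
have bc : balanced (cells := cells) (M := 'F_2) (fun _ _ => 1) q s c.
  case: q IH qs tF tG b1 b2 cE ba => [|q] IH qs tF tG b1 b2 cE ba.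
    move=> m; transitivity (m * \sum_(t <- cfaces 0 s) a [:: t; s]); last by rewrite b2 mulr0.
    rewrite mulr_sumr; apply: eq_big_seq => t; rewrite (mem_faces cc _ _ qs) => /asboolP[qt ts].
    by rewrite -mulrzr -(cE t [:: t])// -(tf0 qt); exact: tfP.
  move=> u qu us m.
  transitivity (m * \sum_(t <- cfaces q.+1 s | `[< u `<=` bdry t >]) a (tf u ++ [:: t; s])).
    rewrite mulr_sumr big_seq_cond [RHS]big_seq_cond; apply: eq_bigr => t.
    rewrite (mem_faces cc _ _ qs) => /andP[/asboolP[qt ts] /asboolP ut].
    rewrite -mulrzr -(cE t (rcons (tf u) t))//; last exact: (top_rcons cc qt qu ut (tfP qu)).
    by rewrite mulr1z -cats1 -cats1 -catA.
  by rewrite (b2 u _ qu us (tfP qu)) mulr0.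
have key t u : cells q t -> t `<=` bdry s -> cells q u -> u `<=` bdry s ->
    (c t)%:~R = 0 :> 'F_2 -> (c u)%:~R = 0 :> 'F_2.
  move=> qt ts qu us ct.
  have ct0 : c t = 0 by move: ct; rewrite /c F2_natint => ->.
  have iu q0 s0 t0 : cells q0.+1 s0 -> cells q0 t0 -> t0 `<=` bdry s0 ->
    (1 : int) = 1 \/ (1 : int) = -1 by move=> *; left.
  exact: (balanced_vanish cc F2_one iu facet_exists 1 qs qt ts qu us bc ct0).
have [F' [t [-> qt ts tF']]] := top_rcons_inv cc qs tF.
have [G' [u [-> qu us tG']]] := top_rcons_inv cc qs tG.
rewrite (cE t)// (cE u)//; have kt := key t u qt ts qu us; have ku := key u t qu us qt ts.
have [e1|e1] := F2_cases (c t)%:~R; first by rewrite (kt e1) e1.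
have [e2|e2] := F2_cases (c u)%:~R; first by rewrite (ku e2) e2.
by rewrite e1 e2.
Qed.

(** The terms [n1 i - n2 i] are 0 or plus or minus 2; half of their sum, reduced modulo 2, counts
    the disagreements. *)
Lemma sum_F2_diff (I : eqType) (r : seq I) (Q : pred I) (n1 n2 : I -> int) :
  (forall i, i \in r -> Q i -> n1 i = 1 \/ n1 i = -1) ->
  (forall i, i \in r -> Q i -> n2 i = 1 \/ n2 i = -1) ->
  \sum_(i <- r | Q i) n1 i = 0 -> \sum_(i <- r | Q i) n2 i = 0 ->
  \sum_(i <- r | Q i) (if n1 i == n2 i then 0 else 1 : 'F_2) = 0.
Proof.
move=> h1 h2 s1 s2.
pose e i : int := if n1 i == n2 i then 0 else n1 i.
have : (\sum_(i <- r | Q i) e i) *+ 2 = 0.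
  transitivity (\sum_(i <- r | Q i) (n1 i - n2 i)); last by rewrite sumrB s1 s2 subr0.
  rewrite -sumrMnl big_seq_cond [RHS]big_seq_cond; apply: eq_bigr => i /andP[ir Qi].
  by rewrite /e; have [->|->] := h1 i ir Qi; have [->|->] := h2 i ir Qi.
move=> /eqP; rewrite mulrn_eq0/= => /eqP/(congr1 (fun x : int => x%:~R : 'F_2)).
rewrite rmorph_sum/= => h; rewrite -[RHS]h big_seq_cond [RHS]big_seq_cond.
apply: eq_bigr => i /andP[ir Qi]; rewrite /e; case: ifP => // _.
by rewrite F2_sign//; exact: h1.
Qed.

Lemma flag_balanced_diff p s (n1 n2 : seq (set D) -> int) : cells p s ->
  (forall F, top p s F -> n1 F = 1 \/ n1 F = -1) ->
  (forall F, top p s F -> n2 F = 1 \/ n2 F = -1) ->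
  flag_balanced p s n1 -> flag_balanced p s n2 ->
  flag_balanced p s (fun F => if n1 F == n2 F then 0 else 1 : 'F_2).
Proof.
elim: p s n1 n2 => //= q IH s n1 n2 qs u1 u2 [a1 b1] [a2 b2]; split.
  move=> t qt ts; apply: (IH t (fun F => n1 (rcons F s)) (fun F => n2 (rcons F s))) => //.
  - by move=> F tF; apply: u1; exact: top_rcons tF.
  - by move=> F tF; apply: u2; exact: top_rcons tF.
  - exact: a1.
  - exact: a2.
case: q IH qs u1 u2 a1 a2 b1 b2 => [|q] IH qs u1 u2 a1 a2 b1 b2.
  have T t : t \in cfaces 0 s -> top 1 s [:: t; s].
    rewrite (mem_faces cc _ _ qs) => /asboolP[qt ts].
    by have := top_rcons cc qs qt ts (tfP qt); rewrite (tf0 qt).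
  apply: (sum_F2_diff (Q := xpredT) (n1 := fun t => n1 [:: t; s]) (n2 := fun t => n2 [:: t; s])) => // t ts _.
    exact/u1/T.
  exact/u2/T.
move=> u G qu us tG.
have T t : t \in cfaces q.+1 s -> `[< u `<=` bdry t >] -> top q.+2 s (G ++ [:: t; s]).
  rewrite (mem_faces cc _ _ qs) => /asboolP[qt ts] /asboolP ut.
  have -> : G ++ [:: t; s] = rcons (rcons G t) s by rewrite -!cats1 -catA.
  by apply: (top_rcons cc qs qt ts); exact: (top_rcons cc qt qu ut tG).
apply: (sum_F2_diff (n1 := fun t => n1 (G ++ [:: t; s])) (n2 := fun t => n2 (G ++ [:: t; s]))).
- by move=> t ts ut; exact/u1/T.
- by move=> t ts ut; exact/u2/T.
- exact: b1.
- exact: b2.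
Qed.

Lemma orientation_unique p s (n1 n2 : seq (set D) -> int) : cells p s ->
  (forall F, top p s F -> n1 F = 1 \/ n1 F = -1) ->
  (forall F, top p s F -> n2 F = 1 \/ n2 F = -1) ->
  flag_balanced p s n1 -> flag_balanced p s n2 ->
  forall F G, top p s F -> top p s G -> n1 F * n2 F = n1 G * n2 G.
Proof.
move=> ps u1 u2 b1 b2 F G tF tG.
have /(_ F G tF tG)/= := flag_balanced_const ps (flag_balanced_diff ps u1 u2 b1 b2).
by have [->|->] := u1 F tF; have [->|->] := u2 F tF; have [->|->] := u1 G tG;
  have [->|->] := u2 G tG.
Qed.

Definition inc s t : int := n s (rcons (tf t) s).

Lemma inc_unit q s t : cells q.+1 s -> cells q t -> t `<=` bdry s ->
  inc s t = 1 \/ inc s t = -1.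
Proof.
move=> qs qt ts; have [nu _ _] := nP qs; apply: nu.
exact: (top_rcons cc qs qt ts (tfP qt)).
Qed.

(** Both [n t] and the restriction of [n s] to flags through [t] orient [t]; at the distinguished
    flag [n t] is [(-1) ^+ q] by normalization, which fixes the factor. *)
Lemma orientation_facet q s t F : cells q.+1 s -> cells q t -> t `<=` bdry s ->
  top q t F -> n s (rcons F s) = (-1) ^+ q * inc s t * n t F.
Proof.
move=> qs qt ts tF; have [us [bs _] _] := nP qs; have [ut bt nt] := nP qt.
have u F0 : top q t F0 -> n s (rcons F0 s) = 1 \/ n s (rcons F0 s) = -1.
  by move=> tF0; apply: us; exact: top_rcons tF0.
have := orientation_unique qt u ut (bs t qt ts) bt tF (tfP qt); rewrite nt -/(inc s t) => e.
have n2 : n t F * n t F = 1 by have [->|->] := ut F tF.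
by rewrite [_ ^+ q * _]mulrC -e -mulrA n2 mulr1.
Qed.

(** By [orientation_facet] the product of the incidence numbers through [t] is, up to a sign common
    to all [t], the value of [n s] on the distinguished flag of [u] followed by [t] and [s]. These
    values sum to zero over [t]. *)
Lemma inc_balanced (M : zmodType) q s : cells q.+1 s ->
  balanced (cells := cells) (M := M) inc q s (inc s).
Proof.
move=> qs; have [_ [_ nb] _] := nP qs; case: q qs nb => [|q] qs nb.
  move=> m; rewrite -mulrz_sumr -[RHS](mulr0z m); congr (_ *~ _).
  rewrite -[RHS]nb; apply: eq_big_seq => t; rewrite (mem_faces cc _ _ qs) => /asboolP[qt ts].
  by rewrite /inc (tf0 qt).
move=> u qu us m.
under eq_bigr do rewrite -mulrzA.
rewrite -mulrz_sumr -[RHS](mulr0z m); congr (_ *~ _).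
transitivity ((-1) ^+ q.+1 * \sum_(t <- cfaces q.+1 s | `[< u `<=` bdry t >]) n s (tf u ++ [:: t; s]));
  last by rewrite (nb u _ qu us (tfP qu)) mulr0.
rewrite mulr_sumr big_seq_cond [RHS]big_seq_cond; apply: eq_bigr => t.
rewrite (mem_faces cc _ _ qs) => /andP[/asboolP[qt ts] /asboolP ut].
have -> : tf u ++ [:: t; s] = rcons (rcons (tf u) t) s by rewrite -!cats1 -catA.
rewrite (orientation_facet qs qt ts (top_rcons cc qt qu ut (tfP qu))) -/(inc t u).
by rewrite !mulrA -expr2 sqrr_sign mul1r mulrC.
Qed.

Section equivariance.
Context {th th' : D -> D} (ca : cell_auto (cells := cells) th th').
Hypothesis tf_auto : forall p s, cells p s ->
  tf (th @` s) = [seq th @` t | t <- tf s].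

Lemma is_flag_auto F : isf F -> isf [seq th @` t | t <- F].
Proof.
move=> [f1 f2]; split.
  by move=> _ /mapP[t /f1[p pt] ->]; exists p; exact: (auto_cells ca).
rewrite sorted_map; apply: sub_sorted f2 => s t /asboolP[st ne]; apply/asboolP; split.
  by rewrite (auto_closure ca); exact: auto_sub.
by move=> /(congr1 (fun A => th' @` A)); rewrite !(auto_imageK ca).
Qed.

Lemma top_auto p s F : top p s F -> top p (th @` s) [seq th @` t | t <- F].
Proof.
move=> [sF fF lF]; split; [by rewrite size_map | exact: is_flag_auto |].
by case: F sF lF {fF} => // x F _ <-; exact: (last_map (fun t => th @` t) F x).
Qed.

Lemma flag_balanced_auto (M : zmodType) p s (a : seq (set D) -> M) : cells p s ->
  flag_balanced p (th @` s) a ->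
  flag_balanced p s (fun F => a [seq th @` t | t <- F]).
Proof.
elim: p s a => //= q IH s a qs [a1 a2]; split.
  move=> t qt ts; have := a1 (th @` t) (auto_cells ca qt).
  rewrite (auto_bdry ca) => /(_ (auto_sub (th := th) ts))/(IH t _ qt).
  by congr flag_balanced; apply/funext => F; rewrite map_rcons.
case: q {IH a1} qs a2 => [|q] qs a2.
  by move: a2; rewrite (perm_big _ (perm_faces cc ca 0 qs))/= big_map.
move=> u G qu us tG; have := a2 (th @` u) [seq th @` t | t <- G] (auto_cells ca qu).
rewrite (auto_bdry ca) => /(_ (auto_sub (th := th) us) (top_auto tG)).
rewrite (perm_big _ (perm_faces cc ca q.+1 qs))/= big_map => h; rewrite -[RHS]h.
apply: eq_big => t; last by rewrite map_cat.
by apply/asboolP/asboolP; rewrite (auto_bdry ca); [exact: auto_sub | exact: (auto_subE ca)].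
Qed.

(** Pulled back along [th], the orientation of the image cell orients [s] and has the same value at
    the distinguished flag, so uniqueness applies. *)
Lemma orientation_auto p s F : cells p s -> top p s F ->
  n (th @` s) [seq th @` t | t <- F] = n s F.
Proof.
move=> ps tF; have ps' := auto_cells ca ps.
have [us bs ns] := nP ps; have [us' bs' ns'] := nP ps'.
have u F0 : top p s F0 -> n (th @` s) [seq th @` t | t <- F0] = 1 \/
    n (th @` s) [seq th @` t | t <- F0] = -1.
  by move=> tF0; apply: us'; exact: top_auto.
have := orientation_unique ps u us (flag_balanced_auto ps bs') bs tF (tfP ps).
rewrite -(tf_auto ps) ns' ns -expr2 sqrr_sign.
by have [->|->] := u F tF; have [->|->] := us F tF.
Qed.

Lemma inc_auto q s t : cells q.+1 s -> cells q t -> t `<=` bdry s ->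
  inc (th @` s) (th @` t) = inc s t.
Proof.
move=> qs qt ts; rewrite /inc (tf_auto qt) -map_rcons; apply: (orientation_auto qs).
exact: (top_rcons cc qs qt ts (tfP qt)).
Qed.
End equivariance.
End uniqueness.
End orientations.

(** * Equivariant cochains *)

Record action (D : topologicalType) (G : Type) (act : G -> D -> D) (Gam : set G)
    (one : G) (mul : G -> G -> G) (inv : G -> G) : Prop := {
  act_one : Gam one;
  act_mul : forall g h, Gam g -> Gam h -> Gam (mul g h);
  act_inv : forall g, Gam g -> Gam (inv g);
  act1 : forall x, act one x = x;
  actM : forall g h x, Gam g -> Gam h -> act (mul g h) x = act g (act h x);
  actK : forall g, Gam g -> cancel (act g) (act (inv g));
  actVK : forall g, Gam g -> cancel (act (inv g)) (act g);
  act_continuous : forall g, Gam g -> continuous (act g) }.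

Section equivariant_cochains.
Context {D : topologicalType} {G : Type} {act : G -> D -> D} {Gam : set G}.
Context {one : G} {mul : G -> G -> G} {inv : G -> G}.
Hypothesis ga : action act Gam one mul inv.
Hypothesis hD : hausdorff_space D.
Context {cells : nat -> set (set D)} {D0 : set D}.
Hypothesis cc : cell_complex cells.
Hypothesis D0E : D0 = \bigcup_p \bigcup_(s in cells p) s.
Hypothesis ec : equivariant_cells act Gam cells.
Implicit Types (s t : set D).

Local Notation stab := (cell_stabilizer act Gam).
Local Notation skelD j := (skel (cells := cells) D0 j).

Lemma subcomplex_D0 : subcomplex (cells := cells) D0.
Proof.
have D0P x : D0 x <-> exists q t, cells q t /\ t x.
  rewrite D0E; split=> [[q _ [t qt tx]]|[q [t [qt tx]]]]; first by exists q, t.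
  by exists q => //; exists t.
split=> [q t x qt tx _ y /(closure_cellP t y)[ty|/(bdry_cell cc qt)[q' [t' [_ ? ? _]]]]|x /D0P//].
  by apply/D0P; exists q, t.
by apply/D0P; exists q', t'.
Qed.

Lemma cell_sub_D0 q t : cells q t -> t `<=` D0.
Proof. by move=> qt x tx; rewrite D0E; exists q => //; exists t. Qed.

Lemma closure_skelD q t : cells q t -> closure t `<=` skelD q.+1.
Proof.
by move=> qt; apply: (closure_sub_skel cc subcomplex_D0 qt) => //; exact: cell_sub_D0 qt.
Qed.

Lemma bdry_skelD q t : cells q t -> bdry t `<=` skelD q.
Proof.
move=> qt; rewrite (bdry_skel cc qt); apply: skelS => //.
apply: subset_trans (@skel_sub _ cells D0 q.+1).
by apply: subset_trans (closure_skelD qt); exact: bdry_sub.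
Qed.

Lemma action_auto g : Gam g -> cell_auto (cells := cells) (act g) (act (inv g)).
Proof.
move=> Gg; have Gi := act_inv ga Gg; have [ec1 _] := ec; split.
- exact: (act_continuous ga Gg).
- exact: (act_continuous ga Gi).
- exact: (actK ga Gg).
- exact: (actVK ga Gg).
- by move=> q t qt; exact: ec1.
- by move=> q t qt; exact: ec1.
Qed.

Lemma action_fix_closure q s g x : cells q s -> stab s g -> closure s x -> act g x = x.
Proof.
move=> qs sg cx; apply: hD => A B; have [Gg _] := sg.
move=> /(act_continuous ga Gg); rewrite nbhs_simpl => gA xB.
have gA' : nbhs x (act g @^-1` A) := gA.
have [z [sz [Az Bz]]] := cx _ (filterI gA' xB).
by exists z; split=> //; have := Az; rewrite /= (ec.2 _ _ _ qs sg z sz).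
Qed.

Lemma action_fix_list q s g (l : seq D) : cells q s -> stab s g -> lall (closure s) l ->
  map (act g) l = l.
Proof.
move=> qs sg; elim: l => //= x l IH [cx cl].
by rewrite (action_fix_closure qs sg cx) IH.
Qed.

Context {k : nzRingType} {E : lmodType k} (rho : G -> {linear E -> E}).
Hypothesis rho1 : forall v, rho one v = v.
Hypothesis rhoM : forall g h v, Gam g -> Gam h -> rho (mul g h) v = rho g (rho h v).
Hypothesis mulV : forall g, Gam g -> mul g (inv g) = one.
Hypothesis mulVg : forall g, Gam g -> mul (inv g) g = one.

Lemma rhoK g v : Gam g -> rho (inv g) (rho g v) = v.
Proof. by move=> Gg; rewrite -rhoM ?mulVg ?rho1//; exact: act_inv ga _ Gg. Qed.

Lemma rhoVK g v : Gam g -> rho g (rho (inv g) v) = v.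
Proof. by move=> Gg; rewrite -rhoM ?mulV ?rho1//; exact: act_inv ga _ Gg. Qed.

Definition equivariant (f : seq D -> E) : Prop :=
  forall g, Gam g -> forall l, f (map (act g) l) = rho g (f l).

Implicit Types f : seq D -> E.

Lemma equivariant_cob f : equivariant f -> equivariant (cob f).
Proof.
move=> ef g Gg l; rewrite cob_map cob_additive; congr cob; apply/funext => t; exact: ef.
Qed.

Lemma equivariant_lin (a : k) f f' : equivariant f -> equivariant f' ->
  equivariant (fun l => a *: f l + f' l).
Proof. by move=> ef ef' g Gg l; rewrite ef// ef'// linearP. Qed.

Lemma equivariantB f f' : equivariant f -> equivariant f' ->
  equivariant (fun l => f l - f' l).
Proof. by move=> ef ef' g Gg l; rewrite ef// ef'// linearB. Qed.

Lemma equivariantD f f' : equivariant f -> equivariant f' ->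
  equivariant (fun l => f l + f' l).
Proof. by move=> ef ef' g Gg l; rewrite ef// ef'// linearD. Qed.

Lemma equivariant0 : equivariant (fun=> 0).
Proof. by move=> g Gg l; rewrite linear0. Qed.

Context (reps : nat -> set (set D)) (rep : set D -> set D).
Context (gam : set D -> G).
Hypothesis cr : cell_representatives act Gam cells reps rep.
Hypothesis gamP : forall q t, cells q t -> Gam (gam t) /\ translate act (gam t) (rep t) = t.

Lemma reps_cell p s : reps p s -> cells p s.
Proof. by have [h _ _] := cr; exact: h. Qed.

Lemma rep_reps p s : cells p s -> reps p (rep s).
Proof. by have [_ h _] := cr; move=> /h[]. Qed.

Lemma rep_id p s : reps p s -> rep s = s.
Proof.
move=> ps; have [_ h1 h2] := cr; have [rs [g Gg e]] := h1 _ _ (reps_cell ps).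
exact: h2 rs ps Gg e.
Qed.

Lemma translate_id s : translate act one s = s.
Proof.
by apply/seteqP; split=> x => [[y sy <-]|sx]; rewrite ?(act1 ga)//; exists x; rewrite ?(act1 ga).
Qed.

Lemma translateM g h s : Gam g -> Gam h ->
  translate act (mul g h) s = translate act g (translate act h s).
Proof.
move=> Gg Gh; apply/seteqP; split=> x.
  by move=> [y sy <-]; rewrite (actM ga)//; exists (act h y) => //; exists y.
by move=> [_ [y sy <-] <-]; exists y => //; rewrite (actM ga).
Qed.

Lemma rep_translate p s g : cells p s -> Gam g -> rep (translate act g s) = rep s.
Proof.
move=> ps Gg; have [_ h1 h2] := cr; have ps' : cells p (translate act g s) by exact: ec.1.
have [r1 [a Ga ea]] := h1 _ _ ps; have [r2 [b Gb eb]] := h1 _ _ ps'.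
apply: esym; apply: (h2 p _ _ (mul (inv b) (mul g a))) => //.
  by do ?[apply: (act_mul ga) | apply: (act_inv ga)].
have Gib := act_inv ga Gb; have Gga := act_mul ga Gg Ga.
by rewrite translateM// translateM// -ea [X in translate act (inv b) X]eb -translateM// mulVg// translate_id.
Qed.

(* Both gam (g s) and g gam s carry rep s to g s. *)
Lemma gam_translate p s g : cells p s -> Gam g ->
  stab (rep s) (mul (inv (gam (translate act g s))) (mul g (gam s))).
Proof.
move=> ps Gg; have ps' : cells p (translate act g s) by exact: ec.1.
have [G1 e1] := gamP ps; have [G2 e2] := gamP ps'; rewrite (rep_translate ps Gg) in e2.
have Gi := act_inv ga G2; have Ggg := act_mul ga Gg G1.
split; first exact: act_mul ga _ _ Gi Ggg.
rewrite translateM// translateM// e1 -[X in translate act _ X]e2 -translateM//.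
by rewrite mulVg// translate_id.
Qed.

Lemma gam_stab p s : reps p s -> stab s (gam s).
Proof. by move=> ps; have [? e] := gamP (reps_cell ps); split=> //; rewrite -[RHS]e (rep_id ps). Qed.

Section extension.
Context (r n : nat) (h : set D -> seq D -> E).
Hypothesis h0 : forall s, reps r s -> ev (bdry s) n (fun l => h s l = 0).
Hypothesis hfix : forall s g l, reps r s -> stab s g -> rho g (h s l) = h s l.

(** The cut-off [ext0] makes this formula equivariant on all lists: the stabilizer of a cell is only
    known to fix lists in its closure, and elsewhere the transported value could depend on the
    choice of [gam t]. *)
Let h' t (l : seq D) : E :=
  rho (gam t) (ext0 (closure (rep t)) (h (rep t)) (map (act (inv (gam t))) l)).

Let h'_translate t g l : cells r t -> Gam g ->
  h' (translate act g t) (map (act g) l) = rho g (h' t l).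
Proof.
move=> rt Gg; rewrite /h' (rep_translate rt Gg).
have rt' : cells r (translate act g t) by exact: ec.1.
have [G1 e1] := gamP rt; have [G2 e2] := gamP rt'; have sk := gam_translate rt Gg.
set b := gam (translate act g t) in G2 e2 sk *; set a := gam t in G1 e1 sk *.
have rr := rep_reps rt; have cr' := reps_cell rr.
have Gi := act_inv ga G2; have Ggg := act_mul ga Gg G1.
have -> : map (act (inv b)) (map (act g) l) =
    map (act (mul (inv b) (mul g a))) (map (act (inv a)) l).
  rewrite -!map_comp; apply: eq_map => x /=.
  by rewrite (actM ga)// (actM ga)// (actVK ga).
set m := map (act (inv a)) l; set c := mul (inv b) (mul g a) in sk *.
have fixc v : (forall g', stab (rep t) g' -> rho g' v = v) -> rho b v = rho g (rho a v).
  by move=> hv; rewrite -{1}(hv _ sk) /c rhoM// rhoVK// rhoM.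
rewrite /ext0; have [cm|ncm] := pselect (lall (closure (rep t)) m).
  rewrite (action_fix_list cr' sk cm) asboolT//; apply: fixc => g' sg'; exact: hfix.
rewrite !asboolF ?linear0// => cm; apply: ncm.
have sk' : forall x, closure (rep t) (act c x) -> closure (rep t) x.
  move=> x cx; have Gc := sk.1; suff -> : x = act c x by [].
  by apply: (can_inj (actK ga Gc)); rewrite (action_fix_closure cr' sk cx).
by elim: (m) cm => //= x m' IH [/sk' ? /IH].
Qed.

Let h'0 t : cells r t -> ev (bdry t) n (fun l => h' t l = 0).
Proof.
move=> rt; have [G1 e1] := gamP rt; have rr := rep_reps rt; have cr' := reps_cell rr.
have ca := cell_auto_sym (action_auto G1).
have e : bdry (rep t) = act (inv (gam t)) @` bdry t.
  by rewrite -(auto_bdry ca); congr bdry; rewrite -{2}e1 [RHS](auto_imageK (cell_auto_sym ca)).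
have : ev (bdry (rep t)) n (fun l => ext0 (closure (rep t)) (h (rep t)) l = 0).
  by apply: ev_imp (h0 rr) => l _ _ hl; rewrite /ext0; case: ifP.
by rewrite e => /(ev_auto ca); apply: ev_imp => l _ _; rewrite /h' => ->; rewrite linear0.
Qed.

(** The value is read off at the cell of the last point, which moves along with the list;
    equivariance therefore holds for all lists, not only generic ones. *)
Lemma equivariant_extension : exists f, [/\ equivariant f,
  ev (skelD r) n (fun l => f l = 0) &
  forall s, reps r s -> ev (closure s) n (fun l => f l = h s l)].
Proof.
exists (glue_cells (cells := cells) r h'); split.
- move=> g Gg [|x l]; first by rewrite linear0.
  rewrite /= last_map; have [[t [rt tl]]|nt] := pselect (exists t, cells r t /\ t (last x l)).
    have rt' : cells r (translate act g t) by exact: ec.1.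
    have tl' : translate act g t (act g (last x l)) by exists (last x l).
    rewrite !asboolT; [|by exists t|by exists (translate act g t)].
    rewrite (cell_atE cc rt' tl') (cell_atE cc rt tl).
    exact: (h'_translate (x :: l) rt Gg).
  rewrite !asboolF ?linear0// => -[t [rt tl]]; apply: nt.
  have Gi := act_inv ga Gg; exists (translate act (inv g) t); split; first exact: ec.1.
  by exists (act g (last x l)); rewrite ?(actK ga).
- exact: glue_skel.
- move=> s rs; have cs := reps_cell rs; have sg := gam_stab rs.
  have e1 := glue_cell cc (g := h') cs (h'0 cs).
  have e2 : ev (closure s) n (fun l => h' s l = h s l).
    apply: ev_all => l _ cl; rewrite /h' (rep_id rs).
    have -> : map (act (inv (gam s))) l = l.
      rewrite -{1}(action_fix_list cs sg cl) -map_comp -[RHS]map_id.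
      by apply: eq_map => x /=; rewrite (actK ga)//; case: sg.
    by rewrite /ext0 asboolT// hfix.
  exact: ev_trans e1 e2.
Qed.
End extension.

Lemma equivariant_spread r n f f' : equivariant f -> equivariant f' ->
  (forall s, reps r s -> ev (closure s) n (fun l => f l = f' l)) ->
  forall t, cells r t -> ev (closure t) n (fun l => f l = f' l).
Proof.
move=> ef ef' ff t rt; have [G1 e1] := gamP rt; have rr := rep_reps rt.
have ca := cell_auto_sym (action_auto G1).
have e : closure (rep t) = act (inv (gam t)) @` closure t.
  by rewrite -(auto_closure ca); congr closure; rewrite -{2}e1 [RHS](auto_imageK (cell_auto_sym ca)).
have := ff _ rr; rewrite e => /(ev_auto ca); apply: ev_imp => l _ _.
have Gi := act_inv ga G1.
by rewrite ef// ef'// => /(congr1 (rho (gam t))); rewrite !rhoVK.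
Qed.

Program Definition fixed s : submodule E :=
  @Submodule k E [set v | forall g, stab s g -> rho g v = v] _ _.
Next Obligation. by move=> s g _; rewrite linear0. Qed.
Next Obligation. by move=> s a x y hx hy g sg; rewrite linearP hx// hy. Qed.

(** Lists outside the closed cell may have values that are not fixed; these are replaced by the
    default 0. *)
Definition corestrict s f : seq D -> submod_type (fixed s) := fun l => insubd 0 (f l).

Lemma equivariant_fixed q s f l : cells q s -> equivariant f -> lall (closure s) l ->
  forall g, stab s g -> rho g (f l) = f l.
Proof.
move=> qs ef cl g sg; rewrite -ef; last by case: sg.
by rewrite (action_fix_list qs sg cl).
Qed.

Lemma val_corestrict q s f l : cells q s -> equivariant f -> lall (closure s) l ->
  val (corestrict s f l) = f l.
Proof.
move=> qs ef cl; rewrite val_insubd; case: ifPn => // /negP[].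
by apply/asboolP => g sg; exact: (equivariant_fixed qs ef cl sg).
Qed.

Lemma ev_corestrict q s f n : cells q s -> equivariant f ->
  ev (closure s) n (fun l => val (corestrict s f l) = f l).
Proof. by move=> qs ef; apply: ev_all => l _ cl; exact: (val_corestrict qs ef cl). Qed.

Lemma rel_cocycle_val q s (f : seq D -> submod_type (fixed s)) :
  rel_cocycle q s f <-> rel_cocycle q s (fun l => val (f l)).
Proof.
have v0 (x : submod_type (fixed s)) : x = 0 <-> val x = 0.
  by split=> [->//|e]; apply: val_inj.
have dv l : val (cob f l) = cob (fun u => val (f u)) l by rewrite cob_additive.
split=> -[f0 df]; split.
- by apply: ev_imp f0 => l _ _ /v0.
- by apply: ev_imp df => l _ _ /v0; rewrite dv.
- by apply: ev_imp f0 => l _ _ /v0.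
- by apply: ev_imp df => l _ _; rewrite -dv => /v0.
Qed.

Lemma corestrict_rel_cocycle q s f : cells q s -> equivariant f ->
  rel_cocycle q s f -> rel_cocycle q s (corestrict s f).
Proof.
move=> qs ef rf; apply/rel_cocycle_val.
by apply: rel_cocycle_ext rf; apply: ev_esym; exact: (ev_corestrict q.+1 qs ef).
Qed.

Lemma extend_primitive r n f : equivariant f ->
  ev (skelD r) n.+1 (fun l => f l = 0) ->
  (forall s, reps r s -> exists g : seq D -> submod_type (fixed s),
    ev (bdry s) n (fun l => g l = 0) /\
    ev (closure s) n.+1 (fun l => corestrict s f l = cob g l)) ->
  exists g, [/\ equivariant g, ev (skelD r) n (fun l => g l = 0) &
    ev (skelD r.+1) n.+1 (fun l => f l = cob g l)].
Proof.
move=> ef f0 ex.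
have ex' s : exists g : seq D -> submod_type (fixed s), reps r s ->
    ev (bdry s) n (fun l => g l = 0) /\
    ev (closure s) n.+1 (fun l => corestrict s f l = cob g l).
  have [rs|nrs] := pselect (reps r s); last by exists (fun=> 0).
  by have [g hg] := ex s rs; exists g.
pose g s := projT1 (cid (ex' s)).
have gP s : reps r s -> ev (bdry s) n (fun l => g s l = 0) /\
    ev (closure s) n.+1 (fun l => corestrict s f l = cob (g s) l).
  by rewrite /g; case: cid.
have [G0 [eG G00 Gg]] : exists G0, [/\ equivariant G0, ev (skelD r) n (fun l => G0 l = 0) &
    forall s, reps r s -> ev (closure s) n (fun l => G0 l = val (g s l))].
  apply: equivariant_extension => [s rs|s g' l rs sg'].
    by apply: ev_imp (gP s rs).1 => l _ _ ->.
  by have /asboolP := valP (g s l); apply.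
exists G0; split=> //; apply: (ev_skel cc subcomplex_D0) => q t qt.
rewrite ltnS leq_eqVlt => /orP[/eqP qr|qr] tD; last first.
  have ct := closure_sub_skel cc subcomplex_D0 qt qr tD.
  by apply: (ev_imp2 _ (ev_sub ct f0) (ev_sub ct (ev_cob0 G00))) => l _ _ -> ->.
rewrite {}qr in qt; apply: (equivariant_spread ef (equivariant_cob eG)) qt => s rs.
have cs := reps_cell rs.
apply: ev_trans (ev_esym (ev_corestrict n.+1 cs ef)) _.
apply: (ev_imp2 _ (gP s rs).2 (ev_cob (Gg s rs))) => l _ _ -> ->.
by rewrite cob_additive.
Qed.

Lemma equivariant_rel_acyclic r n f : n != r -> equivariant f ->
  ev (skelD r) n.+1 (fun l => f l = 0) -> ev (skelD r.+1) n.+2 (fun l => cob f l = 0) ->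
  exists g, [/\ equivariant g, ev (skelD r) n (fun l => g l = 0) &
    ev (skelD r.+1) n.+1 (fun l => f l = cob g l)].
Proof.
move=> nr ef f0 df; apply: extend_primitive => // s rs; have cs := reps_cell rs.
have dc l : val (cob (corestrict s f) l) = cob (fun u => val (corestrict s f u)) l.
  by rewrite cob_additive.
have v0 (x : submod_type (fixed s)) : val x = 0 -> x = 0 by move=> e; apply: val_inj.
apply: (rel_acyclic cc cs nr).
  apply: (ev_imp2 _ (ev_sub (@bdry_sub _ s) (ev_corestrict n.+1 cs ef)) (ev_sub (bdry_skelD cs) f0)).
  by move=> l _ _ e1 e2; apply: v0; rewrite e1 e2.
apply: (ev_imp2 _ (ev_cob (ev_corestrict n.+1 cs ef)) (ev_sub (closure_skelD cs) df)).
by move=> l _ _ e1 e2; apply: v0; rewrite dc e1 e2.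
Qed.

(** The equivariant form of [skel_cobd]: cells of dimension below n carry no relative cohomology in
    degree n. *)
Lemma equivariant_push n j f : (j <= n)%N -> equivariant f ->
  ev (skelD j) n.+2 (fun l => cob f l = 0) ->
  exists g, equivariant g /\ ev (skelD j) n.+1 (fun l => f l = cob g l).
Proof.
elim: j f => [|j IH] f jn ef df.
  by exists (fun=> 0); split; [exact: equivariant0 | move=> x [_ [q [t []]]]].
have [g [eg fg]] : exists g, equivariant g /\ ev (skelD j) n.+1 (fun l => f l = cob g l).
  by apply: IH => //; [exact: ltnW | apply: ev_sub df; exact: skelS].
have [||||g' [eg' g'0 fg']] := @equivariant_rel_acyclic j n (fun l => f l - cob g l).
- by rewrite gtn_eqF.
- exact/equivariantB/equivariant_cob.
- by apply: ev_imp fg => l _ _ ->; rewrite subrr.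
- by apply: ev_imp df => l _ _; rewrite cobB cob_cob subr0.
exists (fun l => g l + g' l); split; first exact: equivariantD.
by apply: ev_imp fg' => l _ _; rewrite cobD => /eqP; rewrite subr_eq addrC => /eqP.
Qed.

Context {N : nat}.
Hypothesis cdim : cw_dimension cells N.

Lemma skelD_full j : (N < j)%N -> skelD j = D0.
Proof.
move=> Nj; apply/seteqP; split=> [|x Dx]; first exact: skel_sub.
split=> //; have [_ /(_ _ Dx)[q [t [qt tx]]]] := subcomplex_D0; exists q, t; split=> //.
rewrite ltnNge; apply/negP => jq; have [_ /(_ q)] := cdim.
by move=> /(_ (leq_trans Nj jq)) e; rewrite e in qt.
Qed.

(** Cells of dimension at least [j > n] carry no relative cohomology in degree n either; as there
    are no cells above dimension [N], the extension reaches all of [D0] after [N.+1] steps. *)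
Lemma equivariant_kill n j f : (n < j)%N -> equivariant f ->
  ev D0 n.+2 (fun l => cob f l = 0) -> ev (skelD j) n.+1 (fun l => f l = 0) ->
  exists g, [/\ equivariant g, ev (skelD j) n (fun l => g l = 0) &
    ev D0 n.+1 (fun l => f l = cob g l)].
Proof.
move=> nj ef df f0.
have H m : exists g, [/\ equivariant g, ev (skelD j) n (fun l => g l = 0) &
    ev (skelD (j + m)) n.+1 (fun l => f l = cob g l)].
  elim: m => [|m [g [eg g0 fg]]].
    exists (fun=> 0); split; [exact: equivariant0 | exact: ev_all |].
    by rewrite addn0; apply: ev_imp f0 => l _ _ ->; rewrite cob0.
  have [||||g' [eg' g'0 fg']] := @equivariant_rel_acyclic (j + m) n (fun l => f l - cob g l).
  - by rewrite ltn_eqF//; exact: leq_trans nj (leq_addr _ _).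
  - exact/equivariantB/equivariant_cob.
  - by apply: ev_imp fg => l _ _ ->; rewrite subrr.
  - apply: (ev_sub (@skel_sub _ cells D0 _)).
    by apply: ev_imp df => l _ _; rewrite cobB cob_cob subr0.
  exists (fun l => g l + g' l); split; first exact: equivariantD.
    have := ev_sub (skelS (fun x h => h) (leq_addr m j)) g'0.
    by apply: (ev_imp2 _ g0) => l _ _ -> ->; rewrite addr0.
  by rewrite addnS; apply: ev_imp fg' => l _ _; rewrite cobD => /eqP; rewrite subr_eq addrC => /eqP.
have [g [eg g0 fg]] := H N.+1; exists g; split=> //.
by move: fg; rewrite skelD_full// addnS ltnS leq_addl.
Qed.
End equivariant_cochains.

(** * Comparison of equivariant cochains with the cellular complex *)

Section cellular.
Context {D : topologicalType} {G : Type} {act : G -> D -> D} {Gam : set G}.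
Context {one : G} {mul : G -> G -> G} {inv : G -> G}.
Hypothesis ga : action act Gam one mul inv.
Hypothesis hD : hausdorff_space D.
Context {cells : nat -> set (set D)} {D0 : set D}.
Hypothesis cc : cell_complex cells.
Hypothesis D0E : D0 = \bigcup_p \bigcup_(s in cells p) s.
Hypothesis ec : equivariant_cells act Gam cells.
Context {N : nat} (cdim : cw_dimension cells N).
Context {k : nzRingType} {E : lmodType k} (rho : G -> {linear E -> E}).
Hypothesis rho1 : forall v, rho one v = v.
Hypothesis rhoM : forall g h v, Gam g -> Gam h -> rho (mul g h) v = rho g (rho h v).
Hypothesis mulV : forall g, Gam g -> mul g (inv g) = one.
Hypothesis mulVg : forall g, Gam g -> mul (inv g) g = one.
Context (reps : nat -> set (set D)) (rep : set D -> set D).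
Context (flag : set D -> seq (set D)) (gam : set D -> G).
Context (n : set D -> seq (set D) -> int).
Hypothesis cr : cell_representatives act Gam cells reps rep.
Hypothesis df : distinguished_flags cells reps flag.
Hypothesis tr : transporters act Gam cells rep flag gam.
Hypothesis fo : flag_orientation act cells rep flag gam n.
Implicit Types (s t : set D) (f : seq D -> E).

Local Notation skelD j := (skel (cells := cells) D0 j).
Local Notation tf := (transported_flag act rep flag gam).
Local Notation inc := (cell_sign act rep flag gam n).
Local Notation top := (top (cells := cells)).
Local Notation equivariant := (equivariant (act := act) (Gam := Gam) rho).
Local Notation stab := (cell_stabilizer act Gam).
Local Notation cfaces q s := (fset_set (facets cells q s)).

Lemma cobZ (a : k) (f : seq D -> E) l : cob (fun u => a *: f u) l = a *: cob f l.
Proof. by rewrite (cob_additive (GRing.scale a)). Qed.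

Lemma rep_top p s : reps p s -> top p s (flag s).
Proof. by move=> /df[]. Qed.

Lemma gamP q t : cells q t -> Gam (gam t) /\ translate act (gam t) (rep t) = t.
Proof.
move=> qt; have [|Gg lt] := tr (t := t); first by exists q.
split=> //; rewrite -[RHS]lt /transported_flag.
have [sf _ lf] := rep_top (rep_reps cr qt).
by case: (flag (rep t)) sf lf => // x F _ <-; apply: esym; exact: (last_map (translate act (gam t)) F x).
Qed.

Lemma tfP p s : cells p s -> top p s (tf s).
Proof.
move=> ps; have [Gg e] := gamP ps; have := rep_top (rep_reps cr ps).
by move=> /(top_auto (action_auto ga ec Gg)); rewrite -/(translate act (gam s) (rep s)) e.
Qed.

Lemma nP p s : cells p s ->
  [/\ forall F, top p s F -> n s F = 1 \/ n s F = -1,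
      flag_balanced (cells := cells) p s (n s) & n s (tf s) = (-1) ^+ p].
Proof.
move=> ps; have [f1 f2 f3] := fo ps; split=> //.
  by move=> F tF; apply: f1; apply/(subdivisionE cc F ps).
exact: (orientation_balanced cc ps f2).
Qed.

(** The two transporters differ by an element of the stabilizer of [rep s], which fixes every cell
    of the distinguished flag because all of them lie in the closure. *)
Lemma tf_auto g p s : Gam g -> cells p s ->
  tf (translate act g s) = [seq translate act g t | t <- tf s].
Proof.
move=> Gg ps; rewrite /transported_flag -map_comp (rep_translate ga ec mulVg cr ps Gg).
have sk := gam_translate ga ec mulVg cr gamP ps Gg.
have ps' : cells p (translate act g s) by exact: ec.1.
have [G1 _] := gamP ps; have [G2 _] := gamP ps'.
have rr := rep_reps cr ps; have cs := reps_cell cr rr.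
apply/eq_in_map => u uf /=.
have us : u `<=` closure (rep s) by apply: (top_sub (rep_top rr)).
have fixu : translate act (mul (inv (gam (translate act g s))) (mul g (gam s))) u = u.
  apply/seteqP; split=> x.
    by move=> [y uy <-]; rewrite (action_fix_closure ga hD ec cs sk (us _ uy)).
  by move=> ux; exists x => //; rewrite (action_fix_closure ga hD ec cs sk (us _ ux)).
rewrite -[X in translate act _ X = _]fixu.
have Ggg := act_mul ga Gg G1; have Gi := act_inv ga G2.
rewrite (translateM ga u Gi Ggg).
apply/seteqP; split=> x.
  move=> [_ [y uy <-] <-]; rewrite (actVK ga G2); case: uy => z uz <-.
  by exists (act (gam s) z); [exists z | rewrite (actM ga)].
move=> [_ [z uz <-] <-]; exists (act (inv (gam (translate act g s))) (act g (act (gam s) z))).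
  by exists (act g (act (gam s) z)) => //; exists z => //; rewrite (actM ga).
by rewrite (actVK ga G2).
Qed.

Lemma inc_eq g q s t : Gam g -> cells q.+1 s -> cells q t -> t `<=` bdry s ->
  inc (act g @` s) (act g @` t) = inc s t.
Proof.
move=> Gg qs qt ts.
by apply: (inc_auto cc tfP nP (action_auto ga ec Gg) _ qs qt ts) => p u pu; exact: tf_auto pu.
Qed.

Lemma balM (M : zmodType) q s : cells q.+1 s ->
  balanced (cells := cells) (M := M) inc q s (inc s).
Proof. exact: (inc_balanced cc tfP nP). Qed.

Lemma incU q s t : cells q.+1 s -> cells q t -> t `<=` bdry s -> inc s t = 1 \/ inc s t = -1.
Proof. exact: (inc_unit cc tfP nP). Qed.

Lemma facE q s : cells q.+1 s -> facets cells q s !=set0.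
Proof. exact: (facet_exists cc tfP). Qed.

Local Notation Fix s := (submod_type (fixed (act := act) (Gam := Gam) rho s)).
Local Notation evl := (cell_eval (cells := cells) inc).

(** Representatives of the relative cohomology of the p-skeleton modulo the (p - 1)-skeleton, the
    first page of the skeletal filtration. *)
Definition pure p f : Prop := [/\ equivariant f,
  ev (skelD p) p.+1 (fun l => f l = 0) & ev (skelD p.+1) p.+2 (fun l => cob f l = 0)].

Lemma pure_rel p f s : pure p f -> cells p s -> rel_cocycle p s f.
Proof.
move=> [_ f0 df'] ps; split; first exact: ev_sub (bdry_skelD cc D0E ps) f0.
exact: ev_sub (closure_skelD cc D0E ps) df'.
Qed.

Lemma evl_translate p f t : pure p f -> cells p t ->
  evl p t f = rho (gam t) (evl p (rep t) f).
Proof.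
move=> pf pt; have [G1 e] := gamP pt; have [ef _ _] := pf.
have rr := rep_reps cr pt; have cs := reps_cell cr rr.
have ca := action_auto ga ec G1.
have rt : rel_cocycle p (act (gam t) @` rep t) f.
  by rewrite -/(translate act (gam t) (rep t)) e; exact: pure_rel.
rewrite -[in LHS]e (cell_eval_auto cc (@balM E) ca _ cs rt); last first.
  by move=> q u v; exact: inc_eq.
rewrite -(cell_eval_nat cc (rho (gam t)) (@balM E) (@balM E) cs (pure_rel pf cs)).
by congr (evl p _ _); apply/funext => l; exact: ef.
Qed.

Lemma evl_fixed p f s g : pure p f -> cells p s -> stab s g -> rho g (evl p s f) = evl p s f.
Proof.
move=> pf ps sg; have [ef _ _] := pf.
rewrite -(cell_eval_nat cc (rho g) (@balM E) (@balM E) ps (pure_rel pf ps)).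
apply: (cell_eval_ext cc) => //; apply: ev_all => l _ cl.
exact: (equivariant_fixed ga hD ec ps ef cl sg).
Qed.

Definition pure_value p f : set D -> E := fun s => if `[< reps p s >] then evl p s f else 0.

Local Notation C := (cellular_complex act Gam cells rho reps rep flag gam n).

Lemma pure_value_in p f : pure p f -> scarrier (ccar C p) (pure_value p f).
Proof.
move=> pf; split=> s; first by move=> ns; rewrite /pure_value asboolF.
move=> rs g sg; rewrite /pure_value asboolT//; exact: (evl_fixed pf (reps_cell cr rs) sg).
Qed.

Lemma pure_cob p f : pure p f -> pure p.+1 (cob f).
Proof.
move=> [ef f0 df']; split=> //; first exact: equivariant_cob.
by apply: ev_all => l _ _; rewrite cob_cob.
Qed.

(** [f] is itself an admissible primitive of [cob f] on each cell of dimension [p.+1], so Stokes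
    gives the cellular differential; [evl_translate] expresses values at arbitrary facets by those
    at representatives. *)
Lemma pure_value_cob p f : pure p f -> cdiff C p (pure_value p f) = pure_value p.+1 (cob f).
Proof.
move=> pf; apply/funext => s; rewrite /pure_value /= /cellular_differential.
case: asboolP => // rs; have qs := reps_cell cr rs; have rdf := pure_rel (pure_cob pf) qs.
have [ef f0 df'] := pf.
apply: etrans (esym (cell_eval_stokes cc (@balM E) qs rdf (f := f) _)).
  apply: eq_big_seq => t; rewrite (mem_faces cc _ _ qs) => /asboolP[pt ts].
  by rewrite asboolT -?(evl_translate pf pt)//; exact: (rep_reps cr).
split; last exact: ev_all.
apply: ev_sub f0; apply: skelS => //; apply: subset_trans (@bdry_sub _ s) _.
by apply: subset_trans (closure_skelD cc D0E qs) _; exact: skel_sub.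
Qed.

Lemma pure_value_ext p f f' : ev (skelD p.+1) p.+1 (fun l => f l = f' l) ->
  pure_value p f = pure_value p f'.
Proof.
move=> ff; apply/funext => s; rewrite /pure_value; case: asboolP => // rs.
have ps := reps_cell cr rs; apply: (cell_eval_ext cc) => //.
exact: ev_sub (closure_skelD cc D0E ps) ff.
Qed.

Lemma pure_value_lin p (a : k) f f' : pure p f -> pure p f' ->
  pure_value p (fun l => a *: f l + f' l) = a *: pure_value p f + pure_value p f'.
Proof.
move=> pf pf'; apply/funext => s; rewrite [RHS]/GRing.add/= [in RHS]/GRing.scale/= /pure_value.
case: asboolP => rs; last by rewrite scaler0 addr0.
have ps := reps_cell cr rs; have r1 := pure_rel pf ps; have r2 := pure_rel pf' ps.
have r3 : rel_cocycle p s (fun l => a *: f l).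
  case: r1 => h1 h2; split; first by apply: ev_imp h1 => l _ _ ->; rewrite scaler0.
  by apply: ev_imp h2 => l _ _; rewrite cobZ => ->; rewrite scaler0.
rewrite (cell_evalD cc (@balM E) ps r3 r2); congr (_ + _).
exact: (cell_eval_nat cc (GRing.scale a) (@balM E) (@balM E) ps r1).
Qed.

Lemma pure_lin p (a : k) f f' : pure p f -> pure p f' -> pure p (fun l => a *: f l + f' l).
Proof.
move=> [e1 h1 d1] [e2 h2 d2]; split; first exact: equivariant_lin.
  by apply: (ev_imp2 _ h1 h2) => l _ _ -> ->; rewrite scaler0 addr0.
apply: (ev_imp2 _ d1 d2) => l _ _; rewrite cobD cobZ => -> ->.
by rewrite scaler0 addr0.
Qed.

Lemma pureB p f f' : pure p f -> pure p f' -> pure p (fun l => f l - f' l).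
Proof.
move=> p1 p2; have := pure_lin (-1) p2 p1; congr pure.
by apply/funext => l; rewrite scaleN1r addrC.
Qed.

Lemma pure_valueB p f f' : pure p f -> pure p f' ->
  pure_value p (fun l => f l - f' l) = pure_value p f - pure_value p f'.
Proof.
move=> p1 p2; have := pure_value_lin (-1) p2 p1; rewrite scaleN1r addrC => <-.
by congr pure_value; apply/funext => l; rewrite scaleN1r addrC.
Qed.

Lemma pure_value_surj p v : scarrier (ccar C p) v -> exists2 f, pure p f & pure_value p f = v.
Proof.
move=> [v0 vP].
have ex s : exists f : seq D -> submod_type (fixed (act := act) (Gam := Gam) rho s),
    reps p s -> rel_cocycle p s f /\ evl p s (fun l => val (f l)) = v s.
  have [rs|nrs] := pselect (reps p s); last by exists (fun=> 0).
  have ps := reps_cell cr rs.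
  have vfix : v s \in submod_pred (fixed (act := act) (Gam := Gam) rho s).
    by apply/asboolP => g sg; exact: vP.
  (* The value is realized with coefficients in the fixed elements, so that the cochain on [s] is
     invariant under the stabilizer. *)
  have [f rf e] := cell_eval_surj cc (@balM (Fix s)) incU facE (Sub (v s) vfix : Fix s) ps.
  by exists f => _; split=> //; rewrite (cell_eval_nat cc \val (@balM (Fix s)) (@balM E) ps rf) e.
pose h s := projT1 (cid (ex s)).
have hP s : reps p s -> rel_cocycle p s (h s) /\ evl p s (fun l => val (h s l)) = v s.
  by rewrite /h; case: cid.
have [f [ef f0 fh]] : exists f, [/\ equivariant f, ev (skelD p) p.+1 (fun l => f l = 0) &
    forall s, reps p s -> ev (closure s) p.+1 (fun l => f l = val (h s l))].
  apply: (equivariant_extension ga hD cc ec rho1 rhoM mulV mulVg cr gamP (h := fun s l => val (h s l))) => [s rs|s g' l rs sg'].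
    by apply: ev_imp (hP s rs).1.1 => l _ _ ->.
  by have /asboolP := valP (h s l); apply.
have pf : pure p f.
  split=> //; apply: (ev_skel cc (subcomplex_D0 cc D0E)) => q t qt.
  rewrite ltnS leq_eqVlt => /orP[/eqP qr|qr] tD; last first.
    by apply: ev_sub (closure_sub_skel cc (subcomplex_D0 cc D0E) qt qr tD) _; exact: ev_cob0.
  rewrite {}qr in qt.
  apply: (equivariant_spread ga ec rho1 rhoM mulV cr gamP (equivariant_cob ef) (equivariant0 _)) qt => s rs.
  have /(rel_cocycle_val (rho := rho)) [_ d] := (hP s rs).1.
  by apply: (ev_imp2 _ (ev_cob (fh s rs)) d) => l _ _ ->.
exists f => //; apply/funext => s; rewrite /pure_value; case: asboolP => [rs|nrs].
  rewrite -(hP s rs).2; apply: (cell_eval_ext cc); [exact: (reps_cell cr)|exact: fh].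
by rewrite v0.
Qed.

Lemma pure_value_ker p f : pure p f -> pure_value p f = 0 ->
  exists g, [/\ equivariant g, ev (skelD p) p (fun l => g l = 0) &
    ev (skelD p.+1) p.+1 (fun l => f l = cob g l)].
Proof.
move=> pf f0; have [ef fs _] := pf.
apply: (extend_primitive ga hD cc D0E ec rho1 rhoM mulV mulVg cr gamP ef fs) => s rs.
have ps := reps_cell cr rs; have rf := pure_rel pf ps.
have rc := corestrict_rel_cocycle ga hD ec ps ef rf.
apply: (cell_eval_ker cc (@balM (Fix s)) incU facE ps rc).
apply: val_inj; apply: etrans (esym (cell_eval_nat cc \val (@balM (Fix s)) (@balM E) ps rc)) _.
have -> : evl p s (fun l => val (corestrict (act := act) (Gam := Gam) rho s f l)) = evl p s f.
  by apply: (cell_eval_ext cc) => //; exact: (ev_corestrict ga hD ec p.+1 ps ef).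
transitivity (0 : E) => //; by have := congr1 (fun v => v s) f0; rewrite /pure_value asboolT.
Qed.

Lemma cellular_is_complex : is_complex C.
Proof.
move=> p v /pure_value_surj[f pf <-]; rewrite !pure_value_cob//; last exact: pure_cob.
split; first exact/pure_value_in/pure_cob.
apply/funext => s; rewrite /pure_value; case: asboolP => // rs.
have [add _] := cell_eval_theory cc (@balM E) p.+2.
apply: (cell_eval0 cc (@balM E)); first exact: (reps_cell cr).
by apply: ev_all => l _ _; rewrite cob_cob.
Qed.

Definition equivariant_cocycle p (f : seq D -> E) : Prop :=
  equivariant f /\ ev D0 p.+2 (fun l => cob f l = 0).

Definition equivariant_coboundary p (f : seq D -> E) : Prop :=
  if p is q.+1 then exists2 g, equivariant g & ev D0 p.+1 (fun l => f l = cob g l)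
  else ev D0 1 (fun l => f l = 0).

(** [equivariant_push] removes the restriction to the lower skeleton. In degree 0 the correction has
    to vanish, since [cob] of an augmentation term does not count as a coboundary. *)
Lemma pure_cocycle p f : equivariant f -> ev D0 p.+2 (fun l => cob f l = 0) ->
  exists l (r : seq D -> E), [/\ pure p l, equivariant r, (p = 0%N -> r = fun=> 0),
    ev D0 p.+2 (fun x => cob l x = 0) & f = (fun x => l x + cob r x)].
Proof.
move=> ef dF; case: p dF => [|p] dF.
  exists f, (fun=> 0); split=> //; last by apply/funext => x; rewrite cob0 addr0.
    split=> //; last exact: ev_sub (@skel_sub _ _ _ _) dF.
    by move=> x [_ [q [t []]]].
  exact: equivariant0.
have [|g [eg fg]] := equivariant_push ga hD cc D0E ec rho1 rhoM mulV mulVg cr gamP (leqnn p.+1) ef.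
  exact: ev_sub (@skel_sub _ _ _ _) dF.
have dl : ev D0 p.+3 (fun x => cob (fun x => f x - cob g x) x = 0).
  by apply: ev_imp dF => l _ _; rewrite cobB cob_cob subr0.
exists (fun x => f x - cob g x), g; split=> //; last by apply/funext => x; rewrite subrK.
split; [exact/equivariantB/equivariant_cob| |exact: ev_sub (@skel_sub _ _ _ _) dl].
by apply: ev_imp fg => l _ _ ->; rewrite subrr.
Qed.

(** A primitive of [f] becomes pure up to a coboundary. Conversely, a pure cochain with value zero
    bounds on the p-skeleton by [pure_value_ker], and what remains is supported on higher cells,
    where [equivariant_kill] applies. *)
Lemma pure_value_coboundary p l (t : seq D -> E) f : pure p l -> equivariant t -> (p = 0%N -> t = fun=> 0) ->
  f = (fun x => l x + cob t x) -> ev D0 p.+2 (fun x => cob l x = 0) ->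
  equivariant_coboundary p f <-> @is_coboundary _ C p (pure_value p l).
Proof.
move=> pl et t0 fE dl; split.
  case: p pl t0 fE dl => [|p] pl t0 fE dl.
    move=> f0; have {}f0 : ev D0 1 (fun l => f l = 0) by exact: f0.
    rewrite (_ : pure_value 0 l = 0)//; apply/funext => s.
    rewrite /pure_value; case: asboolP => // rs; have ps := reps_cell cr rs.
    apply: (cell_eval0 cc (@balM E)) => //.
    have sD : closure s `<=` D0 by apply: subset_trans (closure_skelD cc D0E ps) _; exact: skel_sub.
    by apply: ev_imp (ev_sub sD f0) => x _ _; rewrite fE t0// cob0 addr0.
  move=> [g eg fg].
  have ea := equivariantB eg et; set a := (fun x => g x - t x) in ea.
  have la : ev D0 p.+2 (fun x => l x = cob a x).
    by apply: ev_imp fg => x _ _; rewrite fE cobB => <-; rewrite addrK.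
  have [_ l0 _] := pl.
  have la' : ev (skelD p.+1) p.+2 (fun x => l x = cob a x) := ev_sub (@skel_sub _ _ _ _) la.
  have [c [b [pc ec' ac]]] : exists c b, [/\ pure p c, equivariant b & a = fun x => c x + cob b x].
    case: p pl t0 fE dl fg l0 la la' => [|p] pl t0 fE dl fg l0 la la'.
      exists a, (fun=> 0); split; [|exact: equivariant0|by apply/funext => x; rewrite cob0 addr0].
      split=> //; first by move=> x [_ [q [u []]]].
      by apply: (ev_imp2 _ l0 la') => x _ _ -> <-.
    have da : ev (skelD p.+1) p.+3 (fun x => cob a x = 0).
      have := ev_sub (skelS (Y := D0) (fun x h => h) (leqnSn p.+1)) l0.
      have := ev_sub (skelS (Y := D0) (fun x h => h) (leqnSn p.+1)) la'.
      by apply: ev_imp2 => x _ _ -> ->.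
    have [b [eb ab]] := equivariant_push ga hD cc D0E ec rho1 rhoM mulV mulVg cr gamP (leqnn p.+1) ea da.
    exists (fun x => a x - cob b x), b; split=> //; last by apply/funext => x; rewrite subrK.
    split; first exact/equivariantB/equivariant_cob.
      by apply: ev_imp ab => x _ _ ->; rewrite subrr.
    by apply: (ev_imp2 _ l0 la') => x _ _ e1 e2; rewrite cobB cob_cob subr0 -e2.
  exists (pure_value p c); first exact: pure_value_in.
  rewrite pure_value_cob//; apply: pure_value_ext; apply: (ev_sub (@skel_sub _ cells D0 _)).
  by apply: ev_imp la => x _ _ ->; rewrite ac cobD cob_cob addr0.
case: p pl t0 fE dl => [|p] pl t0 fE dl.
  move=> l0; have [el _ _] := pl.
  change (ev D0 1 (fun l => f l = 0)).
  have z : ev (skelD 1) 1 (fun x => l x = 0).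
    have [u' [eu' u0 lu']] := pure_value_ker pl l0.
    by apply: ev_imp lu' => x; case: x => [|y [|]] //= _ _; rewrite u0 subr0.
  have [w [ew w0 lw]] := equivariant_kill ga hD cc D0E ec rho1 rhoM mulV mulVg cr gamP cdim (ltn0Sn 0) el dl z.
  apply: ev_imp lw => x; case: x => [|y [|]] //= _ _.
  by rewrite w0 subr0 fE t0// => ->; rewrite cob0 addr0.
move=> [v /pure_value_surj[c pc <-]]; rewrite pure_value_cob// => e.
have pd : pure p.+1 (fun x => l x - cob c x) by apply: pureB => //; exact: pure_cob.
have [|u [eu u0 lu]] := pure_value_ker pd.
  by rewrite pure_valueB ?e ?subrr//; exact: pure_cob.
have [epd _ _] := pd.
have e2 := equivariantB epd (equivariant_cob eu).
have [||w [ew w0 lw]] := equivariant_kill ga hD cc D0E ec rho1 rhoM mulV mulVg cr gamP cdim (ltnSn p.+1) e2.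
- by apply: ev_imp dl => x _ _; rewrite !cobB !cob_cob !subr0.
- by apply: ev_imp lu => x _ _ ->; rewrite subrr.
exists (fun x => w x + u x + c x + t x).
  by do ![apply: equivariantD => //]; case: pc.
apply: ev_imp lw => x _ _; rewrite !cobD => <-; rewrite fE.
by rewrite [_ - _ + _]subrK [_ - _ + _]subrK.
Qed.

Lemma equivariant_cellular p : subquotient_iso (equivariant_cocycle p) (equivariant_coboundary p)
  (scarrier (cocycles C p)) (@is_coboundary _ C p).
Proof.
(* [f] is related to the value of any pure cocycle that differs from it by a coboundary. *)
exists (fun f v => equivariant_cocycle p f /\ exists l (r : seq D -> E), [/\ pure p l, equivariant r /\ (p = 0%N -> r = fun=> 0),
    f = (fun x => l x + cob r x), ev D0 p.+2 (fun x => cob l x = 0) & v = pure_value p l]).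
split.
- move=> a f v f' v' [[ef dF] [l [t [pl [et t0] fE dl ->]]]] [[ef' dF'] [l' [t' [pl' [et' t0'] fE' dl' ->]]]].
  split.
    split; first exact: equivariant_lin.
    apply: (ev_imp2 _ dF dF') => x _ _ h h'; rewrite [X in cob X](_ : _ = fun l => a *: f l + f' l)//.
    by rewrite cobD cobZ h h' scaler0 addr0.
  exists (fun x => a *: l x + l' x), (fun x => a *: t x + t' x); split.
  - exact: pure_lin.
  - split; first exact: equivariant_lin.
    by move=> p0; rewrite t0// t0'//; apply/funext => x; rewrite scaler0 addr0.
  - apply/funext => x; rewrite [LHS]/GRing.add/= [in LHS]/GRing.scale/= fE fE' cobD cobZ.
    by rewrite scalerDr addrACA.
  - apply: (ev_imp2 _ dl dl') => x _ _; rewrite cobD cobZ => -> ->.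
    by rewrite scaler0 addr0.
  - by rewrite pure_value_lin.
- move=> f v [Zf [l [t [pl _ _ dl ->]]]]; split=> //; split; first exact: pure_value_in.
  rewrite pure_value_cob//; apply/funext => s; rewrite /pure_value; case: asboolP => // rs.
  have ps := reps_cell cr rs; apply: (cell_eval0 cc (@balM E)) => //.
  apply: ev_sub dl; apply: subset_trans (closure_skelD cc D0E ps) _; exact: skel_sub.
- move=> f [ef dF]; have [l [t [pl et t0 dl fE]]] := pure_cocycle ef dF.
  by exists (pure_value p l); split=> //; exists l, t.
- move=> v [/pure_value_surj[l pl <-]]; rewrite pure_value_cob// => dv.
  (* A cellular cocycle lifts to [l] with [cob l] of value zero. The corrections [t] and [u] make it
     closed on all of [D0]; both vanish on the p-skeleton and leave the value unchanged. *)
  have [t [et t0 lt]] := pure_value_ker (pure_cob pl) dv.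
  have [el l0 _] := pl.
  have e1 := equivariantB (equivariant_cob el) (equivariant_cob et).
  have [||u [eu u0 lu]] := equivariant_kill ga hD cc D0E ec rho1 rhoM mulV mulVg cr gamP cdim (ltnSn p.+1) e1.
  + by apply: ev_all => x _ _; rewrite cobB !cob_cob subr0.
  + by apply: ev_imp lt => x _ _ ->; rewrite subrr.
  have u0' := ev_sub (skelS (Y := D0) (fun x h => h) (leqnSn p.+1)) u0.
  have dl : ev D0 p.+2 (fun x => cob (fun x => l x - t x - u x) x = 0).
    by apply: ev_imp lu => x _ _; rewrite !cobB => ->; rewrite subrr.
  exists (fun x => l x - t x - u x); split; first by split=> //; do ![apply: equivariantB => //].
  exists (fun x => l x - t x - u x), (fun=> 0); split=> //.
  + split; first by do ![apply: equivariantB => //].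
      have s1 : skelD p `<=` skelD p.+1 by exact: skelS.
      have h : ev (skelD p) p.+1 (fun x => t x = 0 /\ u x = 0).
        by apply: (ev_imp2 _ (ev_sub s1 t0) (ev_sub s1 u0')) => x _ _ -> ->.
      by apply: (ev_imp2 _ l0 h) => x _ _ -> [-> ->]; rewrite !subr0.
    exact: ev_sub (@skel_sub _ _ _ _) dl.
  + by split=> //; exact: equivariant0.
  + by apply/funext => x; rewrite cob0 addr0.
  + apply: pure_value_ext; apply: (ev_imp2 _ t0 u0') => x _ _ -> ->; by rewrite !subr0.
- move=> f v [_ [l [t [pl [et t0] fE dl ->]]]]; exact: pure_value_coboundary fE dl.
Qed.
End cellular.

(** * Comparison of sheaves of germs *)

Section generic_germs.
Context {X : topologicalType}.
Implicit Types (Q : seq X -> X -> Prop) (x y z : X) (l : seq X).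

Fixpoint germx n Q x : Prop :=
  if n is m.+1 then \forall y \near x, germx m (fun l => Q (y :: l)) y
  else \forall z \near x, Q [::] z.

(* [z] ranges over a neighbourhood of the last point of [l]; for [n = 0] it is
   arbitrary, which makes global sections the cochains of length 0. *)
Definition germ n Q : Prop :=
  if n is m.+1 then forall x, germx m (fun l => Q (x :: l)) x
  else forall z, Q [::] z.

Lemma germx_imp2 n Q Q' Q'' x :
  (forall l z, size l = n -> Q l z -> Q' l z -> Q'' l z) ->
  germx n Q x -> germx n Q' x -> germx n Q'' x.
Proof.
elim: n Q Q' Q'' x => [|n IH] Q Q' Q'' x h /=.
  by apply: filterS2 => z; exact: h.
by apply: filterS2 => y; apply: IH => l z ls; apply: h; rewrite /= ls.
Qed.

Lemma germ_imp2 n Q Q' Q'' :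
  (forall l z, size l = n -> Q l z -> Q' l z -> Q'' l z) ->
  germ n Q -> germ n Q' -> germ n Q''.
Proof.
case: n => [|n] h a b x; first exact: h.
by apply: (germx_imp2 _ (a x) (b x)) => l z ls; apply: h; rewrite /= ls.
Qed.

Lemma germ_imp n Q Q' : (forall l z, size l = n -> Q l z -> Q' l z) ->
  germ n Q -> germ n Q'.
Proof. by move=> h a; apply: (germ_imp2 _ a a) => l z ls q _; exact: h. Qed.

Lemma germx_all n Q x : (forall l z, Q l z) -> germx n Q x.
Proof.
by elim: n Q x => [|n IH] Q x h /=; apply: nearW => y //; exact: IH.
Qed.

Lemma germ_all n Q : (forall l z, Q l z) -> germ n Q.
Proof. by case: n => [|n] h x //; exact: germx_all. Qed.

Lemma germx_near n Q x : germx n Q x -> \forall y \near x, germx n Q y.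
Proof. by case: n => [|n] /near_near. Qed.

Lemma germx_faces n Q x : germx n Q x ->
  germx n.+1 (fun l z => faces (Q^~ z) l) x.
Proof.
elim: n Q x => [|n IH] Q x Qx.
  by near=> y; near=> z; split => //; near: z; near: y; exact: near_near.
change (\forall y \near x, germx n.+1 (fun l z => faces (Q^~ z) (y :: l)) y).
have := germx_near Qx; apply: filterS2 (Qx : \forall y \near x, germx n (fun l => Q (y :: l)) y).
move=> y /IH h1 h2; apply: (germx_imp2 _ h2 h1) => l z _ ? ?; by split.
Unshelve. all: by end_near. Qed.

Lemma germ_faces n Q : germ n Q -> germ n.+1 (fun l z => faces (Q^~ z) l).
Proof.
case: n => [|n] h x.
  by apply: nearW => z; split.
change (germx n.+1 (fun l z => faces (Q^~ z) (x :: l)) x).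
have h' : germx n.+1 Q x by apply: nearW => y; exact: h.
by apply: (germx_imp2 _ h' (germx_faces (h x))) => l z _ ? ?; split.
Qed.

Lemma germx_rcons n Q x : germx n.+1 Q x ->
  germx n (fun l z => \forall y \near z, Q (rcons l y) y) x.
Proof.
elim: n Q x => [|n IH] Q x h.
  apply: near_near; apply: filterS (h : \forall y \near x, \forall z \near y, Q [:: y] z) => y.
  exact: nbhs_singleton.
by apply: filterS (h : \forall y \near x, germx n.+1 (fun l => Q (y :: l)) y) => y /IH.
Qed.

Lemma germ_rcons n Q : germ n.+1 Q ->
  germ n (fun l z => \forall y \near z, Q (rcons l y) y).
Proof.
case: n => [|n] h x; last exact: germx_rcons (h x).
by apply: nearW => y; have /nbhs_singleton := h y.
Qed.

Lemma germx_last n Q Q' x :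
  (forall s, Q s (last x s) -> \forall y \near last x s, Q' s y) ->
  germx n Q x -> germx n Q' x.
Proof.
elim: n x Q Q' => [|n IH] x Q Q' QQ' /= h; first by apply: (QQ' [::]); exact: nbhs_singleton.
by apply: filterS h => y; apply: IH => s; exact: (QQ' (y :: s)).
Qed.

(** Solutions are chosen independently for all lists, each valid near the last point of its list. No
    compatibility is asked for, so the columns are exact as soon as germs are. *)
Lemma germ_choice (A : Type) (a0 : A) n Q (Q' : seq X -> A -> X -> Prop) :
  (forall l x, Q l x -> exists a, \forall y \near x, Q' l a y) ->
  germ n.+1 Q -> exists g : seq X -> A, germ n.+1 (fun l => Q' l (g l)).
Proof.
move=> QQ' h.
have /choice[g gP] : forall l, exists a, forall x s, l = x :: s -> Q l (last x s) ->
    \forall y \near last x s, Q' l a y.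
  case=> [|x s]; first by exists a0.
  have [q|nq] := pselect (Q (x :: s) (last x s)); last first.
    by exists a0 => ? ? [<- <-].
  by have [a aP] := QQ' _ _ q; exists a => ? ? [<- <-].
exists g => x; apply: germx_last (h x) => s; exact: gP.
Qed.

Lemma cob_rcons (k : nzRingType) (M : lmodType k) (f : seq X -> M) l y :
  cob f (rcons l y) = cob (fun t => f (rcons t y)) l + (-1) ^+ size l *: f l.
Proof.
elim: l f => [|x l IH] f /=; first by rewrite subr0 scale1r add0r.
by rewrite IH opprD addrA exprS mulN1r scaleNr.
Qed.

Lemma cob_eval (k : nzRingType) (T : Type) (M : lmodType k) (f : seq X -> T -> M) l (y : T) :
  cob f l y = cob (fun t => f t y) l.
Proof.
elim: l f => [|x l IH] f //=.
by rewrite {1}/GRing.add/= {1}/GRing.opp/= IH.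
Qed.

Lemma cob_lin (k : nzRingType) (M : lmodType k) (a : k) (f g : seq X -> M) l :
  cob (a *: f + g) l = a *: cob f l + cob g l.
Proof.
by rewrite (cobD (fun t => a *: f t)) (cob_additive ( *:%R a : {additive _ -> _})).
Qed.
End generic_germs.

(* [van s x] says that the germ of [s] at [x] vanishes, and [retr] glues sections
   chosen independently at all points; the latter replaces injectivity. *)
Record germ_complex (k : nzRingType) (X : topologicalType) := GermComplex {
  term : nat -> lmodType k;
  dif : forall q, {linear term q -> term q.+1};
  van : forall q, term q -> X -> Prop;
  retr : forall q, {linear (X -> term q) -> term q};
  difK : forall q s, dif q.+1 (dif q s) = 0;
  van0 : forall q x, van (0 : term q) x;
  van_lin : forall q (a : k) (s t : term q) x, van s x -> van t x -> van (a *: s + t) x;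
  van_open : forall q (s : term q) x, van s x -> \forall y \near x, van s y;
  van_dif : forall q (s : term q) x, van s x -> van (dif q s) x;
  van_exact : forall q (s : term q.+1) x, van (dif q.+1 s) x ->
    exists t, van (s - dif q t) x;
  retr_cst : forall q (s : term q) x, van (retr q (fun=> s) - s) x;
  retr_van : forall q (G : X -> term q) x,
    (\forall y \near x, van (G y) y) -> van (retr q G) x }.
Arguments dif {k X g q}.
Arguments van {k X g q}.
Arguments retr {k X g q}.

(** * The double complex of generic families of germs *)

Section zigzag.
Context {k : nzRingType} {X : topologicalType} {F : germ_complex k X}.
Local Notation term := (term F).

Lemma vanD q (s t : term q) x : van s x -> van t x -> van (s + t) x.
Proof. by move=> /(van_lin 1) h /h; rewrite scale1r. Qed.

Lemma vanZ q a (s : term q) x : van s x -> van (a *: s) x.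
Proof. by move=> sx; rewrite -[_ *: _]addr0; apply: van_lin => //; exact: van0. Qed.

Lemma vanN q (s : term q) x : van s x -> van (- s) x.
Proof. by rewrite -scaleN1r; exact: vanZ. Qed.

Lemma vanB q (s t : term q) x : van s x -> van t x -> van (s - t) x.
Proof. by move=> ? /vanN; exact: vanD. Qed.

Lemma vanBr q (s t : term q) x : van (s - t) x -> van t x -> van s x.
Proof. by move=> st tx; rewrite -[s](subrK t); exact: vanD. Qed.

Lemma vanBl q (s t : term q) x : van (s - t) x -> van s x -> van t x.
Proof. by move=> st sx; rewrite -[t](subKr s); exact: vanB. Qed.

Lemma vanBB q (s t u : term q) x : van (s - t) x -> van (s - u) x -> van (t - u) x.
Proof. by move=> h1 h2; have := vanB h2 h1; rewrite opprB addrC addrA subrK. Qed.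

Definition null m q (f : seq X -> term q) : Prop := germ m (fun l => van (f l)).

Lemma van_faces q (f : seq X -> term q) l z : faces (fun t => van (f t) z) l -> van (cob f l) z.
Proof.
elim: l f => [|x l IH] f /=; first by move=> _; exact: van0.
by move=> [h /IH h']; exact: vanB.
Qed.

Lemma null_cob m q (f : seq X -> term q) : null m f -> null m.+1 (cob f).
Proof. by move=> /germ_faces; apply: germ_imp => l z _; exact: van_faces. Qed.

Lemma null_dif m q (f : seq X -> term q) : null m f -> null m (fun l => dif (f l)).
Proof. by apply: germ_imp => l z _; exact: van_dif. Qed.

Lemma cob_dif q (f : seq X -> term q) l : cob (fun t => dif (f t)) l = dif (cob f l).
Proof. by rewrite (cob_additive (dif : {linear _ -> _})). Qed.

(* Integrating out the last variable contracts the rows. *)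
Lemma row_exact m q (f : seq X -> term q) : null m.+1 (cob f) ->
  exists g : seq X -> term q, null m (fun l => f l - cob g l).
Proof.
move=> cf; pose c l : X -> term q := fun y => f (rcons l y).
(* The sign compensates that of the last term in [cob_rcons]. *)
exists (fun l => (-1) ^+ m.+1 *: retr (c l)).
have := germ_rcons cf; apply: germ_imp => l z lm /retr_van h.
have e : (fun y => cob f (rcons l y)) = cob c l + (-1) ^+ m *: (fun=> f l).
  apply/funext => y; rewrite cob_rcons lm [RHS]/GRing.add/= [in RHS]/GRing.scale/=.
  by rewrite cob_eval.
move: h; rewrite e linearD linearZ /= (cob_additive (retr : {linear _ -> _})) => h.
rewrite -(cob_additive ( *:%R ((-1) ^+ m.+1) : {additive _ -> _})) /=.
have := vanB (vanZ ((-1) ^+ m) h) (retr_cst (f l) z).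
have sq : (-1) ^+ m * (-1) ^+ m = 1 :> k by rewrite -exprD addnn -signr_odd odd_double.
rewrite scalerDr scalerA sq scale1r.
by rewrite opprB addrACA subrr addr0 addrC exprS mulN1r scaleNr opprK.
Qed.

(** Cochains closed for both differentials of the double complex. Taken modulo [bdif] at one place
    and modulo [bcob] at the next place of the antidiagonal, they form the same group
    ([zigzag_step]). *)
Definition zz m q (f : seq X -> term q) : Prop :=
  null m (fun l => dif (f l)) /\ null m.+1 (cob f).

Definition bdif m q : (seq X -> term q) -> Prop :=
  if q is q'.+1 then fun f => exists a : seq X -> term q',
    null m (fun l => f l - dif (a l)) /\ null m.+1 (cob a)
  else @null m 0.

Definition bcob m q (f : seq X -> term q) : Prop :=
  exists b : seq X -> term q, null m.-1 (fun l => dif (b l)) /\ null m (fun l => f l - cob b l).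

Lemma col_exact m q (f : seq X -> term q.+1) : null m.+1 (fun l => dif (f l)) ->
  exists g : seq X -> term q, null m.+1 (fun l => f l - dif (g l)).
Proof.
apply: (germ_choice (0 : term q) (Q' := fun l g => van (f l - dif g))) => l x /van_exact[t ft].
by exists t; exact: van_open.
Qed.

Lemma null_eq m q (f g : seq X -> term q) : (forall l, f l = g l) -> null m (fun l => f l - g l).
Proof. by move=> fg; apply: germ_all => l z; rewrite fg subrr; exact: van0. Qed.

Lemma null_trans m q (f g h : seq X -> term q) : null m (fun l => f l - g l) ->
  null m (fun l => g l - h l) -> null m (fun l => f l - h l).
Proof.
by apply: germ_imp2 => l z _ /vanD h1 /h1; rewrite addrA subrK.
Qed.

Lemma null_sym m q (f g : seq X -> term q) : null m (fun l => f l - g l) ->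
  null m (fun l => g l - f l).
Proof. by apply: germ_imp => l z _ /vanN; rewrite opprB. Qed.

(** Exactness of rows and columns turns either condition into [f = dif (cob c)] up to null
    cochains. *)
Lemma bdif_bcob m q (f : seq X -> term q.+1) : bdif m.+2 f <-> bcob m.+2 f.
Proof.
split=> [[a [fa /row_exact[c ac]]]|[b [/col_exact[c bc] fb]]].
  exists (fun l => dif (c l)); split.
    by apply: germ_all => l z; rewrite difK; exact: van0.
  apply: null_trans fa _; apply: null_sym.
  by apply: germ_imp (null_dif ac) => l z _; rewrite linearB cob_dif => /vanN; rewrite opprB.
exists (cob c); split; last by apply: germ_all => l z; rewrite cob_cob; exact: van0.
apply: null_trans fb _; apply: germ_imp (null_cob bc) => l z _.
by rewrite cobB cob_dif.
Qed.

Lemma zigzag_step m q : subquotient_iso (@zz m.+1 q.+1) (@bdif m.+1 q.+1) (@zz m.+2 q) (@bcob m.+2 q).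
Proof.
exists (fun f f' => [/\ zz m.+1 f, zz m.+2 f' & exists g : seq X -> term q,
  null m.+1 (fun l => f l - dif (g l)) /\ null m.+2 (fun l => f' l - cob g l)]).
have zz_lin m' q' (a : k) (f g : seq X -> term q') : zz m' f -> zz m' g -> zz m' (a *: f + g).
  move=> [f1 f2] [g1 g2]; split.
    by apply: germ_imp2 f1 g1 => l z _; rewrite linearP; exact: van_lin.
  by apply: germ_imp2 f2 g2 => l z _; rewrite cob_lin; exact: van_lin.
split.
- move=> a f f' g g' [zf zf' [u [fu fu']]] [zg zg' [v [gv gv']]]; split; [exact: zz_lin..|].
  exists (a *: u + v); split.
    apply: germ_imp2 fu gv => l z _ h1 h2; have := van_lin a h1 h2.
    by rewrite scalerBr addrACA -opprD -linearP.
  apply: germ_imp2 fu' gv' => l z _ h1 h2; have := van_lin a h1 h2.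
  by rewrite scalerBr addrACA -opprD cob_lin.
- by move=> f f' [].
- move=> f [df cf]; have [g fg] := col_exact df.
  exists (cob g); split=> //; last by exists g; split=> //; exact: null_eq.
  split; last by apply: germ_all => l z; rewrite cob_cob; exact: van0.
  apply: germ_imp2 (null_cob fg) cf => l z _; rewrite cobB cob_dif; exact: vanBl.
- move=> f' [df cf]; have [g fg] := row_exact cf.
  exists (fun l => dif (g l)); split=> //; last by exists g; split=> //; exact: null_eq.
  split; first by apply: germ_all => l z; rewrite difK; exact: van0.
  apply: germ_imp2 (null_dif fg) df => l z _; rewrite linearB cob_dif; exact: vanBl.
- move=> f f' [_ _ [g [fg fg']]]; split=> [[a [fa ca]]|[b [db fb]]].
    exists (fun l => g l - a l); split.
      by apply: germ_imp2 fg fa => l z _ h1 h2; rewrite linearB; exact: vanBB h1 h2.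
    by apply: germ_imp2 fg' ca => l z _; rewrite cobB opprB addrA addrAC; exact: vanD.
  exists (fun l => g l - b l); split.
    by apply: germ_imp2 fg db => l z _; rewrite linearB opprB addrA addrAC; exact: vanD.
  by apply: germ_imp2 fg' fb => l z _ h1 h2; rewrite cobB; exact: vanBB h1 h2.
Qed.

Definition global_cocycle n (s : term n) : Prop := forall x, van (dif s) x.

Definition global_coboundary n : term n -> Prop :=
  if n is n'.+1 then fun s => exists t : term n', forall x, van (s - dif t) x
  else fun s => forall x, van s x.

Lemma zigzag_start n : subquotient_iso (@global_cocycle n) (@global_coboundary n) (@zz 1 n) (@bdif 1 n).
Proof.
exists (fun s f => [/\ global_cocycle s, zz 1 f & null 1 (fun l => f l - s)]).
split.
- move=> a s f s' f' [zs [df cf] sf] [zs' [df' cf'] sf']; split.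
  + by move=> x; rewrite linearP; exact: van_lin.
  + split.
      by apply: germ_imp2 df df' => l z _; rewrite linearP; exact: van_lin.
    by apply: germ_imp2 cf cf' => l z _; rewrite cob_lin; exact: van_lin.
  + apply: germ_imp2 sf sf' => l z _ h1 h2; have := van_lin a h1 h2.
    by rewrite scalerBr addrACA -opprD.
- by move=> s f [].
- move=> s zs; exists (fun=> s); split=> //; last exact: null_eq.
  split; first exact: germ_all.
  by move=> x; apply: nearW => y; apply: nearW => z; rewrite /= !subr0 subrr; exact: van0.
- move=> f [df cf]; have [g fg] := row_exact cf.
  have sf : null 1 (fun l => f l - g [::]).
    by apply: germ_imp fg => l z; case: l => [|x [|]] //= _; rewrite subr0.
  exists (g [::]); split=> // x; have h := null_dif sf.
  have /nbhs_singleton := h x; rewrite linearB => /vanBl; apply.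
  by have /nbhs_singleton := df x.
- move=> s f [zs [df cf] sf]; case: n s f zs df cf sf => [|n] s f zs df cf sf.
    split=> [s0|f0 x].
      by apply: germ_imp sf => l z _ /vanBr; apply.
    by have /nbhs_singleton := sf x => /vanBl; apply; have /nbhs_singleton := f0 x.
  split=> [[t st]|[a [fa /row_exact[c ac]]]].
    exists (fun=> t); split.
      by apply: germ_imp sf => l z _ h; have := vanD h (st z); rewrite addrA subrK.
    by move=> x; apply: nearW => y; apply: nearW => z; rewrite /= !subr0 subrr; exact: van0.
  exists (c [::]) => x; have /nbhs_singleton h1 := sf x; have /nbhs_singleton h2 := fa x.
  have /nbhs_singleton := ac x; rewrite /= subr0 => /van_dif; rewrite linearB => h3.
  by have := vanD (vanBB h1 h2) h3; rewrite addrA subrK.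
Qed.

Lemma zigzag n : subquotient_iso (@global_cocycle n) (@global_coboundary n) (@zz n.+1 0)
  (if n is _.+1 then @bcob n.+1 0 else @bdif 1 0).
Proof.
case: n => [|n]; first exact: zigzag_start.
apply: subquotient_iso_trans (zigzag_start n.+1) _.
have H m q : subquotient_iso (@zz m.+1 q.+1) (@bdif m.+1 q.+1) (@zz (m.+1 + q.+1) 0) (@bcob (m.+1 + q.+1) 0).
  elim: q m => [|q IH] m; first by rewrite addn1; exact: zigzag_step.
  apply: subquotient_iso_trans (zigzag_step m q.+1) _.
  rewrite -addSnnS; have [R [R1 R2 R3 R4 R5]] := IH m.+1.
  by exists R; split=> // f f' /R5; rewrite -bdif_bcob.
by have := H 0%N n; rewrite add1n.
Qed.
End zigzag.

Section compatible.
Context {k : nzRingType} {X : topologicalType} (F F' : germ_complex k X).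
Variable R : term F 0 -> term F' 0 -> X -> Prop.
Hypothesis R_lin : forall (a : k) s s' t t' x, R s s' x -> R t t' x ->
  R (a *: s + t) (a *: s' + t') x.
Hypothesis R_open : forall s s' x, R s s' x -> \forall y \near x, R s s' y.
Hypothesis R_van : forall s s' x, R s s' x -> (van s x <-> van s' x).
Hypothesis R_tot : forall s x, van (dif s) x -> exists s', van (dif s') x /\ R s s' x.
Hypothesis R_surj : forall s' x, van (dif s') x -> exists s, van (dif s) x /\ R s s' x.

Lemma R_cob (f : seq X -> term F 0) (f' : seq X -> term F' 0) l z :
  faces (fun t => R (f t) (f' t) z) l -> R (cob f l) (cob f' l) z.
Proof.
have R0 : R 0 0 z.
  have [|s' [_ h]] := @R_tot 0 z; first by rewrite linear0; exact: van0.
  by have := R_lin (-1) h h; rewrite !scaleN1r !addNr.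
elim: l f f' => [|x l IH] f f' /= => [//|[h /IH h']].
by have := R_lin (-1) h' h; rewrite !scaleN1r ![- _ + _]addrC.
Qed.

(** The zigzag ends at bidegree (n + 1, 0), where only germs of cocycles of degree 0 enter. Hence
    two complexes with the same local kernels have the same cohomology, and no map between their
    higher terms is needed. *)
Lemma compatible_degree0 n :
  subquotient_iso (@zz _ _ F n.+1 0) (if n is _.+1 then @bcob _ _ F n.+1 0 else @bdif _ _ F 1 0)
    (@zz _ _ F' n.+1 0) (if n is _.+1 then @bcob _ _ F' n.+1 0 else @bdif _ _ F' 1 0).
Proof.
pose RR m f f' := germ m (fun l => R (f l) (f' l)).
have RRc m f f' : RR m f f' -> RR m.+1 (cob f) (cob f').
  by move=> /germ_faces; apply: germ_imp => l z _; exact: R_cob.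
have RRn m f f' : RR m f f' -> null m f <-> null m f'.
  by move=> h; split; apply: (germ_imp2 _ h) => l z _ /R_van[].
have RRB m f f' g g' : RR m f f' -> RR m g g' ->
    RR m (fun l => f l - g l) (fun l => f' l - g' l).
  apply: germ_imp2 => l z _ h1 h2; have := R_lin (-1) h2 h1.
  by rewrite !scaleN1r ![- _ + _]addrC.
have tot m f : null m.+1 (fun l => dif (f l)) -> exists f',
    null m.+1 (fun l => dif (f' l)) /\ RR m.+1 f f'.
  move=> /(germ_choice (0 : term F' 0) (Q' := fun l s' x => van (dif s') x /\ R (f l) s' x)).
  case=> [l x /R_tot[s' [h1 h2]]|f' h].
    by exists s'; have := van_open h1; apply: filterS2 (R_open h2).
  by exists f'; split; apply: germ_imp h => l z _ [].
have surj m f' : null m.+1 (fun l => dif (f' l)) -> exists f,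
    null m.+1 (fun l => dif (f l)) /\ RR m.+1 f f'.
  move=> /(germ_choice (0 : term F 0) (Q' := fun l s x => van (dif s) x /\ R s (f' l) x)).
  case=> [l x /R_surj[s [h1 h2]]|f h].
    by exists s; have := van_open h1; apply: filterS2 (R_open h2).
  by exists f; split; apply: germ_imp h => l z _ [].
exists (fun f f' => [/\ zz n.+1 f, zz n.+1 f' & RR n.+1 f f']); split.
- move=> a f f' g g' [[zf1 zf2] [zf1' zf2'] ff] [[zg1 zg2] [zg1' zg2'] gg]; split.
  + by split; [apply: germ_imp2 zf1 zg1 | apply: germ_imp2 zf2 zg2] => l z _;
      rewrite ?linearP ?cob_lin; exact: van_lin.
  + by split; [apply: germ_imp2 zf1' zg1' | apply: germ_imp2 zf2' zg2'] => l z _;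
      rewrite ?linearP ?cob_lin; exact: van_lin.
  + by apply: germ_imp2 ff gg => l z _; exact: R_lin.
- by move=> f f' [].
- move=> f [df cf]; have [f' [df' ff]] := tot _ _ df; exists f'; split=> //; split=> //.
  by apply/(RRn _ _ _ (RRc _ _ _ ff)).
- move=> f' [df cf]; have [f [df' ff]] := surj _ _ df; exists f; split=> //; split=> //.
  by apply/(RRn _ _ _ (RRc _ _ _ ff)).
- move=> f f' [zf zf' ff]; case: n ff {zf zf'} => [|n] ff; first exact: RRn.
  split=> [[b [db fb]]|[b' [db fb]]].
    have [b' [db' bb]] := tot _ _ db; exists b'; split=> //.
    by apply/(RRn _ _ _ (RRB _ _ _ _ _ ff (RRc _ _ _ bb))).
  have [b [db' bb]] := surj _ _ db; exists b; split=> //.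
  by apply/(RRn _ _ _ (RRB _ _ _ _ _ ff (RRc _ _ _ bb))).
Qed.

Lemma compatible_iso n : subquotient_iso (@global_cocycle _ _ F n) (@global_coboundary _ _ F n)
  (@global_cocycle _ _ F' n) (@global_coboundary _ _ F' n).
Proof.
apply: subquotient_iso_trans (zigzag n) _.
apply: subquotient_iso_trans (compatible_degree0 n) _.
exact/subquotient_iso_sym/zigzag.
Qed.
End compatible.

(** * Products of stalks and injective sheaves *)

Section product_module.
Context {k : nzRingType} {I : Type} (M : I -> lmodType k).

Definition product_module : Type := forall i, M i.

HB.instance Definition _ := gen_eqMixin product_module.
HB.instance Definition _ := gen_choiceMixin product_module.

Implicit Types f g h : product_module.

Let addm f g : product_module := fun i => f i + g i.
Let oppm f : product_module := fun i => - f i.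
Let zerom : product_module := fun i => 0.
Let scalem (a : k) f : product_module := fun i => a *: f i.

Let addmA : associative addm.
Proof. by move=> f g h; apply: functional_extensionality_dep => i; exact: addrA. Qed.
Let addmC : commutative addm.
Proof. by move=> f g; apply: functional_extensionality_dep => i; exact: addrC. Qed.
Let add0m : left_id zerom addm.
Proof. by move=> f; apply: functional_extensionality_dep => i; exact: add0r. Qed.
Let addNm : left_inverse zerom oppm addm.
Proof. by move=> f; apply: functional_extensionality_dep => i; exact: addNr. Qed.

HB.instance Definition _ := GRing.isZmodule.Build product_module addmA addmC add0m addNm.

Let scalemA (a b : k) f : scalem a (scalem b f) = scalem (a * b) f.
Proof. by apply: functional_extensionality_dep => i; exact: scalerA. Qed.
Let scale1m : left_id 1 scalem.
Proof. by move=> f; apply: functional_extensionality_dep => i; exact: scale1r. Qed.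
Let scalemDr : right_distributive scalem +%R.
Proof. by move=> a f g; apply: functional_extensionality_dep => i; exact: scalerDr. Qed.
Let scalemDl f : {morph scalem^~ f : a b / a + b}.
Proof. by move=> a b; apply: functional_extensionality_dep => i; exact: scalerDl. Qed.

HB.instance Definition _ := GRing.Zmodule_isLmodule.Build k product_module
  scalemA scale1m scalemDr scalemDl.
End product_module.

Section quotient_projection.
Context {k : nzRingType} {V : lmodType k} (S : submodule V).

Definition quot_pi (x : V) : quot_module S := (\pi_(Quotient.quot (submod_pred S)) x)%qT.

Lemma quot_pi_linear : linear quot_pi.
Proof. by move=> a x y; rewrite /quot_pi quot_piD -quot_scale_pi. Qed.

HB.instance Definition _ := GRing.isLinear.Build k V (quot_module S) _ quot_pi quot_pi_linear.

Lemma quot_pi_eq0 x : quot_pi x = 0 <-> scarrier S x.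
Proof.
rewrite -[0](linear0 quot_pi); split=> [/eqP|Sx].
  by rewrite -quot_eq subr0 => /asboolP.
by apply/eqP; rewrite -quot_eq subr0; apply/asboolP.
Qed.
End quotient_projection.

Section stalk_product.
Context {k : nzRingType} {X : topologicalType} (J : sheaf k X).
Implicit Types (U V W : opens X) (x : X).

(** In place of a direct limit, families over all open sets are divided by those vanishing on all
    open subsets of some neighbourhood of [x]. The quotient may be larger than the usual stalk, but
    sections have the same kernel ([to_stalk_eq0]). *)
Definition germ_module : lmodType k := product_module (fun W => sec J W).

Program Definition germ_null x : submodule germ_module :=
  @Submodule k germ_module [set w : germ_module | exists2 V : opens X, oset V x &
    forall W, W `<=` V -> w W = 0] _ _.
Next Obligation. by move=> x; exists (@topens X). Qed.
Next Obligation.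
move=> x a w w' [V Vx wV] [V' V'x wV'].
exists (Opens (openI (opensP V) (opensP V'))) => //= W WV.
have -> : (a *: w + w') W = a *: w W + w' W by [].
by rewrite wV ?wV' ?scaler0 ?addr0// => y /WV[].
Qed.

Definition stalk x : lmodType k := quot_module (germ_null x).

Definition stalks : lmodType k := product_module stalk.

Program Definition stalks_on U : submodule stalks :=
  @Submodule k stalks [set f : stalks | forall x, ~ oset U x -> f x = 0] _ _.
Next Obligation. by []. Qed.
Next Obligation.
move=> U a f g f0 g0 x nU; have -> : (a *: f + g) x = a *: f x + g x by [].
by rewrite f0// g0// scaler0 addr0.
Qed.

Definition cut V (f : stalks) : stalks := fun x => if `[< oset V x >] then f x else 0.

Lemma cutE V f x : oset V x -> cut V f x = f x.
Proof. by move=> Vx; rewrite /cut asboolT. Qed.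

Lemma cutN V f x : ~ oset V x -> cut V f x = 0.
Proof. by move=> Vx; rewrite /cut asboolF. Qed.

Lemma cut_subproof V f : cut V f \in submod_pred (stalks_on V).
Proof. by apply/asboolP => x; exact: cutN. Qed.

Definition stalk_res V U (f : submod_type (stalks_on U)) : submod_type (stalks_on V) :=
  Sub (cut V (val f)) (cut_subproof V (val f)).

Lemma stalk_res_linear V U : linear (@stalk_res V U).
Proof.
move=> a f g; apply: val_inj; apply: functional_extensionality_dep => x.
change (cut V (a *: val f + val g) x = a *: cut V (val f) x + cut V (val g) x).
have [Vx|nVx] := pselect (oset V x); first by rewrite !cutE.
by rewrite !cutN// scaler0 addr0.
Qed.

HB.instance Definition _ V U := GRing.isLinear.Build k _ _ _ (@stalk_res V U) (@stalk_res_linear V U).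

Lemma stalk_ext U (f g : submod_type (stalks_on U)) :
  (forall x, oset U x -> val f x = val g x) -> f = g.
Proof.
move=> fg; apply: val_inj; apply: functional_extensionality_dep => x.
have [/fg //|nU] := pselect (oset U x).
have /asboolP f0 := valP f; have /asboolP g0 := valP g.
exact: etrans (f0 x nU) (esym (g0 x nU)).
Qed.

Lemma stalk_resE V U (f : submod_type (stalks_on U)) x : oset V x -> val (stalk_res V f) x = val f x.
Proof. exact: cutE. Qed.

Lemma stalk_res_id U (h : U `<=` U) (s : submod_type (stalks_on U)) : stalk_res U s = s.
Proof. by apply: stalk_ext => x Ux; rewrite stalk_resE. Qed.

Lemma stalk_res_comp U V W (hVU : V `<=` U) (hWV : W `<=` V) (hWU : W `<=` U)
  (s : submod_type (stalks_on U)) : stalk_res W (stalk_res V s) = stalk_res W s.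
Proof. by apply: stalk_ext => x Wx; rewrite !stalk_resE//; exact: hWV. Qed.

Lemma stalk_sep U (I : Type) (V : I -> opens X) (hV : forall i, V i `<=` U) :
  U `<=` \bigcup_i V i -> forall s t : submod_type (stalks_on U),
  (forall i, stalk_res (V i) s = stalk_res (V i) t) -> s = t.
Proof.
move=> UV s t st; apply: stalk_ext => x /UV[i _ Vix].
by rewrite -(stalk_resE s Vix) st stalk_resE.
Qed.

Lemma stalk_glue U (I : Type) (V : I -> opens X) (hV : forall i, V i `<=` U) :
  U `<=` \bigcup_i V i -> forall s : forall i, submod_type (stalks_on (V i)),
  (forall i j W (hi : W `<=` V i) (hj : W `<=` V j), stalk_res W (s i) = stalk_res W (s j)) ->
  exists t : submod_type (stalks_on U), forall i, stalk_res (V i) t = s i.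
Proof.
move=> UV s sij.
pose t : stalks := fun x => if pselect (exists i, oset (V i) x) is left h then val (s (projT1 (cid h))) x else 0.
have tP : t \in submod_pred (stalks_on U).
  apply/asboolP => x nU; rewrite /t; case: pselect => // -[i Vix].
  by case: nU; exact: hV Vix.
exists (Sub t tP) => i; apply: stalk_ext => x Vix; rewrite stalk_resE//= /t.
case: pselect => [h|[]]; last by exists i.
case: cid => j Vjx /=.
have := sij i j (Opens (openI (opensP (V i)) (opensP (V j)))) (@subIsetl _ _ _) (@subIsetr _ _ _).
by move=> /(congr1 (fun f => val f x)); rewrite !stalk_resE.
Qed.

Definition stalk_sheaf : sheaf k X :=
  @Sheaf k X (fun U => submod_type (stalks_on U)) (fun U V h => @stalk_res V U)
    stalk_res_id stalk_res_comp stalk_sep stalk_glue.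

Definition germ_res U (s : sec J U) : germ_module := fun W =>
  if pselect (W `<=` U) is left h then res h s else 0.

Lemma germ_resE U (s : sec J U) W (h : W `<=` U) : germ_res s W = res h s.
Proof. by rewrite /germ_res; case: pselect => // h'; rewrite (Prop_irrelevance h' h). Qed.

Lemma germ_res_linear U : linear (@germ_res U).
Proof.
move=> a s t; apply: functional_extensionality_dep => W.
change (germ_res (a *: s + t) W = a *: germ_res s W + germ_res t W).
rewrite /germ_res; case: pselect => h; first by rewrite linearP.
by rewrite scaler0 addr0.
Qed.

Definition to_stalk U x (s : sec J U) : stalk x := quot_pi (germ_null x) (germ_res s).

Lemma to_stalk_linear U x : linear (@to_stalk U x).
Proof. by move=> a s t; rewrite /to_stalk germ_res_linear linearP. Qed.

Lemma to_stalk_eq0 U x (s : sec J U) : oset U x -> to_stalk x s = 0 <->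
  exists (W : opens X) (h : W `<=` U), oset W x /\ res h s = 0.
Proof.
move=> Ux; rewrite /to_stalk quot_pi_eq0; split=> [[V Vx sV]|[W [h [Wx sW]]]].
  pose W := Opens (openI (opensP U) (opensP V)).
  have h : W `<=` U by move=> y [].
  exists W, h; split=> //; rewrite -germ_resE; apply: sV => y [] //.
exists W => // W' W'W; have h' : W' `<=` U := subset_trans W'W h.
by rewrite germ_resE -(res_comp h W'W h') sW linear0.
Qed.

Lemma to_stalk_res U V x (h : V `<=` U) (s : sec J U) : oset V x ->
  to_stalk x (res h s) = to_stalk x s.
Proof.
move=> Vx; apply/eqP; rewrite -subr_eq0; apply/eqP.
rewrite /to_stalk -linearB; apply/quot_pi_eq0; exists V => // W WV.
have hW : W `<=` U by apply: subset_trans h.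
change (germ_res (res h s) W - germ_res s W = 0).
by rewrite !germ_resE res_comp subrr.
Qed.

Definition stalk_emb_fun U (s : sec J U) : submod_type (stalks_on U) := 
  Sub (cut U (fun x => to_stalk x s)) (cut_subproof U (fun x => to_stalk x s)).

Lemma stalk_emb_linear U : linear (@stalk_emb_fun U).
Proof.
move=> a s t; apply: stalk_ext => x Ux.
change (cut U (fun x => to_stalk x (a *: s + t)) x =
  a *: cut U (fun x => to_stalk x s) x + cut U (fun x => to_stalk x t) x).
by rewrite !cutE// to_stalk_linear.
Qed.

HB.instance Definition _ U := GRing.isLinear.Build k _ _ _ (@stalk_emb_fun U) (@stalk_emb_linear U).

Lemma stalk_emb_res U V (h : V `<=` U) s :
  stalk_emb_fun (res h s) = stalk_res V (stalk_emb_fun s).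
Proof.
apply: stalk_ext => x Vx; rewrite stalk_resE//= !cutE//; last exact: h.
exact: to_stalk_res.
Qed.

Definition stalk_emb : sheaf_mor J stalk_sheaf := @SheafMor k X J stalk_sheaf
  (fun U => @stalk_emb_fun U) stalk_emb_res.

Lemma stalk_emb_mono : sheaf_mono stalk_emb.
Proof.
move=> U; apply: raddf_inj => s s0.
have cov x : oset U x -> exists (W : opens X) (h : W `<=` U), oset W x /\ res h s = 0.
  move=> Ux; apply/to_stalk_eq0 => //.
  by have := congr1 (fun f => val f x) s0; rewrite /= cutE.
pose I := {W : opens X | exists h : W `<=` U, res h s = 0}.
apply: (@sheaf_sep _ _ J U I (fun i => sval i) (fun i => projT1 (cid (svalP i)))) => [x /cov[W [h [Wx e]]]|i].
  by exists (exist _ W (ex_intro _ h e)).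
by case: cid => h /= ->; rewrite linear0.
Qed.
End stalk_product.

Lemma sub_top (X : topologicalType) (U : opens X) : U `<=` @topens X.
Proof. by []. Qed.
Arguments sub_top {X} U _ _.

Section injective_germs.
Context {k : nzRingType} {X : topologicalType} (J : sheaf k X).
Hypothesis Jinj : injective_sheaf J.
Local Notation top := (@topens X).

(* Injectivity is used only for the embedding into the product of the stalks. *)
Lemma stalk_retraction : exists g : sheaf_mor (stalk_sheaf J) J,
  forall U s, g U (stalk_emb J U s) = s.
Proof.
pose id1 : sheaf_mor J J := @SheafMor k X J J (fun U => idfun) (fun U V h s => erefl).
by have [g gP] := Jinj id1 (@stalk_emb_mono _ _ J); exists g => U s; exact: gP.
Qed.

(** In the product of stalks a section extends by zero; the retraction brings the extension back to
    [J]. *)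
Lemma injective_flasque U (t : sec J U) : exists s : sec J top, res (sub_top U) s = t.
Proof.
have [g gP] := stalk_retraction.
pose f : submod_type (stalks_on J top) := stalk_res top (stalk_emb J U t).
exists (g top f); rewrite -(smor_res g) -[RHS](gP U); congr (g U _).
by apply: stalk_ext => x Ux; rewrite /= !cutE.
Qed.

Definition sec_van (s : sec J top) (x : X) : Prop :=
  exists2 U : opens X, oset U x & res (sub_top U) s = 0.

Lemma sec_van_sub (U V : opens X) (s : sec J top) : V `<=` U ->
  res (sub_top U) s = 0 -> res (sub_top V) s = 0.
Proof. by move=> VU e; rewrite -(res_comp (sub_top U) VU) e linear0. Qed.

Lemma sec_van_lin (a : k) s t x : sec_van s x -> sec_van t x -> sec_van (a *: s + t) x.
Proof.
move=> [U Ux sU] [V Vx tV]; exists (Opens (openI (opensP U) (opensP V))) => //.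
by rewrite linearP (sec_van_sub _ sU) ?(sec_van_sub _ tV) ?scaler0 ?addr0// => y [].
Qed.

Lemma sec_van_open s x : sec_van s x -> \forall y \near x, sec_van s y.
Proof.
move=> [U Ux sU]; have : nbhs x U by apply: open_nbhs_nbhs; split => //; exact: opensP.
by apply: filterS => y Uy; exists U.
Qed.

Lemma sec_van_eq0 s : (forall x, sec_van s x) -> s = 0.
Proof.
move=> s0; pose I := {U : opens X | res (sub_top U) s = 0}.
apply: (@sheaf_sep _ _ J top I (fun i => sval i) (fun i => sub_top _)) => [x _|i].
  by have [U Ux sU] := s0 x; exists (exist _ U sU).
by rewrite linear0; exact: svalP i.
Qed.

(** The germs of the sections [G x], each taken at its own point [x], form one section of the
    product of stalks, which the retraction maps back to [J]. *)
Lemma sec_retract : exists r : {linear (X -> sec J top) -> sec J top},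
  (forall s x, sec_van (r (fun=> s) - s) x) /\
  (forall (G : X -> sec J top) x, (\forall y \near x, sec_van (G y) y) -> sec_van (r G) x).
Proof.
have [g gP] := stalk_retraction.
have eP (G : X -> sec J top) : (fun x => to_stalk x (G x) : stalk J x) \in submod_pred (stalks_on J top).
  by apply/asboolP => x [].
pose e G : submod_type (stalks_on J top) := Sub (fun x => to_stalk x (G x)) (eP G).
have re : linear (fun G => g top (e G)).
  move=> a G H; rewrite -linearP; congr (g top _); apply: stalk_ext => x _.
  exact: to_stalk_linear.
pose r : {linear (X -> sec J top) -> sec J top} := HB.pack (fun G => g top (e G)) (GRing.isLinear.Build _ _ _ _ _ re).
exists r; split=> [s x|G x].
  have -> : r (fun=> s) = s; last by rewrite subrr; exists top => //; rewrite linear0.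
  rewrite -[RHS](gP top); congr (g top _); apply: stalk_ext => y _.
  by rewrite /= cutE.
move=> h; have : nbhs x [set y | sec_van (G y) y] by exact: h.
rewrite nbhsE => -[U [oU Ux] UG]; exists (Opens oU) => //.
rewrite -[r G]/(g top (e G)) -(smor_res g) -[RHS](linear0 (g (Opens oU))); congr (g _ _).
apply: stalk_ext => y Uy; rewrite /= cutE//; apply/to_stalk_eq0 => //.
by have [W Wy GW] := UG y Uy; exists W, (sub_top W).
Qed.
End injective_germs.

Section resolution_germs.
Context {k : nzRingType} {X : topologicalType} {F : sheaf k X}.
Variable J : injective_resolution F.
Local Notation top := (@topens X).

Program Definition resolution_germs : germ_complex k X := @GermComplex k X
  (fun q => sec (ires J q) top) (fun q => idiff J q top) (fun q => @sec_van k X (ires J q))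
  (fun q => projT1 (cid (sec_retract (@ires_inj _ _ _ J q))))
  _ _ (fun q => @sec_van_lin _ _ _) (fun q => @sec_van_open _ _ _) _ _ _ _.
Next Obligation. by move=> q s; have [+ _] := idiff_exact J q; apply. Qed.
Next Obligation. by move=> q x; exists top => //; rewrite linear0. Qed.
Next Obligation.
by move=> q s x [U Ux sU]; exists U => //; rewrite -smor_res sU linear0.
Qed.
Next Obligation.
move=> q s x [U Ux]; rewrite -smor_res => sU; have [_ h] := idiff_exact J q.
have [V [VU [Vx [t tV]]]] := h U _ sU x Ux.
have [T Tt] := injective_flasque (@ires_inj _ _ _ J q) t.
exists T; exists V => //; rewrite linearB -smor_res Tt tV.
by rewrite -(res_comp (sub_top U) VU) subrr.
Qed.
Next Obligation. by move=> q; exact: (projT2 (cid (sec_retract (ires_inj (p := q))))).1. Qed.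
Next Obligation. by move=> q; exact: (projT2 (cid (sec_retract (ires_inj (p := q))))).2. Qed.

Lemma resolution_cohomology n :
  subquotient_iso (scarrier (cocycles (global_sections J) n)) (@is_coboundary _ (global_sections J) n)
    (@global_cocycle _ _ resolution_germs n) (@global_coboundary _ _ resolution_germs n).
Proof.
have van0P q (s : sec (ires J q) top) : (forall x, sec_van s x) <-> s = 0.
  split=> [|->]; first exact: sec_van_eq0.
  by move=> x; exists top => //; rewrite linear0.
exists (fun s t => s = t /\ idiff J n top s = 0); split.
- by move=> a s s' t t' [-> ds] [-> dt]; split=> //; rewrite linearP ds dt scaler0 addr0.
- by move=> s _ [<- ds]; split=> //; apply/van0P.
- by move=> s [_ ds]; exists s.
- by move=> s /van0P ds; exists s.
- move=> s _ [<- _]; case: n s => [|n] s; first by split=> /van0P.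
  split=> [[t _ ->]|[t /van0P st]]; first by exists t; apply/van0P; rewrite subrr.
  by exists t => //; apply/eqP; rewrite -subr_eq0; apply/eqP.
Qed.
End resolution_germs.

Lemma near_open (T : topologicalType) (x : T) (P : T -> Prop) :
  (\forall y \near x, P y) -> exists U, [/\ open U, U x & forall y, U y -> P y].
Proof.
move=> h; have : nbhs x [set y | P y] by exact: h.
by rewrite nbhsE => -[U [oU Ux] UP]; exists U.
Qed.

Lemma quot_proj_open (T : topologicalType) (S : Type) (f : T -> S) (U : set (quot_space f)) :
  open U <-> open (@quot_proj T S f @^-1` U).
Proof. by []. Qed.

Lemma quot_proj_continuous (T : topologicalType) (S : Type) (f : T -> S) : continuous (@quot_proj T S f).
Proof. exact: pi_continuous. Qed.

Lemma quot_proj_surj (T : topologicalType) (S : Type) (f : T -> S) (x : quot_space f) :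
  exists y, quot_proj f y = x.
Proof. by exists (repr x); exact: reprK. Qed.

(** * Equivariant cochains over the orbit space *)

Section orbit_space_germs.
Context {D : topologicalType} {G : Type} {act : G -> D -> D} {Gam : set G}.
Context {one : G} {mul : G -> G -> G} {inv : G -> G}.
Hypothesis ga : action act Gam one mul inv.
Context {D0 : set D}.
Hypothesis D0g : forall g x, Gam g -> D0 x -> D0 (act g x).
Hypothesis slice : forall x, D0 x -> exists2 W, nbhs x W &
  forall g y, Gam g -> W y -> W (act g y) -> act g x = x.
Context {k : nzRingType} {E : lmodType k} (rho : G -> {linear E -> E}).
Hypothesis rho1 : forall v, rho one v = v.
Hypothesis rhoM : forall g h v, Gam g -> Gam h -> rho (mul g h) v = rho g (rho h v).
Hypothesis mulV : forall g, Gam g -> mul g (inv g) = one.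
Hypothesis mulVg : forall g, Gam g -> mul (inv g) g = one.
Local Notation X := (orbit_space act Gam D0).
Local Notation proj := (@orbit_proj D G act Gam D0).
Local Notation equivariant := (equivariant (act := act) (Gam := Gam) rho).
Implicit Types (x : X) (y : set_type D0) (f : seq D -> E).

Definition pt z (h : D0 z) : set_type D0 := SigSub (mem_set h).

Lemma proj_orbit y y' : proj y = proj y' -> exists2 g, Gam g & val y' = act g (val y).
Proof.
move/quot_projP => e.
have : Defs.orbit act Gam y y' by rewrite e; exact: Relation_Operators.rst_refl.
elim=> {y y' e} [y y' //|y|y y' _ [g Gg e]|y y' y'' _ [g Gg e] _ [h Gh e']].
- by exists one; [exact: act_one ga | rewrite (act1 ga)].
- by exists (inv g); [exact: act_inv ga _ Gg | rewrite e (actK ga)].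
- by exists (mul h g); [exact: act_mul ga _ _ Gh Gg | rewrite e' e (actM ga)].
Qed.

Lemma proj_act g y (h : D0 (act g (val y))) : Gam g -> proj (pt h) = proj y.
Proof. by move=> Gg; apply/esym/orbit_proj_step; exists g. Qed.

Lemma proj_surj x : exists y, proj y = x.
Proof. exact: quot_proj_surj. Qed.

(** The projection is open: the preimage of the image of an open set is the union of its
    translates. *)
Lemma proj_near (P : D -> Prop) y : (\forall z \near val y, D0 z -> P z) ->
  \forall x \near proj y, exists2 y', proj y' = x & P (val y').
Proof.
move=> /near_open[U [oU Uy UP]].
pose V : set X := [set x | exists2 y', proj y' = x & U (val y')].
have oV : open V.
  apply/quot_proj_open.
  have -> : proj @^-1` V = \bigcup_(g in Gam) [set y' | U (act g (val y'))].
    apply/seteqP; split=> y1 /=.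
      by move=> [y2 /esym /proj_orbit[g Gg ->] Uy2]; exists g.
    move=> [g Gg Uy1]; have h := D0g Gg (set_valP y1).
    by exists (pt h) => //; exact: proj_act.
  apply: bigcup_open => g Gg.
  have -> : [set y' : set_type D0 | U (act g (val y'))] = set_val @^-1` (act g @^-1` U) by [].
  by exists (act g @^-1` U) => //; apply: open_comp => // z _; exact: act_continuous ga _ Gg z.
have Vy : V (proj y) by exists y.
apply: filterS (open_nbhs_nbhs (conj oV Vy)) => x [y' <- Uy'].
by exists y' => //; apply: UP => //; exact: set_valP.
Qed.

Definition orbit_van q f x : Prop :=
  forall y, proj y = x -> evx D0 q.+1 (fun l => f l = 0) (val y).

Lemma orbit_vanP q f y : equivariant f ->
  evx D0 q.+1 (fun l => f l = 0) (val y) -> orbit_van q f (proj y).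
Proof.
move=> ef f0 y' /proj_orbit[g Gg e]; rewrite {}e in f0.
have : evx D0 q.+1 (fun l => f (map (act g) l) = 0) (val y').
  apply: (evx_map (phi := act g) (P := fun l => f l = 0) _ _ _ f0) => [z|z _ U|]; [exact: (D0g Gg)| |exact: set_valP].
  move=> /(act_continuous ga Gg) h.
  by apply: filterS (h : nbhs z (act g @^-1` U)) => w Uw _.
apply: evx_imp => l _ _; rewrite ef// => h.
by rewrite -[f l](rhoK ga rho1 rhoM mulVg _ Gg) h linear0.
Qed.

Lemma orbit_van_singleton q f y : orbit_van q f (proj y) ->
  evx D0 q (fun l => f (val y :: l) = 0) (val y).
Proof. by move=> /(_ y erefl)/nbhs_singleton; apply; exact: set_valP. Qed.

Lemma orbit_van_lin q (a : k) f f' x : orbit_van q f x -> orbit_van q f' x ->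
  orbit_van q (fun l => a *: f l + f' l) x.
Proof.
move=> f0 f'0 y yx; apply: evx_imp2 (f0 y yx) (f'0 y yx) => l _ _ -> ->.
by rewrite scaler0 addr0.
Qed.

Lemma orbit_van_open q f x : equivariant f -> orbit_van q f x ->
  \forall x' \near x, orbit_van q f x'.
Proof.
move=> ef f0; have [y yx] := proj_surj x.
have /evx_near h := f0 y yx.
rewrite -yx; apply: filterS (@proj_near (fun z => evx D0 q.+1 (fun l => f l = 0) z) y _).
  by move=> x' [y' <-]; exact: orbit_vanP.
by apply: filterS h => z h _.
Qed.

Lemma orbit_van_cob q f x : orbit_van q f x -> orbit_van q.+1 (cob f) x.
Proof.
move=> f0 y /f0/evx_faces; apply: evx_imp => l _ _ h.
by rewrite (@faces_cob _ _ f (fun=> 0))// cob0.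
Qed.

(* The cone with apex [y] is a primitive near [y]; the slice makes its
   equivariant extension well defined. *)
Lemma orbit_exact q f x : equivariant f -> orbit_van q.+2 (cob f) x ->
  exists2 t : seq D -> E, equivariant t & orbit_van q.+1 (fun l => f l - cob t l) x.
Proof.
move=> ef; have [y yx] := proj_surj x; rewrite -yx => f0.
have D0y := set_valP y; have [W0 W0y Ws] := slice D0y.
have [W [oW Wy WW]] : exists U, [/\ open U, U (val y) & forall z, U z -> W0 z] by exact: near_open.
(* [t] is the cone over [val y] for lists starting in the slice, carried to all their translates and
   zero elsewhere. Two ways of translating a list differ by an element that moves a point of [W]
   within [W], and so fixes [val y]. *)
pose moves l (c : G * seq D) := [/\ Gam c.1, l = map (act c.1) c.2 & if c.2 is z :: _ then W z else False].
pose t l := if pselect (exists c, moves l c) is left h then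
    rho (projT1 (cid h)).1 (f (val y :: (projT1 (cid h)).2)) else 0.
have tE l g l' : moves l (g, l') -> t l = rho g (f (val y :: l')).
  move=> ml; rewrite /t; case: pselect => [h|[]]; last by exists (g, l').
  case: cid => -[g2 l2] [/= G2 e2 W2]; case: ml => /= Gg e1 W1.
  have Gi := act_inv ga G2; have Gk := act_mul ga Gi Gg.
  have e : l2 = map (act (mul (inv g2) g)) l'.
    rewrite -[LHS](mapK (actK ga G2)) -e2 e1 -map_comp; apply: eq_map => w /=.
    by rewrite (actM ga).
  have fy : act (mul (inv g2) g) (val y) = val y.
    move: e W1 W2; case: l' {e1} => // w l' ->/= /WW W1 /WW W2; exact: Ws Gk W1 W2.
  have -> : val y :: l2 = map (act (mul (inv g2) g)) (val y :: l') by rewrite /= fy -e.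
  by rewrite ef// rhoM// (rhoVK ga rho1 rhoM mulV).
have moves_act g l h l' : Gam g -> moves l (h, l') -> moves (map (act g) l) (mul g h, l').
  move=> Gg [/= Gh -> Wl]; split=> //=; first exact: act_mul ga _ _ Gg Gh.
  by rewrite -map_comp; apply: eq_map => w /=; rewrite (actM ga).
have et : equivariant t.
  move=> g Gg l; have [[[h l'] ml]|nm] := pselect (exists c, moves l c).
    have [/= Gh _ _] := ml.
    by rewrite (tE _ _ _ ml) (tE _ _ _ (moves_act _ _ _ _ Gg ml)) rhoM.
  have nm' : ~ exists c, moves (map (act g) l) c.
    move=> [[h l'] /(moves_act _ _ _ _ (act_inv ga Gg))]; rewrite (mapK (actK ga Gg)) => m.
    by apply: nm; exists (mul (inv g) h, l').
  by rewrite /t; case: pselect => // _; case: pselect => // _; rewrite linear0.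
exists t => //; apply: orbit_vanP.
  exact/equivariantB/equivariant_cob.
have h0 := orbit_van_singleton f0.
have st : evx D0 q.+2 (lall W) (val y).
  apply: evx_stay => // z _ Wz.
  by have : nbhs z W by [exact: open_nbhs_nbhs]; apply: filterS => w Ww _.
apply: (evx_imp2 _ st h0) => l ls _ Wl /eqP.
rewrite /= subr_eq0 => /eqP ->; apply/eqP; rewrite subr_eq0; apply/eqP.
apply: faces_cob; apply: (@faces_lall _ W) Wl => l' ls' Wl'.
rewrite ls /= in ls'; case: l' ls' Wl' => // w l' _ [Ww _].
rewrite (tE _ one (w :: l')) ?rho1//; split => //=; first exact: act_one ga.
by rewrite (act1 ga); congr (_ :: _); rewrite -[LHS]map_id; apply: eq_map => u; rewrite (act1 ga).
Qed.

Definition orbit_term : submodule (seq D -> E) := @Submodule k (seq D -> E) [set f | equivariant f]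
  (@equivariant0 D G act Gam k E rho)
  (fun a f f' => @equivariant_lin D G act Gam k E rho a f f').

Lemma orbit_termP (f : submod_type orbit_term) : equivariant (val f).
Proof. exact/asboolP/(valP f). Qed.

Definition orbit_mk f (ef : equivariant f) : submod_type orbit_term := Sub f (asboolT ef).

Definition orbit_cob (f : submod_type orbit_term) : submod_type orbit_term :=
  orbit_mk (equivariant_cob (orbit_termP f)).

Lemma orbit_cob_linear : linear orbit_cob.
Proof. by move=> a f f'; apply: val_inj; apply/funext => l; exact: cob_lin. Qed.

HB.instance Definition _ := GRing.isLinear.Build k _ _ _ orbit_cob orbit_cob_linear.

(** The section is chosen by the orbit of the first point, which translation does not change; hence
    equivariance is preserved. *)
Definition spread (s : X -> seq D -> E) l : E :=
  if l is z :: _ then if pselect (D0 z) is left h then s (proj (pt h)) l else 0 else 0.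

Lemma spreadE s y l : spread s (val y :: l) = s (proj y) (val y :: l).
Proof.
rewrite /spread; case: pselect => [h|[]]; last exact: set_valP.
by rewrite (_ : pt h = y)//; exact: val_inj.
Qed.

Lemma spread_equivariant s : (forall x, equivariant (s x)) -> equivariant (spread s).
Proof.
move=> es g Gg [|z l]; first by rewrite linear0.
rewrite /=; case: pselect => h; case: pselect => h'; rewrite ?linear0//.
- by rewrite (@proj_act g (pt h'))// (es _ g Gg (z :: l)).
- by case: h'; rewrite -(actK ga Gg z); apply: D0g => //; exact: (act_inv ga Gg).
- by case: h; exact: D0g.
Qed.

Definition orbit_retr (s : X -> submod_type orbit_term) : submod_type orbit_term :=
  orbit_mk (spread_equivariant (fun x => orbit_termP (s x))).

Lemma orbit_retr_linear : linear orbit_retr.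
Proof.
move=> a s s'; apply: val_inj; apply/funext => -[|z l].
  by change (0 = a *: 0 + 0 :> E); rewrite scaler0 addr0.
have [D0z|nz] := pselect (D0 z).
  change (spread (fun x => val ((a *: s + s') x)) (val (pt D0z) :: l) =
    a *: spread (fun x => val (s x)) (val (pt D0z) :: l) + spread (fun x => val (s' x)) (val (pt D0z) :: l)).
  by rewrite !spreadE.
change (spread (fun x => val ((a *: s + s') x)) (z :: l) =
    a *: spread (fun x => val (s x)) (z :: l) + spread (fun x => val (s' x)) (z :: l)).
by rewrite /spread; case: pselect => // _; rewrite scaler0 addr0.
Qed.

HB.instance Definition _ := GRing.isLinear.Build k _ _ _ orbit_retr orbit_retr_linear.

(** All terms are the same module of functions of lists; the degree enters only through the length
    of lists in [orbit_van]. *)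
Program Definition orbit_germs : germ_complex k X := @GermComplex k X
  (fun q => submod_type orbit_term) (fun q => orbit_cob) (fun q (f : submod_type orbit_term) => orbit_van q (val f))
  (fun q => orbit_retr) _ _ _ _ _ _ _ _.
Next Obligation. by move=> q f; apply: val_inj; apply/funext => l; exact: cob_cob. Qed.
Next Obligation. by move=> q x y _; apply: evx_all. Qed.
Next Obligation. by move=> q a f f' x; exact: orbit_van_lin. Qed.
Next Obligation. by move=> q f x; apply: orbit_van_open; exact: orbit_termP. Qed.
Next Obligation. by move=> q f x; exact: orbit_van_cob. Qed.
Next Obligation.
move=> q f x /(orbit_exact (orbit_termP f))[t et ft].
by exists (orbit_mk et).
Qed.
Next Obligation.
move=> q f x y yx; rewrite /=; apply: nearW => z D0z; apply: evx_all => l _ _.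
by have := spreadE (fun=> val f) (pt D0z) l; rewrite [X in X -> _]/= => e; apply/eqP; rewrite subr_eq0; apply/eqP.
Qed.
Next Obligation.
move=> q s x h y yx; rewrite -yx in h.
have /quot_proj_continuous := h => /nbhs_set_typeP[W Wy WP].
apply: filterS Wy => z Wz D0z; have := WP (pt D0z) Wz => /orbit_van_singleton.
by apply: evx_imp => l _ _ <-; exact: (spreadE _ (pt D0z)).
Qed.

Lemma orbit_cohomology n :
  subquotient_iso (@global_cocycle _ _ orbit_germs n) (@global_coboundary _ _ orbit_germs n)
    (equivariant_cocycle (act := act) (Gam := Gam) (D0 := D0) rho n)
    (equivariant_coboundary (act := act) (Gam := Gam) (D0 := D0) rho n).
Proof.
have vanP q f : (forall x, orbit_van q f x) <-> ev D0 q.+1 (fun l => f l = 0).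
  split=> [f0 z D0z|f0 x y _]; last exact: ev_evx.
  exact: (orbit_van_singleton (f0 (proj (pt D0z)))).
exists (fun (f : submod_type orbit_term) f' => [/\ val f = f', equivariant f' & ev D0 n.+2 (fun l => cob f' l = 0)]); split.
- move=> a f f' g g' [ff' ef' df'] [gg' eg' dg']; split.
  + by rewrite -ff' -gg'.
  + exact: equivariant_lin.
  + by apply: (ev_imp2 _ df' dg') => l _ _; rewrite cob_lin => -> ->; rewrite scaler0 addr0.
- by move=> f _ [<- ef df]; split=> //; apply/vanP.
- by move=> f /vanP df; exists (val f); split=> //; exact: orbit_termP.
- by move=> f [ef df]; exists (orbit_mk ef).
- move=> f _ [<- ef df]; case: n f ef df => [|n] f ef df; first exact: (vanP 0 _).
  split=> [[t /vanP ft]|[t et ft]].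
    exists (val t); first exact: orbit_termP.
    by apply: ev_imp ft => l _ _ /eqP; rewrite subr_eq0 => /eqP.
  exists (orbit_mk et); apply/vanP; apply: ev_imp ft => l _ _ e.
  by apply/eqP; rewrite subr_eq0; apply/eqP.
Qed.

Local Notation F := (equivariant_sheaf act Gam D0 rho).
Variable J : injective_resolution F.
Local Notation top := (@topens X).
Implicit Types (U V : opens X) (r : sec (ires J 0) top) (h : submod_type orbit_term).

(** Both kernels in degree 0 are locally the sheaf itself: [r] comes from the section [e] by the
    augmentation, and [h] equals [e] on one-point lists. *)
Definition same_germ r h x : Prop := exists U (e : submod_type (eq_sections rho U)),
  [/\ oset U x, iaug J U e = res (sub_top U) r &
   forall y : set_type (Defs.over U), val h [:: val (val y)] = val e y].

Lemma same_germ_sub r h x U V (e : submod_type (eq_sections rho U)) (VU : V `<=` U) :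
  iaug J U e = res (sub_top U) r ->
  (forall y : set_type (Defs.over U), val h [:: val (val y)] = val e y) ->
  iaug J V (restr VU e) = res (sub_top V) r /\
  (forall y : set_type (Defs.over V), val h [:: val (val y)] = val (restr VU e) y).
Proof.
move=> e1 e2; split; last by move=> y; exact: (e2 (over_incl VU y)).
by rewrite (smor_res (iaug J) VU e) e1; exact: res_comp.
Qed.

Lemma same_germ_lin (a : k) r h r' h' x : same_germ r h x -> same_germ r' h' x ->
  same_germ (a *: r + r') (a *: h + h') x.
Proof.
move=> [U [e [Ux e1 e2]]] [V [e' [Vx e1' e2']]].
pose W := Opens (openI (opensP U) (opensP V)).
have WU : W `<=` U by move=> z [].
have WV : W `<=` V by move=> z [].
have [d1 d2] := same_germ_sub x WU e1 e2; have [d1' d2'] := same_germ_sub x WV e1' e2'.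
exists W, (a *: restr WU e + restr WV e'); split=> //.
  by rewrite !linearP d1 d1'.
move=> y; change (a *: val h [:: val (val y)] + val h' [:: val (val y)] =
  a *: val (restr WU e) y + val (restr WV e') y).
by rewrite d2 d2'.
Qed.

Lemma same_germ_open r h x : same_germ r h x -> \forall x' \near x, same_germ r h x'.
Proof.
move=> [U [e [Ux e1 e2]]].
have : nbhs x U by apply: open_nbhs_nbhs; split=> //; exact: opensP.
by apply: filterS => x' Ux'; exists U, e.
Qed.

Lemma orbit_van0P f y : orbit_van 0 f (proj y) -> f [:: val y] = 0.
Proof. exact: orbit_van_singleton. Qed.

Lemma same_germ_van r h x : same_germ r h x -> sec_van r x <-> orbit_van 0 (val h) x.
Proof.
move=> [U [e [Ux e1 e2]]]; split=> [[V Vx rV]|h0].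
  pose W := Opens (openI (opensP U) (opensP V)).
  have WU : W `<=` U by move=> z [].
  have [d1 d2] := same_germ_sub x WU e1 e2.
  have e0 : restr WU e = 0.
    apply: (iaug_mono (i := J)); rewrite [LHS]d1 linear0.
    by apply: sec_van_sub rV => z [].
  move=> y yx; have : nbhs y (Defs.over W).
    by apply: open_nbhs_nbhs; split; [exact: over_open|rewrite /Defs.over/= yx].
  move=> /nbhs_set_typeP[O Oy OW]; apply: filterS Oy => z Oz D0z.
  have Wz : Defs.over W (pt D0z) by exact: OW.
  by have := d2 (mk_over Wz); rewrite e0.
have [V [oV Vx VP]] := near_open (orbit_van_open (orbit_termP h) h0).
pose W := Opens (openI (opensP U) oV).
have WU : W `<=` U by move=> z [].
have [d1 d2] := same_germ_sub x WU e1 e2.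
exists W => //; rewrite -d1 (_ : restr WU e = 0) ?linear0//.
apply: val_inj; apply/funext => y; rewrite -d2 [RHS]/=.
have [_ /VP/orbit_van0P] := set_valP y.
exact.
Qed.

Lemma same_germ_total r x : sec_van (idiff J 0 top r) x ->
  exists h, orbit_van 1 (cob (val h)) x /\ same_germ r h x.
Proof.
move=> [U Ux]; rewrite -smor_res => dr; have [_ ex] := iaug_exact J.
have [V [VU [Vx [e eV]]]] := ex U _ dr x Ux.
rewrite (res_comp (sub_top U) VU (sub_top V)) in eV.
move: (e : submod_type (eq_sections rho V)) eV => {}e eV.
have /asboolP[loc eqv] := valP e.
(* Extension by zero off the preimage of [V], which is stable under [Gam]. *)
pose f l : E := if l is [:: z] then
  if pselect (exists y : set_type (Defs.over V), val (val y) = z) is left p then val e (projT1 (cid p)) else 0 else 0.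
have fE (y : set_type (Defs.over V)) : f [:: val (val y)] = val e y.
  rewrite /f; case: pselect => [p|[]]; last by exists y.
  by case: cid => y' /= e'; rewrite (_ : y' = y)//; apply: val_inj; apply: val_inj.
have ef : equivariant f.
  move=> g Gg [|z [|? ?]]; rewrite /f/= ?linear0//; case: pselect => p; case: pselect => p'; rewrite ?linear0//.
  - by case: cid => y' e'; case: cid => y1 e1; apply: eqv => //; exact: etrans e' (congr1 (act g) (esym e1)).
  - case: p => y e'; case: p'; have D0z : D0 z.
      by rewrite -(actK ga Gg z) -e'; apply: (D0g (act_inv ga Gg)); exact: set_valP.
    have Vz : Defs.over V (pt D0z).
      have h : D0 (act g (val (pt D0z))) by exact: D0g.
      rewrite /Defs.over/= -(proj_act h Gg) (_ : pt h = val y); last exact: val_inj.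
      exact: (set_valP y).
    by exists (mk_over Vz).
  - case: p' => y e'; case: p; rewrite -e'; have h : D0 (act g (val (val y))) by apply: D0g => //; exact: set_valP.
    have Vz : Defs.over V (pt h) by rewrite /Defs.over/= proj_act//; exact: (set_valP y).
    by exists (mk_over Vz).
exists (orbit_mk ef); split; last by exists V, e.
move=> y yx; have : nbhs y (Defs.over V).
  by apply: open_nbhs_nbhs; split; [exact: over_open|rewrite /Defs.over/= yx].
move=> /nbhs_set_typeP[O Oy OV]; apply: filterS Oy => z Oz D0z.
have Vz : Defs.over V (pt D0z) by exact: OV.
have /nbhs_set_typeP[O1 O1z O1P] := loc (mk_over Vz).
have : nbhs (pt D0z) (Defs.over V) by apply: open_nbhs_nbhs; split => //; exact: over_open.
move=> /nbhs_set_typeP[O2 O2z O2P].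
have [O3 O3z O3P] : exists2 O3, nbhs z O3 & forall w, O3 w -> forall D0w : D0 w, forall Vw : Defs.over V (pt D0w),
    val e (mk_over Vw) = val e (mk_over Vz).
  have /nbhs_set_typeP[O3 O3z O3P] := O1z.
  by exists O3 => // w O3w D0w Vw; apply: O1P; exact: (O3P (pt D0w)).
apply: filterS2 (O2z : nbhs z O2) O3z => w O2w O3w D0w.
have Vw : Defs.over V (pt D0w) by exact: O2P.
have e1 : f [:: w] = f [:: z] := etrans (fE (mk_over Vw)) (etrans (O3P w O3w D0w Vw) (esym (fE (mk_over Vz)))).
by rewrite -[LHS]/(f [:: w] - (f [:: z] - 0)) subr0 e1 subrr.
Qed.

Lemma same_germ_surj h x : orbit_van 1 (cob (val h)) x ->
  exists r, sec_van (idiff J 0 top r) x /\ same_germ r h x.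
Proof.
move=> h0; have [V [oV Vx VP]] := near_open (orbit_van_open (equivariant_cob (orbit_termP h)) h0).
pose U := Opens oV.
pose e (y : set_type (Defs.over U)) : E := val h [:: val (val y)].
have eP : e \in submod_pred (eq_sections rho U).
  apply/asboolP; split=> [y|g Gg y y' yy']; last first.
    by rewrite /e yy' -(orbit_termP h Gg [:: _]).
  have /VP/orbit_van_singleton hy := set_valP y.
  apply/nbhs_set_typeP; exists [set z : set_type D0 | val h [:: val z] = val h [:: val (val y)]] => //.
  apply/nbhs_set_typeP; exists [set z | D0 z -> val h [:: z] = val h [:: val (val y)]].
    by apply: filterS hy => z hz /hz /=; rewrite !subr0 => /eqP; rewrite subr_eq0 => /eqP.
  by move=> z; apply; exact: set_valP.
(* Germs are represented by global sections of the resolution, so the local section has to be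
   extended. *)
have [r re] := injective_flasque (@ires_inj _ _ _ J 0) (iaug J U (Sub e eP : submod_type (eq_sections rho U))).
exists r; split; last by exists U, (Sub e eP); split.
by exists U => //; rewrite -smor_res re; have [+ _] := iaug_exact J; apply.
Qed.

Lemma sheaf_equivariant n :
  subquotient_iso (scarrier (cocycles (global_sections J) n)) (@is_coboundary _ (global_sections J) n)
    (equivariant_cocycle (act := act) (Gam := Gam) (D0 := D0) rho n)
    (equivariant_coboundary (act := act) (Gam := Gam) (D0 := D0) rho n).
Proof.
apply: subquotient_iso_trans (resolution_cohomology J n) _.
apply: subquotient_iso_trans (orbit_cohomology n).
apply: (@compatible_iso _ _ (resolution_germs J) orbit_germs same_germ).
- exact: same_germ_lin.
- exact: same_germ_open.
- exact: same_germ_van.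
- exact: same_germ_total.
- exact: same_germ_surj.
Qed.
End orbit_space_germs.

(** * The symmetric space *)

Section matrix_norm.
Context {R : realType} {n : nat}.
Implicit Types (A B C : 'M[R]_n) (e : R).

(** Submultiplicative, unlike the maximum norm that defines the topology; by [mx_nbhsP] both give
    the same neighbourhoods. *)
Definition mnorm A : R := \sum_i \sum_j `|A i j|.

Lemma mnorm_ge0 A : 0 <= mnorm A.
Proof. by apply: sumr_ge0 => i _; exact: sumr_ge0. Qed.

Lemma mnorm_entry A i j : `|A i j| <= mnorm A.
Proof.
rewrite /mnorm (bigD1 i)//= (bigD1 j)//= -addrA lerDl addr_ge0//.
  exact: sumr_ge0.
by apply: sumr_ge0 => ? _; exact: sumr_ge0.
Qed.

Lemma mnormD A B : mnorm (A + B) <= mnorm A + mnorm B.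
Proof.
rewrite /mnorm -big_split/=; apply: ler_sum => i _; rewrite -big_split/=.
by apply: ler_sum => j _; rewrite mxE ler_normD.
Qed.

Lemma mnormN A : mnorm (- A) = mnorm A.
Proof. by apply: eq_bigr => i _; apply: eq_bigr => j _; rewrite mxE normrN. Qed.

Lemma mnormM A B : mnorm (A *m B) <= mnorm A * mnorm B.
Proof.
rewrite /mnorm mulr_suml; apply: ler_sum => i _.
apply: (@le_trans _ _ (\sum_j \sum_l `|A i l| * `|B l j|)).
  apply: ler_sum => j _; rewrite mxE; apply: le_trans (ler_norm_sum _ _ _) _.
  by apply: ler_sum => l _; rewrite normrM.
rewrite exchange_big mulr_suml/=; apply: ler_sum => l _.
rewrite -mulr_sumr ler_wpM2l// [leRHS](bigD1 l)//= lerDl.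
by apply: sumr_ge0 => ? _; exact: sumr_ge0.
Qed.

Lemma mnorm_gt0 A B : A <> B -> 0 < mnorm (A - B).
Proof.
move=> AB; rewrite lt_neqAle mnorm_ge0 andbT eq_sym; apply/eqP => h; apply: AB.
apply/matrixP => i j; apply/eqP; rewrite -subr_eq0 -normr_le0.
by have := mnorm_entry (A - B) i j; rewrite h !mxE.
Qed.

Lemma mnorm_ltD A B e : mnorm (A - B) < e -> mnorm B < mnorm A + e.
Proof.
move=> h; rewrite -[B](subKr A); apply: le_lt_trans (mnormD _ _) _.
by rewrite mnormN ltrD2l.
Qed.

Lemma mx_nbhsP A (U : set 'M[R]_n) :
  nbhs A U <-> exists2 e, 0 < e & forall B, mnorm (A - B) < e -> U B.
Proof.
split=> [/nbhs_ballP[e e0 eU]|[e e0 eU]].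
  exists e => // B AB; apply: eU; split=> // i j.
  by apply: le_lt_trans AB; have := mnorm_entry (A - B) i j; rewrite !mxE.
(* There are [n * n] entries; the successor makes the final inequality strict and covers [n = 0]. *)
apply/nbhs_ballP; exists (e / (n * n).+1%:R); first by rewrite /= divr_gt0.
move=> B [_ AB]; apply: eU.
apply: (@le_lt_trans _ _ (\sum_(i < n) \sum_(j < n) e / (n * n).+1%:R)).
  apply: ler_sum => i _; apply: ler_sum => j _; rewrite !mxE; exact/ltW/AB.
rewrite !sumr_const !card_ord -mulrnA -[_ *+ (_ * _)]mulr_natr mulrAC.
by rewrite ltr_pdivrMr// ltr_pM2l// ltr_nat.
Qed.

Lemma mx_near A e : 0 < e -> \forall B \near A, mnorm (A - B) < e.
Proof. by move=> e0; apply/mx_nbhsP; exists e. Qed.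

Lemma mulmx_continuousl C : continuous (mulmx C : 'M[R]_n -> 'M[R]_n).
Proof.
move=> A U /mx_nbhsP[e e0 eU]; apply/mx_nbhsP.
have c0 : 0 < mnorm C + 1 by rewrite ltr_wpDl// mnorm_ge0.
exists (e / (mnorm C + 1)); first exact: divr_gt0.
move=> B AB; apply: eU; rewrite -mulmxBr; apply: le_lt_trans (mnormM _ _) _.
have := AB; rewrite ltr_pdivlMr// mulrC; apply: le_lt_trans.
by rewrite ler_wpM2r ?mnorm_ge0// lerDl.
Qed.

Lemma mulmx_continuousr C : continuous (mulmx^~ C : 'M[R]_n -> 'M[R]_n).
Proof.
move=> A U /mx_nbhsP[e e0 eU]; apply/mx_nbhsP.
have c0 : 0 < mnorm C + 1 by rewrite ltr_wpDl// mnorm_ge0.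
exists (e / (mnorm C + 1)); first exact: divr_gt0.
move=> B AB; apply: eU; rewrite -mulmxBl; apply: le_lt_trans (mnormM _ _) _.
have := AB; rewrite ltr_pdivlMr//; apply: le_lt_trans.
by rewrite ler_wpM2l ?mnorm_ge0// lerDl.
Qed.

Lemma compact_mnorm_bounded (K : set 'M[R]_n) : compact K ->
  exists b, forall A, K A -> mnorm A <= b.
Proof.
move=> /compact_near_coveringP cov.
suff [b [_ hb]] : \forall b \near +oo, K `<=` [set A | mnorm A <= b].
  by exists (b + 1) => A KA; apply: hb KA; rewrite ltrDl.
apply: (cov _ _ (fun b A => mnorm A <= b)) => A _.
exists ([set B | mnorm (A - B) < 1], [set b | mnorm A + 1 <= b]) => /=.
  by split; [exact: mx_near | exact/nbhs_pinfty_ge/num_real].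
by move=> [B b] /= [/mnorm_ltD/ltW h1 h2]; exact: le_trans h2.
Qed.

Lemma mulmx_separated (K : set 'M[R]_n) A B : compact K -> (forall C, K C -> A <> B *m C) ->
  exists2 e, 0 < e & forall A' B' C, mnorm (A - A') < e -> mnorm (B - B') < e -> K C ->
    A' <> B' *m C.
Proof.
move=> /compact_near_coveringP cov AB.
have : \forall e \near 0^'+, K `<=` [set C | forall A' B', mnorm (A - A') < e ->
    mnorm (B - B') < e -> A' <> B' *m C].
  apply: (cov _ _ (fun e C => forall A' B', mnorm (A - A') < e -> mnorm (B - B') < e ->
    A' <> B' *m C)) => C /AB/mnorm_gt0; set d := mnorm _ => d0.
  (* The three error terms below are at most [d / c] times 1, [mnorm C + 1] and [mnorm B], which
     together stay below [d]. *)
  pose c := mnorm C + mnorm B + 3.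
  have c0 : 0 < c by rewrite ltr_wpDl// addr_ge0 ?mnorm_ge0.
  have dc : 0 < d / c by exact: divr_gt0.
  exists ([set C' | mnorm (C - C') < Num.min 1 (d / c)], [set e | e < d / c]) => /=.
    split; first by apply: mx_near; rewrite lt_min ltr01.
    exact: nbhs_right_lt.
  move=> [C' e] /= [+ ec] A' B' AA BB E; rewrite lt_min => /andP[C1 Cd].
  have : d < d / c * c; last by rewrite divfK ?gt_eqF// ltxx.
  have dE : d = mnorm ((A - A') - (B - B') *m C' - B *m (C - C')).
    by rewrite E mulmxBl mulmxBr !opprB !subrKA.
  rewrite {1}dE.
  apply: (@le_lt_trans _ _ (mnorm (A - A') + mnorm (B - B') * mnorm C' + mnorm B * mnorm (C - C'))).
    apply: le_trans (mnormD _ _) _; rewrite mnormN; apply: lerD; last exact: mnormM.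
    by apply: le_trans (mnormD _ _) _; rewrite mnormN lerD2l; exact: mnormM.
  have C'1 : mnorm C' <= mnorm C + 1 by apply/ltW; exact: mnorm_ltD.
  apply: (@le_lt_trans _ _ (d / c * (1 + (mnorm C + 1) + mnorm B))); last first.
    rewrite ltr_pM2l// /c; lra.
  rewrite [leRHS]mulrDr; apply: lerD; last by rewrite mulrC; apply: ler_pM; rewrite ?mnorm_ge0// ltW.
  rewrite [leRHS]mulrDr mulr1; apply: lerD; first exact/ltW/(lt_trans AA).
  apply: ler_pM; rewrite ?mnorm_ge0//; exact/ltW/(lt_trans BB).
move=> h; have [e [e0 eK]] : exists e : R, 0 < e /\ K `<=` [set C | forall A' B',
    mnorm (A - A') < e -> mnorm (B - B') < e -> A' <> B' *m C].
  by near (0 : R)^'+ => e; exists e; split; near: e; [exact: nbhs_right_gt | exact: h].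
by exists e => // A' B' C AA BB KC; exact: eK.
Unshelve. all: by end_near. Qed.

Lemma invmx_bounded A : A \in unitmx -> exists e b, [/\ 0 < e, 0 <= b &
  forall B, B \in unitmx -> mnorm (A - B) < e -> mnorm (invmx B) <= b].
Proof.
move=> uA; pose c := mnorm (invmx A) + 1.
have c0 : 0 < c by rewrite ltr_wpDl// mnorm_ge0.
exists (2 * c)^-1, (2 * c); split; [by rewrite invr_gt0 mulr_gt0|by rewrite mulr_ge0// ltW|].
move=> B uB AB; set b := mnorm (invmx B).
(* With radius [(2 * c)^-1] the second term has norm at most half of [b], which gives
   [b <= 2 * c]. *)
have e : invmx B = invmx A + invmx B *m (A - B) *m invmx A.
  by rewrite mulmxBr mulVmx// mulmxBl mul1mx mulmxK// addrCA subrr addr0.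
have b0 : 0 <= b by exact: mnorm_ge0.
have : b <= c + b * (2 * c)^-1 * c.
  rewrite {1}/b e; apply: le_trans (mnormD _ _) _; apply: lerD; first by rewrite lerDl.
  apply: le_trans (mnormM _ _) _; apply: ler_pM; rewrite ?mnorm_ge0 ?lerDl//.
  apply: le_trans (mnormM _ _) _; apply: ler_pM; rewrite ?mnorm_ge0//; exact: ltW.
rewrite invfM mulrA divfK ?gt_eqF// => h.
have : b - b / 2 <= c by rewrite lerBlDr.
by rewrite {1}(splitr b) addrK ler_pdivrMr// mulrC.
Qed.
End matrix_norm.

Lemma bounded_integral_finite (n b : nat) : exists L : seq 'M[rat]_n, forall A : 'M[rat]_n,
  (forall i j, A i j \is a Num.int) -> (forall i j, `|A i j| <= b%:R) -> A \in L.
Proof.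
pose f (M : 'M['I_(b + b).+1]_n) : 'M[rat]_n := \matrix_(i, j) ((M i j : nat)%:R - b%:R).
exists [seq f M | M <- enum {: 'M['I_(b + b).+1]_n}] => A Ai Ab.
have ex i j : exists m : 'I_(b + b).+1, A i j = (m : nat)%:R - b%:R.
  have /intrP[z Az] := Ai i j; move: (Ab i j); rewrite Az ler_norml.
  rewrite -[b%:R]/((b%:Z)%:~R) -mulrNz !ler_int => /andP[z1 z2].
  have zb : 0 <= z + b%:Z by rewrite -lerBlDr sub0r.
  have zn : (absz (z + b%:Z)%R < (b + b).+1)%N.
    by rewrite ltnS -lez_nat gez0_abs// PoszD lerD2r.
  exists (Ordinal zn); have -> : ((Ordinal zn : nat)%:R : rat) = (z + b%:Z)%:~R.
    by rewrite -[in RHS](gez0_abs zb).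
  by rewrite rmorphD/= mulrNz addrK.
pose M : 'M['I_(b + b).+1]_n := \matrix_(i, j) projT1 (cid (ex i j)).
apply/mapP; exists M; first by rewrite mem_enum.
by apply/matrixP => i j; rewrite !mxE; case: cid.
Qed.

Lemma meval_map_ratr (F : numFieldType) m (v : 'I_m -> F) (q : mpoly.mpoly m rat) :
  mpoly.meval v (mpoly.map_mpoly ratr q) =
  \sum_(l <- mpoly.msupp q) ratr (mpoly.mcoeff l q) * \prod_i v i ^+ mpoly.fun_of_multinom l i.
Proof.
rewrite mpoly.mevalE (perm_big _ (mpoly.msupp_map_mpoly q (@fmorph_inj _ _ ratr)))/=.
by apply: eq_bigr => l _; rewrite mpoly.mcoeff_map_mpoly.
Qed.

Lemma points_map (F F' : numFieldType) (f : {rmorphism F -> F'}) n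
    (P : set (mpoly.mpoly (n * n) rat)) (g : 'M[F]_n) :
  points P F' (map_mx f g) <-> points P F g.
Proof.
have e q : mx_eval (mpoly.map_mpoly ratr q) (map_mx f g) =
    f (mx_eval (mpoly.map_mpoly ratr q) g).
  rewrite /mx_eval !meval_map_ratr rmorph_sum/=; apply: eq_bigr => l _.
  rewrite rmorphM/= fmorph_rat rmorph_prod; congr (_ * _); apply: eq_bigr => i _.
  by rewrite rmorphXn/= -map_mxvec mxE.
rewrite /points/= map_unitmx; split=> -[ug h]; split=> // q Pq.
  by apply/eqP; rewrite -(fmorph_eq0 f) -e h.
by rewrite e h// rmorph0.
Qed.

Lemma points_subgroup (R : realType) n (P : set (mpoly.mpoly (n * n) rat)) :
  subgroup (points P R[i]) -> subgroup (points P R).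
Proof.
have pm (g : 'M[R]_n) : points P R[i] (map_mx (real_complex R) g) <-> points P R g.
  exact: (points_map (real_complex R)).
move=> [s1 s2 s3 s4]; split.
- by move=> g [].
- by apply/pm; rewrite map_mx1.
- by move=> g h /pm ? /pm ?; apply/pm; rewrite map_mxM; exact: s3.
- by move=> g /pm ?; apply/pm; rewrite map_invmx; exact: s4.
Qed.

(** * Separation, first countability and slices in the symmetric space *)

Section symmetric_space_topology.
Context {R : realType} {n : nat} {P : set (mpoly.mpoly (n * n) rat)} {K : set 'M[R]_n}.
Local Notation G := (points P R).
Hypothesis sG : subgroup G.
Hypothesis sK : subgroup K.
Hypothesis KG : K `<=` G.
Hypothesis cK : compact K.
Local Notation D := (symmetric_space G K).
Local Notation act := (@symmetric_space_act R n G K).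
Implicit Types (g h u v : set_type G) (x : D).

Definition grp (a : 'M[R]_n) (Ga : G a) : set_type G := SigSub (mem_set Ga).

Lemma base_eq g h : base_proj K g = base_proj K h <-> exists2 k, K k & val g = val h *m k.
Proof.
have [sK1 sK2 sK3 sK4] := sK.
split=> [/quot_projP e|[k Kk e]].
  have : left_coset K g (val g) by exists 1%:M; rewrite ?mulmx1.
  by rewrite e => -[k Kk <-]; exists k.
apply/quot_projP; apply/seteqP; split=> _ [c Kc <-].
  by exists (k *m c); [exact: sK3 | rewrite e mulmxA].
exists (invmx k *m c); first exact/sK3/Kc/sK4.
by rewrite e -mulmxA mulKVmx//; exact: sK1.
Qed.

Lemma base_surj x : exists g, base_proj K g = x.
Proof. by exists (repr x); exact: reprK. Qed.

Lemma base_continuous : continuous (@base_proj R n G K).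
Proof. exact: pi_continuous. Qed.

Lemma base_near (U : set 'M[R]_n) g : nbhs (val g) U ->
  \forall x \near base_proj K g, exists2 h, base_proj K h = x & U (val h).
Proof.
rewrite nbhsE => -[O [oO Og] OU].
pose V : set D := [set x | exists2 h, base_proj K h = x & O (val h)].
have [sG1 sG2 sG3 sG4] := sG; have [sK1 sK2 sK3 sK4] := sK.
have oV : open V.
  change (open (@base_proj R n G K @^-1` V)).
  have -> : @base_proj R n G K @^-1` V = \bigcup_(k in K) [set h | O (val h *m k)].
    apply/seteqP; split=> h /=.
      by move=> [u /base_eq[k Kk e] Ou]; exists k => //=; rewrite -e.
    move=> [k Kk Oh]; have Ghk := sG3 _ _ (set_valP h) (KG Kk).
    by exists (grp Ghk) => //; apply/base_eq; exists k.
  apply: bigcup_open => k Kk; exists (mulmx^~ k @^-1` O) => //.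
  by apply: open_comp => // a _; exact: mulmx_continuousr.
have Vg : V (base_proj K g) by exists g.
apply: filterS (open_nbhs_nbhs (conj oV Vg)) => x [h <- Oh].
by exists h => //; exact: OU.
Qed.

Lemma symmetric_space_hausdorff : hausdorff_space D.
Proof.
move=> x y xy; have [g gx] := base_surj x; have [h hy] := base_surj y.
apply: contrapT => nxy.
have [|e e0 sep] := @mulmx_separated R n K (val g) (val h) cK.
  by move=> k Kk e; apply: nxy; rewrite -gx -hy; apply/base_eq; exists k.
have := xy _ _ _ _.
have gU := base_near (mx_near (val g) e0); have hU := base_near (mx_near (val h) e0).
rewrite gx in gU; rewrite hy in hU.
move=> /(_ _ _ gU hU)[z [[u <- gu] [v /base_eq[k Kk e1] hv]]].
have [_ _ _ sK4] := sK; have [ uK _ _ _] := sK.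
apply: (sep (val u) (val v) (invmx k)) => //; first exact: sK4.
by rewrite e1 mulmxK//; exact: uK.
Qed.

Lemma symmetric_space_countable x : exists W : nat -> set D, (forall i, nbhs x (W i)) /\
  forall U, nbhs x U -> exists i, W i `<=` U.
Proof.
have [g <-] := base_surj x.
exists (fun i => [set y | exists2 h, base_proj K h = y & mnorm (val g - val h) < i.+1%:R^-1]).
split=> [i|U /base_continuous/nbhs_set_typeP[W Wg WU]].
  by apply: (@base_near [set a | mnorm (val g - a) < _]); exact: mx_near.
have [e e0 eW] := (mx_nbhsP _ _).1 Wg.
have [i _ /(_ i (leqnn i)) ie] := near_infty_natSinv_lt (PosNum e0).
exists i => _ [h <- gh]; apply: WU; apply: eW; exact: lt_trans ie.
Qed.

Context {Gam : set 'M[rat]_n}.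
Hypothesis sGam : subgroup Gam.
Hypothesis GamP : Gam `<=` points P rat.
Hypothesis GamC : commensurable Gam (integral_points P).

Lemma points_ratr (a : 'M[rat]_n) : Gam a -> G (map_mx ratr a).
Proof.
by move=> /GamP Pa; have [_] := points_map (F := rat) (F' := R) ratr P a; apply.
Qed.

Lemma act_base a g : Gam a -> exists2 h, val h = map_mx ratr a *m val g &
  act a (base_proj K g) = base_proj K h.
Proof.
have [_ _ sG3 _] := sG.
move=> Ga; have Gh := sG3 _ _ (points_ratr Ga) (set_valP g).
by exists (grp Gh) => //; exact: symmetric_space_actE.
Qed.

Lemma base_ext g h : val g = val h -> base_proj K g = base_proj K h.
Proof. by move=> gh; congr base_proj; exact: val_inj. Qed.

Lemma symmetric_space_action : action act Gam 1%:M mulmx invmx.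
Proof.
have [u1 u2 u3 u4] := sGam.
have a1 x : act 1%:M x = x.
  have [g <-] := base_surj x; have [h hg ->] := act_base g u2.
  by apply: base_ext; rewrite hg map_mx1 mul1mx.
have aM a b x : Gam a -> Gam b -> act (a *m b) x = act a (act b x).
  move=> Ga Gb; have [g <-] := base_surj x; have [h hg ->] := act_base g Gb.
  have [h' hh' ->] := act_base h Ga; have [v vg ->] := act_base g (u3 _ _ Ga Gb).
  by apply: base_ext; rewrite vg hh' hg map_mxM mulmxA.
split=> //.
- by move=> a Ga x; rewrite -aM ?mulVmx ?a1//; [exact: u1|exact: u4].
- by move=> a Ga x; rewrite -aM ?mulmxV ?a1//; [exact: u1|exact: u4].
- move=> a Ga; apply/quotient_continuous => g.
  move=> U; have [h hg /= e] := act_base g Ga.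
  change (nbhs (act a (base_proj K g)) U -> nbhs g [set v | U (act a (base_proj K v))]).
  rewrite e => /base_continuous/nbhs_set_typeP[W Wh WU].
  apply/nbhs_set_typeP; exists (mulmx (map_mx ratr a) @^-1` W).
    by apply: mulmx_continuousl; rewrite -hg.
  move=> v Wv; have [w wv ev] := act_base v Ga.
  by rewrite /= ev; apply: WU; rewrite wv.
Qed.

(** Elements are integral up to finitely many coset representatives, which distort bounds by at most
    the factor [c]; integral matrices with bounded entries are finite in number. *)
Lemma bounded_finite (b : R) : exists L : seq 'M[rat]_n, forall a, Gam a ->
  mnorm (map_mx (ratr : rat -> R) a) <= b -> a \in L.
Proof.
have [[_ [s sP]] _] := GamC.
have [u1 u2 u3 u4] := sGam.
pose c := \sum_(d <- s) mnorm (map_mx (ratr : rat -> R) (invmx d)).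
pose m := Num.bound (c * b).
have [L LP] := bounded_integral_finite n m.
exists [seq (d : 'M[rat]_n) *m l | d <- s, l <- L] => a Ga ab.
have [d ds [Gd [_ [_ di]]]] := sP a Ga.
apply/allpairsP; exists (d, invmx d *m a); split=> //=; last by rewrite mulKVmx//; exact: u1.
have b0 : 0 <= b by exact: le_trans (mnorm_ge0 _) ab.
have hc : mnorm (map_mx (ratr : rat -> R) (invmx d)) <= c.
  by rewrite /c (big_rem d)//= lerDl; apply: sumr_ge0 => i _; exact: mnorm_ge0.
apply: LP => i j; first by have /andP[] := di i j.
rewrite -(ler_rat R) ratr_nat ratr_norm.
have -> : ratr ((invmx d *m a) i j) = (map_mx (ratr : rat -> R) (invmx d *m a)) i j by rewrite [RHS]mxE.
apply: le_trans (mnorm_entry _ _ _) _; rewrite map_mxM; apply: le_trans (mnormM _ _) _.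
apply: (@le_trans _ _ (c * b)); first by apply: ler_pM => //; exact: mnorm_ge0.
apply/ltW/archi_boundP; apply: mulr_ge0 => //; exact: le_trans (mnorm_ge0 _) hc.
Qed.

(* Proper discontinuity: an element moving a small ball close to itself is
   bounded, and a discrete group has finitely many bounded elements. *)
Lemma symmetric_space_slice x : exists2 W, nbhs x W &
  forall a y, Gam a -> W y -> W (act a y) -> act a x = x.
Proof.
have ga := symmetric_space_action.
have [sG1 _ sG3 _] := sG.
(* Finitely many elements are handled one at a time, separating [x] from [act a x] when they
   differ. *)
have shrink (L : seq 'M[rat]_n) : exists2 W, nbhs x W & forall a y, a \in L -> Gam a ->
    W y -> W (act a y) -> act a x = x.
  elim: L => [|a L [W Wx WP]]; first by exists setT => //; exact: filterT.
  have [Ga|nGa] := pselect (Gam a); last first.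
    exists W => // b y; rewrite inE => /orP[/eqP ->//|]; exact: WP.
  have [ax|ax] := pselect (act a x = x).
    exists W => // b y; rewrite inE => /orP[/eqP ->//|]; exact: WP.
  have [A [B [Ax Bx AB]]] : exists A B, [/\ nbhs x A, nbhs (act a x) B & A `&` B = set0].
    apply: contrapT => h; apply: ax; apply/esym/symmetric_space_hausdorff => A B Ax Bx.
    by apply/set0P/eqP => AB; apply: h; exists A, B.
  exists (W `&` (A `&` (act a @^-1` B))).
    by apply: filterI => //; apply: filterI => //; exact: (act_continuous ga Ga).
  move=> b y; rewrite inE => /orP[/eqP -> _ [_ [_ By]] [_ [Ay _]]|bL Gb [Wy _] [Wy' _]].
    by have : (A `&` B) (act a y) by []; rewrite AB.
  exact: WP Wy Wy'.
have [g gx] := base_surj x.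
have [e [b [e0 b0 invb]]] := invmx_bounded (sG1 _ (set_valP g)).
have [c cP] := compact_mnorm_bounded cK.
(* The three factors bound [val v], [k] and [invmx (val u)], whose product is the matrix of [a]. *)
have [L LP] := bounded_finite ((mnorm (val g) + e) * c * b).
have [W Wx WP] := shrink L.
exists (W `&` [set y | exists2 h, base_proj K h = y & mnorm (val g - val h) < e]).
  apply: filterI => //; rewrite -gx.
  by apply: (@base_near [set u | mnorm (val g - u) < e]); exact: mx_near.
move=> a y Ga [Wy [u uy gu]] [Wy' [v vy gv]]; apply: WP Wy Wy' => //; apply: LP => //.
have [h hu] := act_base u Ga; rewrite uy -vy => /esym/base_eq[k Kk vk].
have uU := sG1 _ (set_valP u).
have -> : map_mx ratr a = val v *m k *m invmx (val u).
  by rewrite -vk hu mulmxK.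
apply: le_trans (mnormM _ _) _; apply: ler_pM; rewrite ?mnorm_ge0//; last exact: invb.
apply: le_trans (mnormM _ _) _; apply: ler_pM; rewrite ?mnorm_ge0//; last exact: cP.
exact/ltW/mnorm_ltD.
Qed.
End symmetric_space_topology.

(** * Local finiteness of the cell structure *)

Section regular_complex.
Context {R : realType} {D : topologicalType}.
Hypothesis hD : hausdorff_space D.
Hypothesis fcD : forall x : D, exists W : nat -> set D, (forall i, nbhs x (W i)) /\
  forall U, nbhs x U -> exists i, W i `<=` U.
Context {D0 : set D} {cells : nat -> set (set D)}.
Hypothesis cw : regular_cw_structure (R := R) D0 cells.
Implicit Types s t : set D.

Lemma cw_bdry p s : cells p s -> exists B : seq (set D),
  (forall t, t \in B -> exists2 q, (q < p)%N & cells q t) /\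
  (forall x, bdry s x <-> exists2 t, t \in B & t x).
Proof.
have [_ _ _ h _] := cw; move=> /h[_ /finite_seqP[B ->] [BP ->]].
by exists B; split=> [t /BP//|x]; split=> [[t tB tx]|[t tB tx]]; exists t.
Qed.

(* In a weak topology a set meeting every closed cell in a finite set is closed;
   by first countability, infinitely many cells accumulating at x would
   produce such a set having x as a limit point. *)
Lemma cw_locally_finite p s x : cells p s -> s x -> exists L : seq (set D),
  \forall y \near x, forall q t, cells q t -> t y -> t \in L.
Proof.
move=> ps sx; have [D0E disj _ _ weak] := cw; have [W [Wx WU]] := fcD x.
apply: contrapT => nL.
have ex (c : seq (set D) * nat) : exists yt : D * set D,
    [/\ W c.2 yt.1, exists q, cells q yt.2, yt.2 yt.1 & yt.2 \notin c.1].
  apply: contrapT => h; apply: nL; exists c.1; apply: filterS (Wx c.2) => y Wy q t qt ty.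
  by apply/negPn/negP => tL; apply: h; exists (y, t); split=> //; exists q.
have [f fP] := choice ex.
(* Starting from [s] keeps every [t i] different from the cell of [x], so [x] is a limit point of
   [A] that does not belong to it. *)
pose L := fix L i := if i is j.+1 then (f (L j, j)).2 :: L j else [:: s].
pose y i := (f (L i, i)).1; pose t i := (f (L i, i)).2.
have yP i : [/\ W i (y i), exists q, cells q (t i), t i (y i) & t i \notin L i] := fP (L i, i).
have sL i : s \in L i by elim: i => [|i IH] /=; rewrite inE ?eqxx// IH orbT.
have tL i j : (i < j)%N -> t i \in L j.
  elim: j => // j IH; rewrite ltnS leq_eqVlt /= inE => /orP[/eqP ->|/IH ->]; last by rewrite orbT.
  by rewrite eqxx.
have tinj : injective t.
  move=> i j tij; case: (ltngtP i j) => // /tL; rewrite ?tij => h.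
    by have [_ _ _] := yP j; rewrite h.
  by have [_ _ _] := yP i; rewrite tij h.
pose A := range y.
have AD0 : A `<=` D0.
  by move=> _ [i _ <-]; have [_ [q qt] ty _] := yP i; rewrite D0E; exists q => //; exists (t i).
have Acl q u : cells q u -> closed (A `&` closure u).
  move=> qu; apply: (accessible_finite_set_closed.1 (hausdorff_accessible hD)).
  have [B [BP Bu]] := cw_bdry qu.
  have fin : finite_set [set i | t i \in u :: B].
    apply: (@finite_preimage _ _ [set v | v \in u :: B] t); first by move=> ? ? _ _; exact: tinj.
    exact: finite_seq.
  apply: sub_finite_set (finite_image y fin) => _ [[i _ <-] cy].
  exists i => //=; have [_ [q' qt] ty _] := yP i; rewrite inE.
  have [/esym/= ut|nu] := pselect (t i = u); first by rewrite ut eqxx.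
  apply/orP; right; have uy : bdry u (y i).
    by split=> // uy; apply: nu; have [] := disj _ _ _ _ qt qu _; first by exists (y i).
  have [v vB vy] := (Bu _).1 uy; have [q2 _ qv] := BP _ vB.
  by have [_ ->] := disj _ _ _ _ qt qv (ex_intro _ (y i) (conj ty vy)).
have [C cC AE] := weak A AD0 Acl.
have xC : C x.
  apply: cC => U /WU[i Wi]; exists (y i); split; last by apply: Wi; have [] := yP i.
  by have : A (y i) by [exists i]; rewrite AE => -[].
have : A x by rewrite AE; split=> //; rewrite D0E; exists p => //; exists s.
move=> [i _ yx]; have [_ [q qt] ty /negP] := yP i; apply.
by rewrite (_ : t i = s)//; have [] := disj _ _ _ _ qt ps _; first by exists x; split; rewrite // -yx.
Qed.

Lemma cw_cell_complex : cell_complex cells.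
Proof.
have [D0E disj chr bd _] := cw; split.
- exact: disj.
- by move=> p s ps; have [phi [cphi iphi phis]] := chr p s ps; exact: (cell_nonempty phis).
- move=> s /chr[phi [_ _ <-]]; exists (phi 0); apply/seteqP; split=> [_ [v _ <-]|_ ->].
    by congr phi; apply/rowP => -[].
  by exists 0 => //; rewrite /open_unit_ball/= big_ord0 ltr01.
- exact: cw_bdry.
- move=> p s ps; have [phi [cphi iphi phis]] := chr p s ps; exact: (cell_bdry_closed hD cphi iphi phis).
- move=> M p s n ps; have [phi [cphi iphi phis]] := chr p s ps; exact: (cell_acy hD cphi iphi phis).
- move=> M p s n ps; have [phi [cphi iphi phis]] := chr p s ps; exact: (cell_bdry_acy hD cphi iphi phis).
- move=> M p s A n ps; have [phi [cphi iphi phis]] := chr p s ps; exact: (cell_bdry_proper_acy hD cphi iphi phis).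
- exact: cw_locally_finite.
Qed.
End regular_complex.

Theorem theorem10p7 (R : realType) (n : nat)
    (P : set (mpoly.mpoly (n * n) rat)) (K : set 'M[R]_n)
    (Gam : set 'M[rat]_n) (D0 : set (symmetric_space (points P R) K))
    (cells : nat -> set (set (symmetric_space (points P R) K))) (N : nat)
    (k : nzRingType) (E : lmodType k) (rho : 'M[rat]_n -> {linear E -> E})
    (reps : nat -> set (set (symmetric_space (points P R) K)))
    (rep : set (symmetric_space (points P R) K) ->
           set (symmetric_space (points P R) K))
    (flag : set (symmetric_space (points P R) K) ->
            seq (set (symmetric_space (points P R) K)))
    (gam : set (symmetric_space (points P R) K) -> 'M[rat]_n)
    (nsgn : set (symmetric_space (points P R) K) ->
            seq (set (symmetric_space (points P R) K)) -> int) :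
  let D := symmetric_space (points P R) K in
  let act : 'M[rat]_n -> D -> D := @symmetric_space_act R n (points P R) K in
  semisimple_algebraic_group P R ->
  maximal_compact_subgroup (points P R) K ->
  ~ compact [set: D] ->
  arithmetic_subgroup P Gam ->
  equivariant_deformation_retract (R := R) act Gam D0 ->
  regular_cw_structure (R := R) D0 cells ->
  equivariant_cells act Gam cells ->
  cw_dimension cells N ->
  virtual_cohomological_dimension Gam N ->
  representation Gam rho ->
  cell_representatives act Gam cells reps rep ->
  distinguished_flags cells reps flag ->
  transporters act Gam cells rep flag gam ->
  flag_orientation act cells rep flag gam nsgn ->
  let C := cellular_complex act Gam cells rho reps rep flag gam nsgn in
  is_complex C /\
  forall (J : injective_resolution (equivariant_sheaf act Gam D0 rho)) (p : nat),
    isomorphic (sheaf_cohomology J p) (cohomology C p).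
Proof.
move=> D act [sGC _] [sK KG cK _] _ [sGam GamP GamC] _ cw ec cdim _ [rho1 rhoM] cr df tr fo C.
have sG := points_subgroup sGC; have [u1 _ _ _] := sGam.
have ga : action act Gam 1%:M mulmx invmx by exact: symmetric_space_action.
have hD : hausdorff_space D by exact: symmetric_space_hausdorff.
have cc : cell_complex cells.
  by apply: (cw_cell_complex hD _ cw); exact: symmetric_space_countable.
have [D0E _ _ _ _] := cw; have [ec1 _] := ec.
have D0g g x : Gam g -> D0 x -> D0 (act g x).
  move=> Gg; rewrite D0E => -[q _ [s qs sx]]; exists q => //.
  by exists (translate act g s); [exact: ec1|exists x].
have mulV (g : 'M[rat]_n) : Gam g -> g *m invmx g = 1%:M by move=> /u1; exact: mulmxV.
have mulVg (g : 'M[rat]_n) : Gam g -> invmx g *m g = 1%:M by move=> /u1; exact: mulVmx.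
split; first exact: (cellular_is_complex ga hD cc D0E ec rho1 rhoM mulV mulVg cr df tr fo).
move=> J p; apply: isomorphic_cohomology.
apply: subquotient_iso_trans (equivariant_cellular ga hD cc D0E ec cdim rho1 rhoM mulV mulVg cr df tr fo p).
apply: (sheaf_equivariant ga D0g _ rho1 rhoM mulV mulVg J p) => x _.
exact: (symmetric_space_slice sG sK KG cK sGam GamP GamC).
Qed.
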